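(* Let $q$ be a prime power, let $m,d\geq 1$ be integers and let $r$ be an integer with $1\leq r\leq \binom{m+d-1}{d-1}$. If $q\geq (d-1)^2$, then $$e_r(d,m)=H_r(d-1,m)+\pi_{m-1}.$$
   Context: $\mathbb{F}_q$ is the finite field with $q$ elements and $\overline{\mathbb{F}}_q$ its algebraic closure. $S_d(m)$ is the $\mathbb{F}_q$-vector space of homogeneous polynomials of degree $d$ in $\mathbb{F}_q[x_0,\dots,x_m]$ (together with $0$). For homogeneous $F_1,\dots,F_r$, $V(F_1,\dots,F_r)\subseteq\mathbb{P}^m(\overline{\mathbb{F}}_q)$ is their common zero set and $V(F_1,\dots,F_r)(\mathbb{F}_q)$ is its set of $\mathbb{F}_q$-rational points. For $1\le r\le\binom{m+d}{d}$, $$e_r(d,m)=\max\{|V(F_1,\dots,F_r)(\mathbb{F}_q)| : F_1,\dots,F_r\in S_d(m)\text{ linearly independent over }\mathbb{F}_q\}.$$ $\pi_m=\sum_{i=0}^m q^i$ for $m\ge 0$. For integers $d\ge 0$, $m\geq 1$, $\Omega(d,m)$ is the set of $(\gamma_1,\dots,\gamma_{m+1})\in\mathbb{N}^{m+1}$ (with $0\in\mathbb{N}$) such that $\sum_{i=1}^{m+1}\gamma_i=d$. For $1\leq r\leq\binom{m+d}{d}$, if $(\beta_1,\dots,\beta_{m+1})$ is the $r$-th largest element of $\Omega(d,m)$ in the lexicographic order, then $H_r(d,m)=\sum_{i=1}^m\beta_iq^{m-i}$. *)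

(* Defs.v *)
From mathcomp Require Export all_boot all_order all_algebra all_field.
From mathcomp Require Export mpoly.

Set Implicit Arguments.
Unset Strict Implicit.
Unset Printing Implicit Defensive.

Import Order.TTheory GRing.Theory.
Local Open Scope ring_scope.

Section ProjectiveZeros.
Variables (F : finFieldType) (m : nat).

Definition proportional (x y : 'rV[F]_m.+1) : bool :=
  [exists c : F, (c != 0) && (y == c *: x)].

(* P^m(F): a point is the set of its nonzero homogeneous coordinate vectors. *)
Definition proj_space : {set {set 'rV[F]_m.+1}} :=
  equivalence_partition proportional [set x | x != 0].

Definition vanishes_at (f : {mpoly F[m.+1]}) (p : {set 'rV[F]_m.+1}) : bool :=
  [forall x in p, f.@[x ord0] == 0].

(* The F-rational points of the common zero set of the t_i in P^m over an
   algebraic closure of F, i.e. the points of P^m(F) where all t_i vanish. *)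
Definition rational_zeros (d r : nat) (t : r.-tuple (dhomog m.+1 F d)) :
    {set {set 'rV[F]_m.+1}} :=
  [set p in proj_space | [forall i, vanishes_at (tnth t i) p]].

(* [finvect_type] only makes the space of degree d forms a finite type.  The
   index set of the maximum is nonempty exactly when r <= 'C(m + d, d). *)
Definition max_rational_zeros (r d : nat) : nat :=
  \max_(t : r.-tuple (finvect_type (dhomog m.+1 F d)) | free t)
    #|rational_zeros t|.

End ProjectiveZeros.

Definition proj_card (q m : nat) : nat := (\sum_(i < m.+1) q ^ i)%N.

(* The entries of an (m+1)-tuple of naturals of sum d are at most d, so the
   entries may be taken in 'I_d.+1.  The [tuplelexi] order is lexicographic,
   with the first entry the most significant. *)
Definition Omega (d m : nat) : {set m.+1.-tuplelexi 'I_d.+1} :=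
  [set g : m.+1.-tuplelexi 'I_d.+1 | (\sum_(i < m.+1) tnth g i)%N == d].

(* The r-th largest element of Omega d m, for 1 <= r <= #|Omega d m|; the
   default value of [nth] is irrelevant in this range. *)
Definition Omega_nth (r d m : nat) : m.+1.-tuplelexi 'I_d.+1 :=
  nth [tuple ord0 | i < m.+1] (sort >=%O (enum (Omega d m))) r.-1.

(* Indices are shifted: entry i here is beta_(i+1). *)
Definition Hr (q r d m : nat) : nat :=
  (\sum_(i < m) tnth (Omega_nth r d m) (widen_ord (leqnSn m) i)
                * q ^ (m - i.+1))%N.

(* Main.v *)
Require Import Defs.
From HB Require Import structures.
From mathcomp Require Import zify ring.

Set Implicit Arguments.
Unset Strict Implicit.
Unset Printing Implicit Defensive.

Import Order.TTheory GRing.Theory.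

(* Write e = d - 1, so that e ^ 2 <= q.

   Affine bound.  The standard monomials of a set X of points of F^m form a down-set
   of #|X| exponent vectors with entries < q.  Among the down-sets of N vectors, the N
   lexicographically smallest vectors form the one with the fewest members of degree
   at most e (this uses e ^ 2 <= q).  Hence a space W of polynomials of degree at most e
   vanishing on N points has dimension at most the number of vectors of degree at most
   e that are not among the N smallest ones.

   Projective bound, by induction on m.  If no hyperplane h contributes too many forms
   of W vanishing on h, average over the sections by all hyperplanes.  Otherwise take
   such an h: the section by h is bounded by induction, and the points off h are zeros
   of the quotients by h of the forms vanishing on h, which have degree at most e.
   The affine bound for these quotients is too weak only for spaces that are extremal
   up to a hyperplane, and a stability version of it shows that this does not occur.

   Lower bound.  For g in Omega, let f_g be x_0 times the product of g_i factors
   x_i - a_j x_0 with distinct a_j in F.  The forms f_g for the r largest g vanish on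
   the hyperplane x_0 = 0 and at every affine point (a_(s_1), ..., a_(s_m)) such that
   s is lexicographically smaller than the first m entries of the r-th largest g. *)

(** * Down-sets of digit vectors *)

(** Upper bounds are proved in inverse form, r <= [tail_count] q m e N, which yields N <= H_r by
    [tail_count_Hr]; dimensions then add up along a hyperplane section, as [tail_count] and [pdim]
    do by Pascal's rule. The number j with pdim m j < r <= pdim m j.+1 fixes the leading digit e - j
    of H_r.

    The obstacle, in a chart of dimension n + 1, is a hyperplane dividing more than pdim n.+1 j.-1
    but at most pdim n.+1 j dimensions of W. The affine bound for the quotients then overshoots the
    available (e - j + 1) q ^ n by terms in q ^ (n - 1), and the section brings up to e q ^ (n - 1)
    more. Stability lowers the leading coefficient by one at the price of a term e ^ 2 q ^ (n - 1),
    which covers the section as well unless e = j.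

    The condition e ^ 2 <= q serves twice: it absorbs that term, and it lets a planar down-set
    inside an e by e square fit into one line of q vectors, the critical case of the planar
    count. *)

Lemma sum_mul_ord (a b : nat) (F : nat -> nat) :
  \sum_(n < a * b) F n = \sum_(i < a) \sum_(j < b) F (i * b + j).
Proof.
elim: a => [|a IH]; first by rewrite !big_ord0.
by rewrite mulSnr big_split_ord /= IH big_ord_recr.
Qed.

Definition nsize (M : nat) (A : pred nat) : nat := \sum_(n < M) A n.
Definition nsum (M : nat) (A : pred nat) : nat := \sum_(n < M) A n * n.

Lemma nsize_le M A : nsize M A <= M.
Proof.
rewrite -[leqRHS]card_ord -sum1_card.
by apply: leq_sum => i _; case: (A i).
Qed.

Lemma nsize_ltn M N : N <= M -> nsize M (fun n => n < N) = N.
Proof.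
move=> le_NM; rewrite /nsize -(subnKC le_NM) big_split_ord /=.
rewrite (eq_bigr (fun=> 1)) => [|i _]; last by rewrite ltn_ord.
rewrite [X in _ + X]big1 => [|i _]; last by rewrite ltnNge leq_addr.
by rewrite sum_nat_const card_ord muln1 addn0.
Qed.

Lemma leq_sum_eq (M : nat) (F G : nat -> nat) :
  (forall n, n < M -> F n <= G n) -> \sum_(n < M) G n <= \sum_(n < M) F n ->
  forall n, n < M -> F n = G n.
Proof.
move=> leFG leGF n ltnM.
have := leFG n ltnM; rewrite leq_eqVlt => /orP[/eqP//|lt].
move: leGF; rewrite (bigD1 (Ordinal ltnM)) //= [leqRHS](bigD1 (Ordinal ltnM)) //=.
have: \sum_(i < M | i != Ordinal ltnM) F i <= \sum_(i < M | i != Ordinal ltnM) G i.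
  by apply: leq_sum => i _; apply: leFG.
by set a := \sum_(i < M | _) F i; set b := \sum_(i < M | _) G i; lia.
Qed.

Lemma nsize_sub (M : nat) (A B : pred nat) :
  (forall n, n < M -> A n -> B n) -> nsize M A <= nsize M B.
Proof.
by move=> AB; apply: leq_sum => i _; have := AB i (ltn_ord i); case: (A i) => // ->.
Qed.

(** Termwise (n - N) * ([n < N] - A n) <= 0 with N the size of [A]; on summing, the multiples of N
    cancel because both sets have N members. *)
Lemma nsum_seg M A : nsum M (fun n => n < nsize M A) <= nsum M A.
Proof.
set N := nsize M A.
have: nsum M (fun n => n < N) + \sum_(n < M) A n * N
      <= nsum M A + \sum_(n < M) (n < N) * N.
  rewrite /nsum -!big_split /=; apply: leq_sum => i _.
  by case: (A i); case: ltnP; lia.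
rewrite -!big_distrl /= -/(nsize M A) -/(nsize M (fun n => n < N)).
by rewrite nsize_ltn ?nsize_le // leq_add2r.
Qed.

(** Equality case of [nsum_seg]. The sum of the elements is the potential of the compression
    argument: a compression that does not lower it has left every slice unchanged. *)
Lemma nsum_seg_eq M A : nsum M A <= nsum M (fun n => n < nsize M A) ->
  forall n, n < M -> A n = (n < nsize M A).
Proof.
set N := nsize M A => le_sum.
have seg_size : nsize M (fun n => n < N) = N by rewrite nsize_ltn ?nsize_le.
have eqn n : n < M -> (n < N) * n + A n * N = A n * n + (n < N) * N.
  move=> ltnM.
  apply: (leq_sum_eq (F := fun n => (n < N) * n + A n * N)
                     (G := fun n => A n * n + (n < N) * N)) (ltnM).
    by move=> k _; case: (A k); case: ltnP; lia.
  rewrite !big_split /= -!big_distrl /= -/(nsize M A) -/(nsize M (fun n => n < N)).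
  by rewrite seg_size leq_add2r.
have sub n : n < M -> (n < N) <= A n.
  by move=> /eqn; case: (A n); case: ltnP; lia.
move=> n ltnM.
have := leq_sum_eq (F := fun n => nat_of_bool (n < N)) (G := fun n => nat_of_bool (A n)) sub _ ltnM.
rewrite -/(nsize M A) -/(nsize M (fun n => n < N)) seg_size => /(_ (leqnn _)).
by case: (A n); case: ltnP.
Qed.

Section Digits.
Variable q : nat.
Hypothesis q_gt1 : 1 < q.
Let q_gt0 : 0 < q := ltnW q_gt1.
Let qX_gt0 m : 0 < q ^ m. Proof. by rewrite expn_gt0 q_gt0. Qed.

(* A number below q ^ m encodes the vector of its m base-q digits, so that the
   order of nat is the lexicographic order, the digit m.-1 being the leading one. *)
Definition dig (i n : nat) : nat := n %/ q ^ i %% q.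
Definition dsum (m n : nat) : nat := \sum_(i < m) dig i n.

Lemma dig_lt i n : dig i n < q. Proof. by rewrite ltn_mod. Qed.

Lemma dig0_last n j : j < q -> dig 0 (n * q + j) = j.
Proof. by move=> ltj; rewrite /dig expn0 divn1 modnMDl modn_small. Qed.

Lemma digS_last k n j : j < q -> dig k.+1 (n * q + j) = dig k n.
Proof.
by move=> ltj; rewrite /dig expnS divnMA divnMDl // (divn_small ltj) addn0.
Qed.

Lemma dig_first m i n : i < q -> n < q ^ m -> dig m (i * q ^ m + n) = i.
Proof.
by move=> lti ltn; rewrite /dig divnMDl // (divn_small ltn) addn0 modn_small.
Qed.

Lemma dig_rest m k i n : k < m -> dig k (i * q ^ m + n) = dig k n.
Proof.
move=> ltkm; rewrite /dig -(subnK ltkm) expnD expnS !mulnA divnMDl //.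
by rewrite modnMDl.
Qed.

Lemma dsum_last m n j : j < q -> dsum m.+1 (n * q + j) = dsum m n + j.
Proof.
move=> ltj; rewrite /dsum big_ord_recl /= dig0_last // addnC; congr (_ + _).
by apply: eq_bigr => i _; rewrite -[bump 0 i]/(i.+1) digS_last.
Qed.

Lemma dsum_first m i n : i < q -> n < q ^ m -> dsum m.+1 (i * q ^ m + n) = i + dsum m n.
Proof.
move=> lti ltn; rewrite /dsum big_ord_recr /= dig_first // addnC; congr (_ + _).
by apply: eq_bigr => k _; rewrite dig_rest.
Qed.

Lemma dig_gt0_le k n : 0 < dig k n -> q ^ k <= n.
Proof.
by rewrite /dig => h; rewrite -divn_gt0 //; case: (n %/ _) h; rewrite ?mod0n.
Qed.

(** When digit k of n is positive, n - q ^ k has this digit lowered by one and the others unchanged;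
    so these are the down-sets of the componentwise order. *)
Definition dclosed (m : nat) (A : pred nat) : Prop :=
  forall k n, k < m -> n < q ^ m -> A n -> 0 < dig k n -> A (n - q ^ k).

Definition low_count (m e : nat) (A : pred nat) : nat :=
  \sum_(n < q ^ m) (A n && (dsum m n <= e)).

Definition first_slice (m : nat) (A : pred nat) (i : nat) : pred nat :=
  fun n => A (i * q ^ m + n).
Definition last_slice (A : pred nat) (j : nat) : pred nat :=
  fun n => A (n * q + j).

(* Compression: every slice (fixed leading digit, resp. fixed last digit) is
   replaced by the initial segment of the same size. *)
Definition comp_first (m : nat) (A : pred nat) : pred nat :=
  fun n => n %% q ^ m < nsize (q ^ m) (first_slice m A (n %/ q ^ m)).
Definition comp_last (m : nat) (A : pred nat) : pred nat :=
  fun n => n %/ q < nsize (q ^ m) (last_slice A (n %% q)).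

Lemma comp_firstE m A i n : n < q ^ m ->
  comp_first m A (i * q ^ m + n) = (n < nsize (q ^ m) (first_slice m A i)).
Proof. by move=> ltn; rewrite /comp_first modnMDl modn_small // divnMDl // divn_small // addn0. Qed.

Lemma comp_lastE m A n j : j < q ->
  comp_last m A (n * q + j) = (n < nsize (q ^ m) (last_slice A j)).
Proof. by move=> ltn; rewrite /comp_last modnMDl modn_small // divnMDl // divn_small // addn0. Qed.

Lemma sum_first m (F : nat -> nat) :
  \sum_(n < q ^ m.+1) F n = \sum_(i < q) \sum_(n < q ^ m) F (i * q ^ m + n).
Proof. by rewrite expnS sum_mul_ord. Qed.

Lemma sum_last m (F : nat -> nat) :
  \sum_(n < q ^ m.+1) F n = \sum_(j < q) \sum_(n < q ^ m) F (n * q + j).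
Proof. by rewrite expnSr sum_mul_ord exchange_big. Qed.

Lemma nsize_first m A :
  nsize (q ^ m.+1) A = \sum_(i < q) nsize (q ^ m) (first_slice m A i).
Proof. exact: (sum_first m (fun n => nat_of_bool (A n))). Qed.

Lemma nsize_last m A :
  nsize (q ^ m.+1) A = \sum_(i < q) nsize (q ^ m) (last_slice A i).
Proof. exact: (sum_last m (fun n => nat_of_bool (A n))). Qed.

Lemma nsum_first m A : nsum (q ^ m.+1) A =
  \sum_(i < q) (nsize (q ^ m) (first_slice m A i) * (i * q ^ m) + nsum (q ^ m) (first_slice m A i)).
Proof.
rewrite /nsum (sum_first m (fun n => A n * n)); apply: eq_bigr => i _.
by rewrite /nsize big_distrl -big_split; apply: eq_bigr => n _; rewrite mulnDr.
Qed.

Lemma nsum_last m A : nsum (q ^ m.+1) A =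
  \sum_(i < q) (nsum (q ^ m) (last_slice A i) * q + nsize (q ^ m) (last_slice A i) * i).
Proof.
rewrite /nsum (sum_last m (fun n => A n * n)); apply: eq_bigr => i _.
rewrite /nsize !big_distrl -big_split; apply: eq_bigr => n _ /=.
by rewrite mulnDr mulnA.
Qed.

Lemma low_count_first m e A : low_count m.+1 e A =
  \sum_(i < q) (i <= e) * low_count m (e - i) (first_slice m A i).
Proof.
rewrite /low_count (sum_first m (fun n => nat_of_bool (A n && (dsum m.+1 n <= e)))).
apply: eq_bigr => i _; rewrite big_distrr; apply: eq_bigr => n _ /=.
rewrite dsum_first // /first_slice; case: (A _) => //=; last by rewrite muln0.
case: (leqP i e) => lie; rewrite ?mul1n ?mul0n; last by rewrite leqNgt ltn_addr.
by rewrite -leq_subRL.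
Qed.

Lemma low_count_last m e A : low_count m.+1 e A =
  \sum_(i < q) (i <= e) * low_count m (e - i) (last_slice A i).
Proof.
rewrite /low_count (sum_last m (fun n => nat_of_bool (A n && (dsum m.+1 n <= e)))).
apply: eq_bigr => i _; rewrite big_distrr; apply: eq_bigr => n _ /=.
rewrite dsum_last // /last_slice; case: (A _) => //=; last by rewrite muln0.
case: (leqP i e) => lie; rewrite ?mul1n ?mul0n; last by rewrite leqNgt ltn_addl.
by rewrite addnC -leq_subRL.
Qed.

Lemma eq_low m e A B : (forall n, n < q ^ m -> A n = B n) -> low_count m e A = low_count m e B.
Proof. by move=> AB; apply: eq_bigr => i _; rewrite AB. Qed.
Lemma eq_nsize M A B : (forall n, n < M -> A n = B n) -> nsize M A = nsize M B.
Proof. by move=> AB; apply: eq_bigr => i _; rewrite AB. Qed.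
Lemma eq_nsum M A B : (forall n, n < M -> A n = B n) -> nsum M A = nsum M B.
Proof. by move=> AB; apply: eq_bigr => i _; rewrite AB. Qed.

Lemma nsize_comp_first_slice m A i :
  nsize (q ^ m) (first_slice m (comp_first m A) i) = nsize (q ^ m) (first_slice m A i).
Proof.
rewrite -[RHS](nsize_ltn (nsize_le _ _)); apply: eq_nsize => n ltn.
exact: comp_firstE.
Qed.

Lemma nsize_comp_last_slice m A i : i < q ->
  nsize (q ^ m) (last_slice (comp_last m A) i) = nsize (q ^ m) (last_slice A i).
Proof.
move=> lti; rewrite -[RHS](nsize_ltn (nsize_le _ _)); apply: eq_nsize => n ltn.
exact: comp_lastE.
Qed.

Lemma nsize_comp_first m A : nsize (q ^ m.+1) (comp_first m A) = nsize (q ^ m.+1) A.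
Proof. by rewrite !nsize_first; apply: eq_bigr => i _; rewrite nsize_comp_first_slice. Qed.

Lemma nsize_comp_last m A : nsize (q ^ m.+1) (comp_last m A) = nsize (q ^ m.+1) A.
Proof. by rewrite !nsize_last; apply: eq_bigr => i _; rewrite nsize_comp_last_slice. Qed.

Lemma dclosed_first_slice m A i : i < q -> dclosed m.+1 A -> dclosed m (first_slice m A i).
Proof.
move=> lti dA k n ltk ltn; rewrite /first_slice => An dn.
have lt : i * q ^ m + n < q ^ m.+1.
  rewrite expnS; apply: leq_trans (_ : i.+1 * q ^ m <= _).
    by rewrite mulSn addnC ltn_add2r.
  by rewrite leq_mul2r lti orbT.
have := dA k _ (ltnW ltk : k < m.+1) lt An.
by rewrite dig_rest // => /(_ dn); rewrite addnBA ?dig_gt0_le.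
Qed.

Lemma last_lt m n j : j < q -> n < q ^ m -> n * q + j < q ^ m.+1.
Proof.
move=> ltj ltn; rewrite expnSr; apply: leq_trans (_ : n.+1 * q <= _).
  by rewrite mulSn addnC ltn_add2r.
by rewrite leq_mul2r ltn orbT.
Qed.

Lemma first_lt m n i : i < q -> n < q ^ m -> i * q ^ m + n < q ^ m.+1.
Proof.
move=> lti ltn; rewrite expnS; apply: leq_trans (_ : i.+1 * q ^ m <= _).
  by rewrite mulSn addnC ltn_add2r.
by rewrite leq_mul2r lti orbT.
Qed.

Lemma dclosed_last_slice m A j : j < q -> dclosed m.+1 A -> dclosed m (last_slice A j).
Proof.
move=> ltj dA k n ltk ltn; rewrite /last_slice => An dn.
have := dA k.+1 _ ltk (last_lt ltj ltn) An.
rewrite digS_last // => /(_ dn).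
by rewrite expnSr mulnBl addnBAC // leq_mul2r dig_gt0_le ?orbT.
Qed.

Lemma first_slice_nest m A i n : i.+1 < q -> n < q ^ m -> dclosed m.+1 A ->
  first_slice m A i.+1 n -> first_slice m A i n.
Proof.
move=> lti ltn dA; rewrite /first_slice => An.
have := dA m _ (ltnSn m) (first_lt lti ltn) An; rewrite dig_first // => /(_ isT).
by rewrite mulSn -addnA addKn.
Qed.

Lemma last_slice_nest m A j n : j.+1 < q -> n < q ^ m -> dclosed m.+1 A ->
  last_slice A j.+1 n -> last_slice A j n.
Proof.
move=> ltj ltn dA; rewrite /last_slice => An.
have := dA 0 _ isT (last_lt ltj ltn) An; rewrite dig0_last // => /(_ isT).
by rewrite expn0 addnS subn1.
Qed.

(** The slices of a down-set shrink as the leading digit grows, so the initial segments of their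
    sizes are nested. Within one slice, lowering a digit lowers the number. *)
Lemma dclosed_comp_first m A : dclosed m.+1 A -> dclosed m.+1 (comp_first m A).
Proof.
move=> dA k x ltk ltx.
have ltn : x %% q ^ m < q ^ m by rewrite ltn_mod.
have lti : x %/ q ^ m < q by rewrite ltn_divLR // -expnS.
move: (divn_eq x (q ^ m)) ltn lti.
move: (x %/ q ^ m) (x %% q ^ m) => i n {ltx}-> ltn lti.
rewrite comp_firstE // => lt.
move: ltk; rewrite ltnS leq_eqVlt => /orP[/eqP->|ltk].
  rewrite dig_first //; case: i lti lt => [//|i] lti lt _.
  rewrite mulSn -addnA addKn comp_firstE //; apply: leq_trans lt _.
  by apply: nsize_sub => y lty; apply: first_slice_nest.
rewrite dig_rest // => /dig_gt0_le le.
rewrite -addnBA // comp_firstE ?(leq_ltn_trans (leq_subr _ _) ltn) //.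
exact: leq_ltn_trans (leq_subr _ _) lt.
Qed.

Lemma dclosed_comp_last m A : dclosed m.+1 A -> dclosed m.+1 (comp_last m A).
Proof.
move=> dA k x ltk ltx.
have ltj : x %% q < q by rewrite ltn_mod.
have ltn : x %/ q < q ^ m by rewrite ltn_divLR // -expnSr.
move: (divn_eq x q) ltn ltj; move: (x %/ q) (x %% q) => n j {ltx}-> ltn ltj.
rewrite comp_lastE // => lt.
case: k ltk => [|k] ltk.
  rewrite dig0_last //; case: j ltj lt => [//|j] ltj lt _.
  rewrite expn0 addnS subn1 /= comp_lastE ?(ltnW ltj) //.
  apply: leq_trans lt _.
  by apply: nsize_sub => y lty; exact: (last_slice_nest ltj lty dA).
rewrite digS_last // => /dig_gt0_le le.
rewrite expnSr addnC -addnBA ?leq_mul2r ?le ?orbT // -mulnBl addnC comp_lastE //.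
by apply: leq_ltn_trans lt; apply: leq_subr.
Qed.

End Digits.

Lemma sum1_ord (n : nat) : \sum_(i < n) 1 = n.
Proof. by rewrite sum1_card card_ord. Qed.

Lemma leq_sum_widen (m n : nat) (F : nat -> nat) : m <= n ->
  \sum_(i < m) F i <= \sum_(i < n) F i.
Proof. by move=> /subnKC <-; rewrite big_split_ord leq_addr. Qed.

Lemma sum_recl (Q : nat) (F : nat -> nat) : 0 < Q ->
  \sum_(i < Q) F i = F 0 + \sum_(i < Q.-1) F i.+1.
Proof. by case: Q => // Q _; rewrite big_ord_recl. Qed.

Lemma sum_recr (Q : nat) (F : nat -> nat) : 0 < Q ->
  \sum_(i < Q) F i = \sum_(i < Q.-1) F i + F Q.-1.
Proof. by case: Q => // Q _; rewrite big_ord_recr. Qed.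

(** * Initial segments minimize the number of low-degree members *)

Section low_count_initial.
Variable q : nat.
Hypothesis q_gt1 : 1 < q.
Let q_gt0 : 0 < q := ltnW q_gt1.
Let qX_gt0 m : 0 < q ^ m. Proof. by rewrite expn_gt0 q_gt0. Qed.
Local Notation seg N := (fun n : nat => n < N).

Lemma low_count_le_nsize m e A : low_count q m e A <= nsize (q ^ m) A.
Proof. by apply: leq_sum => i _; case: (A i) => //=; apply: leq_b1. Qed.

Lemma low_count_mono m e (A B : pred nat) :
  (forall n, n < q ^ m -> A n -> B n) -> low_count q m e A <= low_count q m e B.
Proof.
move=> AB; apply: leq_sum => i _; have := AB _ (ltn_ord i).
by case: (A i) => //= ->.
Qed.

Lemma dsum1 n : n < q -> dsum q 1 n = n.
Proof. by move=> ltn; rewrite /dsum big_ord1 /dig expn0 divn1 modn_small. Qed.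

Lemma low1_seg f N : N <= q -> f < q -> low_count q 1 f (seg N) = minn N f.+1.
Proof.
move=> leN ltf; rewrite /low_count expn1 -[RHS](@nsize_ltn q); last by rewrite geq_min leN.
apply: eq_bigr => i _; rewrite dsum1 //.
by rewrite ltn_min ltnS.
Qed.

Lemma low1_le f A : low_count q 1 f A <= f.+1.
Proof.
case: (ltnP f q) => [ltf|leq].
  by rewrite (leq_trans (low_count_mono _ (B := seg q) _)) ?low1_seg ?geq_minr // => n; rewrite expn1.
by rewrite (leq_trans (low_count_le_nsize _ _ _)) // (leq_trans (nsize_le _ _)) // expn1 (leq_trans leq).
Qed.

Lemma first_slice_add m N i n :
  first_slice q m (seg (N + q ^ m)) i.+1 n = first_slice q m (seg N) i n.
Proof. by rewrite /first_slice mulSn [q ^ m + _]addnC -addnA [q ^ m + _]addnC addnA ltn_add2r. Qed.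

(** Adding q to N puts one full row in front: row i.+1 of the longer segment is row i of the shorter
    one, and the new row has at most e.+2 members of degree at most e.+1. *)
Lemma low2_add e N : low_count q 2 e.+1 (seg (N + q)) <= e.+2 + low_count q 2 e (seg N).
Proof.
rewrite !low_count_first //.
rewrite (sum_recl (fun i => (i <= e.+1) * low_count q 1 (e.+1 - i) (first_slice q 1 (seg (N + q)) i))) //.
rewrite (sum_recr (fun i => (i <= e) * low_count q 1 (e - i) (first_slice q 1 (seg N) i))) //.
rewrite subn0 mul1n.
apply: leq_add; first exact: low1_le.
apply: leq_trans (leq_addr _ _); apply: leq_sum => i _.
rewrite ltnS subSS leq_mul2l; apply/orP; right.
apply: low_count_mono => n _ /=.
by rewrite -[X in N + X]expn1 first_slice_add.
Qed.

Lemma low2_small e N : N <= q -> low_count q 2 e (seg N) <= minn N e.+1.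
Proof.
move=> leN; rewrite leq_min; apply/andP; split.
  apply: leq_trans (low_count_le_nsize _ _ _) _.
  by rewrite nsize_ltn // (leq_trans leN) // -mulnn leq_pmulr.
rewrite low_count_first //.
rewrite (sum_recl (fun i => (i <= e) * low_count q 1 (e - i) (first_slice q 1 (seg N) i))) //.
rewrite big1 ?addn0; first by rewrite mul1n subn0; exact: low1_le.
move=> i _; rewrite [low_count q _ _ _]big1 ?muln0 // => n _.
rewrite [X in X && _](_ : _ = false) // /first_slice.
by apply/negbTE; rewrite -leqNgt mulSn -addnA (leq_trans leN) // -{1}[q]expn1 leq_addr.
Qed.

Lemma low2_zero A : low_count q 2 0 A <= 1.
Proof.
rewrite low_count_first // (sum_recl (fun i => (i <= 0) * low_count q 1 (0 - i) (first_slice q 1 A i))) //.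
by rewrite big1 // mul1n addn0 low1_le.
Qed.

(** A planar down-set is a Young diagram with row lengths lam i. Induction on e: a first row or
    column that crosses the whole triangle of degree at most e can be removed at the cost of one row
    of the segment ([low2_add]); if neither does, the diagram fits in an e by e square, hence its
    size in one row of the segment, as e * e <= q. *)
Lemma young (lam : nat -> nat) e : e * e <= q ->
  (forall i, lam i.+1 <= lam i) -> (forall i, lam i <= q) -> lam q = 0 ->
  low_count q 2 e (seg (\sum_(i < q) lam i)) <= \sum_(i < e.+1) minn (lam i) (e.+1 - i).
Proof.
elim: e lam => [|e IH] lam le_e lamS lam_le lam_q.
  rewrite big_ord1 subn0.
  have lamM i : lam i <= lam 0 by elim: i => // i; apply: leq_trans.
  case: (posnP (lam 0)) => l0.
    rewrite big1 => [|i _]; last by apply/eqP; rewrite -leqn0 -l0.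
    by apply: leq_trans (low_count_le_nsize _ _ _) _; rewrite nsize_ltn.
  apply: (leq_trans (n := 1)); last by rewrite leq_min l0.
  exact: low2_zero.
have lamM i j : i <= j -> lam j <= lam i.
  by move=> /subnK <-; elim: (j - i) => // k; apply: leq_trans (lamS (k + i)).
have le_e' : e * e <= q by apply: leq_trans le_e; rewrite leq_mul.
have lam_ge i : q <= i -> lam i = 0.
  by move=> /lamM; rewrite lam_q leqn0 => /eqP.
case: (ltnP e.+1 (lam 0)) => [l0|l0].
  pose lam' i := lam i.+1.
  have -> : \sum_(i < e.+2) minn (lam i) (e.+2 - i)
       = e.+2 + \sum_(i < e.+1) minn (lam' i) (e.+1 - i).
    by rewrite big_ord_recl subn0 (minn_idPr l0).
  have le_N : \sum_(i < q) lam i <= \sum_(i < q) lam' i + q.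
    rewrite sum_recl // addnC leq_add //.
    by rewrite [leqRHS](sum_recr lam') // leq_addr.
  apply: leq_trans (low_count_mono _ (B := seg (\sum_(i < q) lam' i + q)) _) _.
    by move=> n _ /leq_trans; apply.
  apply: leq_trans (low2_add _ _) _; rewrite leq_add2l; apply: IH => //.
  - by move=> i; apply: lamS.
  - by move=> i; apply: lam_le.
  - by apply: lam_ge.
(* Rows 0 to e.+1 are all nonempty: remove the first column. *)
case: (posnP (lam e.+1)) => le1; last first.
  pose lam' i := (lam i).-1.
  have -> : \sum_(i < e.+2) minn (lam i) (e.+2 - i)
       = e.+2 + \sum_(i < e.+1) minn (lam' i) (e.+1 - i).
    have -> : \sum_(i < e.+1) minn (lam' i) (e.+1 - i) = \sum_(i < e.+2) minn (lam' i) (e.+1 - i).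
      by rewrite [RHS]big_ord_recr /= subnn minn0 addn0.
    rewrite -[X in _ = X + _]sum1_ord -big_split; apply: eq_bigr => i _ /=.
    have := lamM i e.+1; rewrite -ltnS ltn_ord => /(_ isT) /(leq_trans le1).
    by rewrite /lam'; have := ltn_ord i; lia.
  have le_N : \sum_(i < q) lam i <= \sum_(i < q) lam' i + q.
    rewrite -[X in _ + X]sum1_ord -big_split; apply: leq_sum => i _ /=.
    by rewrite /lam'; lia.
  apply: leq_trans (low_count_mono _ (B := seg (\sum_(i < q) lam' i + q)) _) _.
    by move=> n _ /leq_trans; apply.
  apply: leq_trans (low2_add _ _) _; rewrite leq_add2l; apply: IH => //.
  - by move=> i; rewrite /lam'; have := lamS i; lia.
  - by move=> i; rewrite /lam'; have := lam_le i; lia.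
  - by rewrite /lam' lam_q.
have lt_e : e.+1 <= q by apply: leq_trans le_e; rewrite leq_pmulr.
have eqN : \sum_(i < q) lam i = \sum_(i < e.+1) lam i.
  rewrite -(subnKC lt_e) big_split_ord /= [X in _ + X]big1 ?addn0 // => i _.
  by apply/eqP; rewrite -leqn0 -le1 lamM ?leq_addr.
have leN : \sum_(i < e.+1) lam i <= q.
  apply: leq_trans le_e; rewrite -[X in _ <= X * _]card_ord -sum_nat_const.
  by apply: leq_sum => i _; apply: leq_trans l0; apply: lamM.
rewrite eqN; apply: leq_trans (low2_small _ leN) _.
rewrite [leqRHS]big_ord_recr /= le1 min0n addn0.
(* Either the diagram lies inside the triangle and all of it counts, or some row i sticks out, and
   then rows 0 to i already contain e.+2 counted members. *)
case: (boolP [forall i : 'I_e.+1, lam i <= e.+2 - i]) => [/forallP all_le|].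
  by rewrite geq_min leq_sum // => i _; rewrite leq_min leqnn all_le.
rewrite negb_forall => /existsP[i]; rewrite -ltnNge => lti.
rewrite geq_min; apply/orP; right.
pose f j := minn (lam j) (e.+2 - j).
have le_f : \sum_(j < i.+1) f j <= \sum_(j < e.+1) f j.
  exact: leq_sum_widen.
apply: leq_trans le_f; rewrite big_ord_recr /=.
have h : i <= \sum_(j < i) f j.
  rewrite -[leqLHS]sum1_ord; apply: leq_sum => j _.
  by have := lamM j i (ltnW (ltn_ord j)); have := ltn_ord i; have := ltn_ord j; rewrite /f; lia.
move: h; set s := bigop _ _ _; have := ltn_ord i; rewrite /f; lia.
Qed.

Lemma seg1 A : dclosed q 1 A -> forall n, n < q -> A n = (n < nsize q A).
Proof.
move=> dA.
have down n : n.+1 < q -> A n.+1 -> A n.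
  move=> ltn An; have := dA 0 n.+1 isT; rewrite expn1 expn0 subn1 => /(_ ltn An).
  by rewrite /dig expn0 divn1 modn_small //; apply.
have down' n k : n + k < q -> A (n + k) -> A n.
  elim: k => [|k IH]; rewrite ?addn0 // addnS => lt /(down _ lt).
  by apply: IH; apply: ltnW.
move=> n ltn; apply/idP/idP => [An|].
  rewrite -(@nsize_ltn q n.+1) //; apply: nsize_sub => k ltk; rewrite ltnS => lekn.
  by apply: (down' k (n - k)); rewrite subnKC.
apply: contraLR => nAn; rewrite -leqNgt -(nsize_ltn (ltnW ltn)).
apply: nsize_sub => k ltk Ak; rewrite ltnNge; apply: contraNN nAn => lenk.
by apply: (down' n (k - n)); rewrite subnKC.
Qed.

Lemma low_count_initial2 e A : e * e <= q -> dclosed q 2 A ->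
  low_count q 2 e (seg (nsize (q ^ 2) A)) <= low_count q 2 e A.
Proof.
move=> le_e dA.
have lt_e : e < q.
  by case: e le_e => [|[|e]] //; move=> h; apply: leq_trans h; rewrite ltn_Pmull.
pose lam i := if i < q then nsize q (first_slice q 1 A i) else 0.
have slice i n : i < q -> n < q -> first_slice q 1 A i n = (n < lam i).
  move=> lti ltn; rewrite /lam lti; apply: seg1 => //.
  exact: dclosed_first_slice.
have lam_le i : lam i <= q by rewrite /lam; case: ifP => // _; apply: nsize_le.
have -> : nsize (q ^ 2) A = \sum_(i < q) lam i.
  by rewrite nsize_first //; apply: eq_bigr => i _; rewrite /lam ltn_ord expn1.
apply: leq_trans (young le_e _ lam_le _) _.
- move=> i; rewrite {1}/lam; case: ifP => // lti; rewrite /lam (ltnW lti).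
  by apply: nsize_sub => n ltn; apply: first_slice_nest => //; rewrite expn1.
- by rewrite /lam ltnn.
rewrite low_count_first //.
apply: leq_trans (leq_sum_widen (fun i => (i <= e) * low_count q 1 (e - i) (first_slice q 1 A i)) lt_e).
apply: leq_sum => i _.
have lei : i <= e by rewrite -ltnS.
rewrite lei mul1n subSn // -low1_seg //; last by apply: leq_ltn_trans lt_e; apply: leq_subr.
by apply: low_count_mono => n; rewrite expn1 => ltn; rewrite slice // (leq_ltn_trans lei).
Qed.

(** In the slice with leading digit i the degree bound becomes e - i, so the statement one dimension
    lower is needed for all smaller degrees f. *)
Lemma low_count_comp_first m e A :
  (forall f B, f * f <= q -> dclosed q m B ->
     low_count q m f (seg (nsize (q ^ m) B)) <= low_count q m f B) ->
  e * e <= q -> dclosed q m.+1 A -> low_count q m.+1 e (comp_first q m A) <= low_count q m.+1 e A.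
Proof.
move=> IH le_e dA; rewrite !low_count_first //; apply: leq_sum => i _; rewrite leq_mul2l.
apply/orP; right; apply: leq_trans (IH _ _ _ (dclosed_first_slice _ _ dA)) => //.
  by apply: low_count_mono => n ltn; rewrite {1}/first_slice comp_firstE.
by apply: leq_trans le_e; apply: leq_mul; apply: leq_subr.
Qed.

Lemma low_count_comp_last m e A :
  (forall f B, f * f <= q -> dclosed q m B ->
     low_count q m f (seg (nsize (q ^ m) B)) <= low_count q m f B) ->
  e * e <= q -> dclosed q m.+1 A -> low_count q m.+1 e (comp_last q m A) <= low_count q m.+1 e A.
Proof.
move=> IH le_e dA; rewrite !low_count_last //; apply: leq_sum => i _; rewrite leq_mul2l.
apply/orP; right; apply: leq_trans (IH _ _ _ (dclosed_last_slice _ _ dA)) => //.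
  by apply: low_count_mono => n ltn; rewrite {1}/last_slice comp_lastE.
by apply: leq_trans le_e; apply: leq_mul; apply: leq_subr.
Qed.

Lemma nsum_comp_first m A : nsum (q ^ m.+1) A <= nsum (q ^ m.+1) (comp_first q m A) ->
  forall i n, i < q -> n < q ^ m ->
  A (i * q ^ m + n) = (n < nsize (q ^ m) (first_slice q m A i)).
Proof.
rewrite !nsum_first // => le i n lti ltn.
pose G i := nsize (q ^ m) (first_slice q m A i) * (i * q ^ m) + nsum (q ^ m) (first_slice q m A i).
pose F' i := nsize (q ^ m) (first_slice q m A i) * (i * q ^ m) +
   nsum (q ^ m) (seg (nsize (q ^ m) (first_slice q m A i))).
apply: (nsum_seg_eq (A := first_slice q m A i)) (ltn).
have := leq_sum_eq (M := q) (F := F') (G := G) _ _ lti; rewrite /F' /G => /(_ _ _)/addnI <- //.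
  by move=> k _; rewrite leq_add2l nsum_seg.
apply: leq_trans le _; rewrite leq_eqVlt; apply/orP; left; apply/eqP.
apply: eq_bigr => k _; rewrite nsize_comp_first_slice //; congr (_ + _).
by apply: eq_nsum => y lty; rewrite {1}/first_slice comp_firstE.
Qed.

Lemma nsum_comp_last m A : nsum (q ^ m.+1) A <= nsum (q ^ m.+1) (comp_last q m A) ->
  forall i n, i < q -> n < q ^ m ->
  A (n * q + i) = (n < nsize (q ^ m) (last_slice q A i)).
Proof.
rewrite !nsum_last // => le i n lti ltn.
pose G i := nsum (q ^ m) (last_slice q A i) * q + nsize (q ^ m) (last_slice q A i) * i.
pose F' i := nsum (q ^ m) (seg (nsize (q ^ m) (last_slice q A i))) * q +
  nsize (q ^ m) (last_slice q A i) * i.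
apply: (nsum_seg_eq (A := last_slice q A i)) (ltn).
have := leq_sum_eq (M := q) (F := F') (G := G) _ _ lti; rewrite /F' /G => /(_ _ _)/addIn/eqP.
rewrite eqn_mul2r eqn0Ngt q_gt0 /= => /(_ _ _)/eqP <- //.
  by move=> k _; rewrite leq_add2r leq_mul2r nsum_seg orbT.
apply: leq_trans le _; rewrite leq_eqVlt; apply/orP; left; apply/eqP.
apply: eq_bigr => k _; rewrite nsize_comp_last_slice //; congr (_ * _ + _).
by apply: eq_nsum => y lty; rewrite {1}/last_slice comp_lastE.
Qed.

(* In a set fixed by both compressions, membership propagates downwards as soon as
   the leading or the last digit agrees; so a gap y below a member x differs from
   it in the leading digit by one, and the remaining digits are forced. *)
Lemma stable_dsum m (A : pred nat) :
  (forall i n n', i < q -> n' <= n -> n < q ^ m.+2 ->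
     A (i * q ^ m.+2 + n) -> A (i * q ^ m.+2 + n')) ->
  (forall j n n', j < q -> n' <= n -> n < q ^ m.+2 -> A (n * q + j) -> A (n' * q + j)) ->
  forall x y, x < q ^ m.+3 -> y < x -> A x -> ~~ A y -> dsum q m.+3 x <= dsum q m.+3 y.
Proof.
move=> sf sl.
have sp z : z < q ^ m.+3 -> exists i v j,
    [/\ z = i * q ^ m.+2 + (v * q + j), i < q, v < q ^ m.+1 & j < q].
  move=> ltz; exists (z %/ q ^ m.+2), (z %% q ^ m.+2 %/ q), (z %% q ^ m.+2 %% q).
  rewrite -!divn_eq ltn_divLR // -expnS ltz ltn_divLR // -expnSr.
  by rewrite !ltn_mod q_gt0 qX_gt0.
have QE : q ^ m.+2 = q ^ m.+1 * q by rewrite expnSr.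
move=> x y ltx ltyx.
have [x1 [xv [xj [eqx ltx1 ltxv ltxj]]]] := sp _ ltx.
have [y1 [yv [yj [eqy lty1 ltyv ltyj]]]] := sp _ (ltn_trans ltyx ltx).
have lin i v j : i * q ^ m.+2 + (v * q + j) = (i * q ^ m.+1 + v) * q + j.
  by rewrite QE mulnDl mulnA addnA.
have sf' i v j v' j' : i < q -> v < q ^ m.+1 -> j < q -> v' * q + j' <= v * q + j ->
    A (i * q ^ m.+2 + (v * q + j)) -> A (i * q ^ m.+2 + (v' * q + j')).
  by move=> lti ltv ltj le; apply: sf => //; apply: last_lt.
have sl' i v j i' v' : i < q -> v < q ^ m.+1 -> j < q ->
    i' * q ^ m.+1 + v' <= i * q ^ m.+1 + v ->
    A (i * q ^ m.+2 + (v * q + j)) -> A (i' * q ^ m.+2 + (v' * q + j)).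
  by move=> lti ltv ltj le; rewrite !lin; apply: sl => //; apply: first_lt.
rewrite eqx eqy => Ax nAy.
(* The middle block has at least one digit; in dimension 2 there is none, and [young] replaces this
   argument. *)
have Mgt1 : 1 < q ^ m.+1 by rewrite expnS; apply: leq_trans q_gt1 (leq_pmulr _ _).
set M := q ^ m.+1 in lin sl' sf' ltxv ltyv QE Mgt1 *.
have Mle i i' v v' : i < i' -> v < M -> i * M + v <= i' * M + v'.
  move=> lti ltv; apply: leq_trans (leq_addr _ _).
  by apply: leq_trans (_ : i.+1 * M <= _); rewrite ?leq_mul2r ?lti ?orbT // mulSn addnC leq_add2r ltnW.
have qle v v' j j' : v < v' -> j < q -> v * q + j <= v' * q + j'.
  move=> lti ltv; apply: leq_trans (leq_addr _ _).
  by apply: leq_trans (_ : v.+1 * q <= _); rewrite ?leq_mul2r ?lti ?orbT // mulSn addnC leq_add2r ltnW.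
have lt1 : y1 < x1.
  have := ltyx; rewrite eqx eqy.
  case: (ltngtP y1 x1) => // [gt|eq1] lt.
    move: lt; rewrite ltnNge !QE => /negP[].
    have : (xv * q + xj) < M * q by rewrite (leq_trans _ (_ : xv.+1 * q <= _)) ?leq_mul2r ?ltxv ?orbT // mulSn addnC ltn_add2r.
    have : x1.+1 * (M * q) <= y1 * (M * q) by rewrite leq_mul2r gt orbT.
    by move: (M * q) => Q; rewrite mulSn; move: (xv * q) (yv * q) (x1 * _) (y1 * _) => a b c d; lia.
  case/negP: nAy; rewrite eq1; apply: sf' Ax => //.
  by move: lt; rewrite eq1 ltn_add2l; apply: ltnW.
have M1 : M.-1 < M by rewrite prednK // ltnW.
have Az : A (y1 * q ^ m.+2 + (M.-1 * q + xj)) by apply: sl' Ax => //; apply: Mle.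
have lt_z : M.-1 * q + xj < yv * q + yj.
  by rewrite ltnNge; apply/negP => le; case/negP: nAy; apply: sf' Az.
have eq_yv : yv = M.-1.
  apply/eqP; rewrite eqn_leq -ltnS prednK ?ltyv //=; last exact: ltnW.
  by rewrite leqNgt; apply/negP => lt; have := qle _ _ yj xj lt ltyj; lia.
have lt_j : xj < yj by move: lt_z; rewrite eq_yv ltn_add2l.
have xv0 : xv = 0.
  case: xv {eqx} ltxv Ax => // xv ltxv Ax; case/negP: nAy.
  apply: (sl' x1 xv) => //; [exact: ltnW|exact: Mle|].
  by apply: sf' Ax => //; apply: qle.
have eq_x1 : x1 = y1.+1.
  apply/eqP; rewrite eqn_leq lt1 andbT leqNgt; apply/negP => lt2.
  have lty1' : y1.+1 < q by apply: ltn_trans ltx1.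
  have Az1 : A (y1.+1 * q ^ m.+2 + (M.-1 * q + xj)) by apply: sl' Ax => //; apply: Mle.
  have Az2 : A (y1.+1 * q ^ m.+2 + (0 * q + yj)).
    by apply: sf' Az1 => //; apply: qle => //; lia.
  by case/negP: nAy; apply: sl' Az2 => //; [exact: ltnW|exact: Mle].
(* Now x has digits y1 + 1, 0, ..., 0, xj and y has digits y1, q - 1, ..., q - 1, yj, with xj <
   yj. *)
rewrite !dsum_first ?dsum_last //; try exact: last_lt.
rewrite xv0 eq_x1; suff -> : dsum q m.+1 0 = 0 by lia.
by rewrite /dsum big1 // => i _; rewrite /dig div0n mod0n.
Qed.

Lemma swap_low m e (A : pred nat) x y : x < q ^ m -> y < x -> A x -> ~~ A y ->
    dsum q m x <= dsum q m y ->
  let B := fun n => (n == y) || (A n && (n != x)) in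
  [/\ nsize (q ^ m) B = nsize (q ^ m) A, low_count q m e B <= low_count q m e A &
      nsum (q ^ m) B < nsum (q ^ m) A].
Proof.
move=> ltx lyx Ax nAy led B.
have lty := ltn_trans lyx ltx.
pose ix := Ordinal ltx; pose iy := Ordinal lty.
have nxy : iy != ix by rewrite -val_eqE /= neq_ltn lyx.
have sp (F : nat -> nat) : \sum_(n < q ^ m) F n =
    F x + (F y + \sum_(n < q ^ m | (n != ix) && (n != iy)) F n).
  by rewrite (bigD1 ix) //= (bigD1 iy).
have BE n : n != x -> n != y -> B n = A n.
  by rewrite /B => -> /negPf->; rewrite andbT.
have Bx : B x = false by rewrite /B eqxx andbF orbF gtn_eqF.
have By : B y by rewrite /B eqxx.
have eqr (F : bool -> nat -> nat) :
    \sum_(n < q ^ m | (n != ix) && (n != iy)) F (B n) n =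
    \sum_(n < q ^ m | (n != ix) && (n != iy)) F (A n) n.
  by apply: eq_bigr => n /andP[nx ny]; rewrite BE.
split.
- rewrite /nsize (sp (fun n => nat_of_bool (B n))) (sp (fun n => nat_of_bool (A n))).
  by rewrite (eqr (fun b _ => nat_of_bool b)) Bx By Ax (negPf nAy).
- rewrite /low_count (sp (fun n => nat_of_bool (B n && (dsum q m n <= e)))).
  rewrite (sp (fun n => nat_of_bool (A n && (dsum q m n <= e)))).
  rewrite (eqr (fun b n => nat_of_bool (b && (dsum q m n <= e)))) Bx By Ax (negPf nAy) /= add0n add0n.
  rewrite leq_add2r; case: (leqP _ e) => // le; by rewrite (leq_trans led le).
- rewrite /nsum (sp (fun n => B n * n)) (sp (fun n => A n * n)).
  rewrite (eqr (fun b n => b * n)) Bx By Ax (negPf nAy) mul0n !mul1n add0n mul0n add0n.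
  by rewrite ltn_add2r.
Qed.

(* Induction on the sum of the elements: compress while this lowers the sum, and
   then swap the largest element for the first gap. *)
Lemma low_count_initial_step m e :
  (forall f B, f * f <= q -> dclosed q m.+2 B ->
     low_count q m.+2 f (seg (nsize (q ^ m.+2) B)) <= low_count q m.+2 f B) ->
  e * e <= q -> forall A, dclosed q m.+3 A ->
  low_count q m.+3 e (seg (nsize (q ^ m.+3) A)) <= low_count q m.+3 e A.
Proof.
move=> IH le_e A; have [k] := ubnP (nsum (q ^ m.+3) A); elim: k A => // k IHk A ltk dA.
case: (ltnP (nsum (q ^ m.+3) (comp_first q m.+2 A)) (nsum (q ^ m.+3) A)) => [lt|/nsum_comp_first sf].
  rewrite -(nsize_comp_first q_gt1); apply: leq_trans (low_count_comp_first IH le_e dA).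
  by apply: IHk; [apply: leq_trans lt _|apply: dclosed_comp_first].
case: (ltnP (nsum (q ^ m.+3) (comp_last q m.+2 A)) (nsum (q ^ m.+3) A)) => [lt|/nsum_comp_last sl].
  rewrite -(nsize_comp_last q_gt1); apply: leq_trans (low_count_comp_last IH le_e dA).
  by apply: IHk; [apply: leq_trans lt _|apply: dclosed_comp_last].
set N := nsize (q ^ m.+3) A.
have stab := @stable_dsum m A _ _.
case: (boolP [forall n : 'I_(q ^ m.+3), (n < N) ==> A n]) => [/forallP h|].
  by apply: low_count_mono => n ltn ltN; have := h (Ordinal ltn); rewrite ltN.
rewrite negb_forall => /existsP[y0]; rewrite negb_imply => /andP[lty0 nAy0].
have exy : exists y, (y < q ^ m.+3) && ~~ A y by exists y0; rewrite ltn_ord.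
have exx : exists x, (y0 < x < q ^ m.+3) && A x.
  case: (boolP [exists x : 'I_(q ^ m.+3), (y0 < x) && A x]) => [/existsP[x /andP[lt Ax]]|].
    by exists x; rewrite lt ltn_ord.
  rewrite negb_exists => /forallP h; exfalso; move: lty0; apply/negP; rewrite -leqNgt.
  rewrite -(nsize_ltn (ltnW (ltn_ord y0))); apply: nsize_sub => n ltn An.
  have := h (Ordinal ltn); rewrite /= An andbT -leqNgt leq_eqVlt => /orP[/eqP eqn|//].
  by rewrite -eqn An in nAy0.
have [y /andP[lty nAy] miny] := ex_minnP exy.
have [x /andP[/andP[ltxy0 ltx] Ax] maxx] := @ex_maxnP _ (q ^ m.+3) exx
   (fun n => fun h => ltnW (proj2 (andP (proj1 (andP h))))).
have lyx : y < x by apply: leq_ltn_trans ltxy0; apply: miny; rewrite ltn_ord.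
have led : dsum q m.+3 x <= dsum q m.+3 y.
  apply: stab Ax nAy => //.
    move=> i n n' lti le ltn; rewrite !sf //; first exact: leq_ltn_trans.
    exact: leq_ltn_trans ltn.
  move=> i n n' lti le ltn; rewrite !sl //; first exact: leq_ltn_trans.
  exact: leq_ltn_trans ltn.
have [sB lB nB] := swap_low e ltx lyx Ax nAy led.
set B := (fun n => _) in sB lB nB.
rewrite /N -sB; apply: leq_trans lB; apply: IHk; first exact: leq_trans nB _.
move=> i n lti ltn /orP[/eqP->|/andP[An nx]] dn; apply/orP; right; apply/andP; split.
- apply/negPn/negP => nA.
  have : y <= y - q ^ i by apply: miny; rewrite nA (leq_ltn_trans (leq_subr _ _) lty).
  by have := dig_gt0_le q_gt1 dn; have := qX_gt0 i; lia.
- by rewrite neq_ltn (leq_ltn_trans (leq_subr _ _)).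
- exact: dA.
- rewrite neq_ltn; apply/orP; left.
  have lenx : n <= x.
    case: (ltnP y0 n) => lt; first by apply: maxx; rewrite lt ltn.
    by apply: leq_trans lt (ltnW ltxy0).
  by have := dig_gt0_le q_gt1 dn; have := qX_gt0 i; lia.
Qed.

Theorem low_count_initial m e A : e * e <= q -> dclosed q m A ->
  low_count q m e (seg (nsize (q ^ m) A)) <= low_count q m e A.
Proof.
elim: m e A => [|[|[|m]] IH] e A le_e dA.
- rewrite /low_count /nsize expn0 !big_ord1; case: (A 0) => //=.
- by apply: low_count_mono => n; rewrite expn1 => ltn; rewrite (seg1 dA).
- exact: low_count_initial2.
- exact: low_count_initial_step.
Qed.

End low_count_initial.

(** * Counting digit vectors above a threshold *)

(* The dimension of the space of polynomials of degree < j in m variables. *)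
Definition pdim (m j : nat) : nat := if j is j'.+1 then 'C(m + j', m) else 0.

Lemma pdimS m j : pdim m.+1 j.+1 = pdim m.+1 j + pdim m j.+1.
Proof.
case: j => [|j]; rewrite /pdim; first by rewrite !addn0 !binn.
by rewrite [m.+1 + j.+1]addSn binS addSnnS.
Qed.

Section tail_count.
Variable q : nat.
Hypothesis q_gt1 : 1 < q.
Let q_gt0 : 0 < q := ltnW q_gt1.
Let qX_gt0 m : 0 < q ^ m. Proof. by rewrite expn_gt0 q_gt0. Qed.

Definition tail_count (m e N : nat) : nat := low_count q m e (fun n => N <= n).

Lemma tail_count_anti m e N N' : N <= N' -> tail_count m e N' <= tail_count m e N.
Proof. by move=> le; apply: low_count_mono => n _; apply: leq_trans. Qed.

Lemma tail_count_compl m e N :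
  low_count q m e (fun n => n < N) + tail_count m e N = tail_count m e 0.
Proof.
rewrite -big_split; apply: eq_bigr => i _ /=.
by case: (ltnP i N) => _ /=; rewrite ?addn0.
Qed.

Lemma tail_count_over m e N : q ^ m <= N -> tail_count m e N = 0.
Proof.
by move=> le; apply: big1 => i _; rewrite leqNgt (leq_trans (ltn_ord i) le).
Qed.

Lemma tail_count_low m e x : x <= q ^ m ->
  tail_count m.+1 e x = tail_count m.+1 e (q ^ m) + tail_count m e x.
Proof.
move=> lex; rewrite /tail_count !low_count_first //.
rewrite (sum_recl (fun i => (i <= e) * low_count q m (e - i) (first_slice q m (fun n => x <= n) i))) //.
rewrite (sum_recl (fun i => (i <= e) * low_count q m (e - i) (first_slice q m (fun n => q ^ m <= n) i))) //.
rewrite subn0 mul1n addnC; congr (_ + _).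
rewrite [low_count _ _ _ _]big1 ?add0n => [|n _]; last first.
  by rewrite /first_slice mul0n add0n leqNgt ltn_ord.
apply: eq_bigr => i _; congr (_ * _); apply: eq_low => n ltn; rewrite /first_slice mulSn -addnA.
by rewrite leq_addr (leq_trans lex) ?leq_addr.
Qed.

Lemma tail_count_shift m e N : e.+1 < q -> tail_count m.+1 e.+1 (q ^ m + N) = tail_count m.+1 e N.
Proof.
move=> lte; rewrite /tail_count !low_count_first //.
rewrite (sum_recl (fun i => (i <= e.+1) * low_count q m (e.+1 - i) (first_slice q m (fun n => q ^ m + N <= n) i))) //.
rewrite (sum_recr (fun i => (i <= e) * low_count q m (e - i) (first_slice q m (fun n => N <= n) i))) //.
(* The slice with leading digit q.-1, lost in the shift, has no member of degree at most e. *)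
have -> : (q.-1 <= e) = false by lia.
rewrite mul0n addn0.
rewrite subn0 mul1n [low_count _ _ _ _]big1 ?add0n => [|n _]; last first.
  by rewrite /first_slice mul0n add0n leqNgt (leq_trans (ltn_ord n)) ?leq_addr.
apply: eq_bigr => i _; rewrite ltnS subSS; congr (_ * _).
by apply: eq_low => n ltn; rewrite /first_slice mulSn -addnA leq_add2l.
Qed.

Lemma tail_count_shiftn m e b x : e < q -> b <= e ->
  tail_count m.+1 e (b * q ^ m + x) = tail_count m.+1 (e - b) x.
Proof.
elim: b e => [|b IH] e lte leb; first by rewrite subn0.
case: e lte leb => // e lte leb; rewrite mulSn -addnA tail_count_shift // IH ?subSS //.
exact: ltnW.
Qed.

Lemma tail_count00 m : tail_count m.+1 0 (q ^ m) = 0.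
Proof.
rewrite /tail_count low_count_first // (sum_recl (fun i => (i <= 0) * low_count q m (0 - i) (first_slice q m (fun n => q ^ m <= n) i))) //.
rewrite big1 // addn0 mul1n [low_count _ _ _ _]big1 => // n _.
by rewrite /first_slice mul0n add0n leqNgt ltn_ord.
Qed.

Lemma tail_count_zero m e : e < q -> tail_count m e 0 = pdim m e.+1.
Proof.
elim: m e => [|m IH] e lte.
  by rewrite /tail_count /low_count expn0 big_ord1 /dsum big_ord0 /pdim bin0.
elim: e lte => [|e IHe] lte; rewrite tail_count_low // pdimS IH //.
  by rewrite tail_count00.
by rewrite -[q ^ m]addn0 tail_count_shift // IHe // ltnW.
Qed.

(** The first term counts the vectors with leading digit above b, the second those with leading
    digit b whose other digits form a number at least x. *)
Lemma tail_count_rec m e b x : e < q -> b <= e -> x <= q ^ m ->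
  tail_count m.+1 e (b * q ^ m + x) = pdim m.+1 (e - b) + tail_count m (e - b) x.
Proof.
move=> lte leb lex; rewrite tail_count_shiftn // tail_count_low //; congr (_ + _).
have: e - b < q by apply: leq_ltn_trans lte; apply: leq_subr.
case: (e - b) => [|f] ltf; first by rewrite tail_count00.
by rewrite -[q ^ m]addn0 tail_count_shift // tail_count_zero // ltnW.
Qed.

Lemma tail_count_big m e b : e < q -> e < b -> tail_count m.+1 e (b * q ^ m) = 0.
Proof.
move=> lte ltb; apply/eqP; rewrite -leqn0.
have le : e * q ^ m + q ^ m <= b * q ^ m by rewrite addnC -mulSn leq_mul2r ltb orbT.
by apply: leq_trans (tail_count_anti _ _ le) _; rewrite tail_count_rec // tail_count_over // subnn.
Qed.

(** An m-digit number of digit sum at most f is at most f * q ^ (m - 1), reached by putting the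
    whole sum in the leading digit. The factor q covers m = 0. *)
Lemma tail_count_pos m f x : 0 < tail_count m f x -> q * x <= f * q ^ m.
Proof.
rewrite /tail_count /low_count lt0n sum_nat_eq0 negb_forall => /existsP[n]; rewrite eqb0 negbK => /andP[lexn le].
apply: leq_trans (_ : q * n <= _); first by rewrite leq_mul2l lexn orbT.
have ltn := ltn_ord n; move: (nat_of_ord n) ltn le {lexn} => {}n.
case: m => [|m] ltn le; first by move: ltn; rewrite expn0 ltnS leqn0 => /eqP->; rewrite muln0.
rewrite expnS mulnCA leq_mul2l; apply/orP; right.
have ltr : n %% q ^ m < q ^ m by rewrite ltn_mod.
have ltd : n %/ q ^ m < q by rewrite ltn_divLR // -expnS.
move: (divn_eq n (q ^ m)) ltr ltd le; move: (n %/ _) (n %% _) => d k -> ltr ltd.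
rewrite dsum_first // => le.
case: (ltnP d f) => [lt|ge].
  apply: leq_trans (_ : d.+1 * q ^ m <= _); last by rewrite leq_mul2r lt orbT.
  by rewrite mulSn addnC leq_add2r ltnW.
have /eqP d0 : dsum q m k == 0 by rewrite -leqn0; lia.
suff -> : k = 0 by rewrite addn0 leq_mul2r; apply/orP; right; lia.
elim: m k ltr d0 {le ltd ltn ge} => [|m IH] k; first by case: k.
move=> ltk; rewrite (divn_eq k q) dsum_last ?ltn_mod // => /eqP.
rewrite addn_eq0 => /andP[/eqP d0 /eqP->].
by rewrite (IH (k %/ q)) // ltn_divLR // -expnSr.
Qed.

(** At most pdim m (e - b) vectors of degree at most e have leading digit above b. So some vector
    counted here has leading digit at most b, and if it is b, the other digits have sum at most e -
    b. The factor q ^ 2 avoids negative exponents. *)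
Lemma tail_count_ub m e b N : e < q -> pdim m (e - b) < tail_count m e N ->
  q ^ 2 * N <= b * q ^ m.+1 + (e - b) * q ^ m.
Proof.
move=> lte lt; have posR : 0 < tail_count m e N by apply: leq_ltn_trans lt.
have := tail_count_pos posR; case: m lt posR => [|m] lt posR leN.
  suff -> : N = 0 by rewrite muln0.
  by case: N posR {lt leN} => // N; rewrite tail_count_over ?expn0.
case: (leqP b e) => [leb|ltb]; last first.
  rewrite -mulnn -mulnA expnS (mulnCA b); apply: leq_trans (leq_addr _ _).
  rewrite leq_mul2l (leq_trans leN) ?orbT //.
  by rewrite leq_mul2r ltnW ?orbT.
case: (leqP N (b * q ^ m)) => [leN'|ltN].
  apply: leq_trans (leq_addr _ _).
  by rewrite -[m.+2]/(2 + m) expnD mulnCA leq_mul2l leN' orbT.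
have [x [eqN ltx]] : exists x, N = b * q ^ m + x /\ x <= q ^ m.
  exists (N - b * q ^ m); rewrite subnKC ?(ltnW ltN) //; split => //.
  rewrite leqNgt; apply/negP => gt.
  have le : b.+1 * q ^ m <= N by rewrite mulSn; lia.
  move: lt; rewrite ltnNge => /negP[]; apply: leq_trans (tail_count_anti _ _ le) _.
  case: (leqP b.+1 e) => leb'; last by rewrite tail_count_big.
  by rewrite -[_ * _]addn0 tail_count_shiftn // tail_count_zero ?(leq_ltn_trans (leq_subr _ _)) // subnSK.
move: lt; rewrite eqN tail_count_rec // -[X in X < _]addn0 ltn_add2l => /tail_count_pos le.
rewrite mulnDr leq_add //.
  by rewrite -[m.+2]/(2 + m) expnD mulnCA.
by rewrite -mulnn -mulnA expnS (mulnCA (e - b)) leq_mul2l le orbT.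
Qed.

Lemma tail_count_mulq m f x : tail_count m f x <= tail_count m.+1 f (q * x).
Proof.
rewrite /tail_count low_count_last // (sum_recl (fun i => (i <= f) * low_count q m (f - i) (last_slice q (fun n => q * x <= n) i))) //.
rewrite subn0 mul1n; apply: leq_trans (leq_addr _ _); apply: low_count_mono => n _.
by rewrite /last_slice addn0 mulnC leq_mul2r => ->; rewrite orbT.
Qed.

(** Made for the averaging step, where an excess A of the section bounds the excess of the whole by
    q * A: r' vectors beyond a class in dimension m become r' vectors beyond the corresponding class
    in dimension m.+1, by appending a last digit 0. *)
Lemma tail_count_avg m e b r' A : e < q -> b <= e -> 0 < r' -> r' <= pdim m (e - b).+1 ->
  minn (r' + pdim m (e - b)) (pdim m e.+1) <= tail_count m e A ->
  r' + pdim m.+1 (e - b) <= tail_count m.+1 e (q * A).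
Proof.
move=> lte leb r0 ler.
have ltf : e - b < q by apply: leq_ltn_trans lte; apply: leq_subr.
have base B : q * B <= b * q ^ m -> r' + pdim m.+1 (e - b) <= tail_count m.+1 e (q * B).
  move=> le; apply: leq_trans (tail_count_anti _ _ le); rewrite -[_ * _]addn0 tail_count_shiftn // tail_count_zero //.
  by rewrite pdimS addnC leq_add2l.
case: (posnP A) => [->|A0]; first by move=> _; apply: base; rewrite muln0.
(* The count pdim m e.+1 is reached only if no low vector lies below A, whereas A > 0 leaves out the
   zero vector. *)
rewrite geq_min => /orP[|]; last first.
  rewrite leqNgt -tail_count_zero // -(tail_count_compl m e A) => /negP[]; rewrite -[ltnLHS]add0n ltn_add2r.
  rewrite /low_count (bigD1 (Ordinal (qX_gt0 m))) //= A0 /dsum big1 // => i _.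
  by rewrite /dig div0n mod0n.
case: m ler base => [|m] ler base le.
  by move: le; rewrite tail_count_over ?expn0 //; lia.
case: (leqP A (b * q ^ m)) => [leA|ltA].
  by apply: base; rewrite expnS mulnCA leq_mul2l leA orbT.
have [x [eqA ltx]] : exists x, A = b * q ^ m + x /\ x <= q ^ m.
  exists (A - b * q ^ m); rewrite subnKC ?(ltnW ltA) //; split => //.
  rewrite leqNgt; apply/negP => gt.
  have le' : b.+1 * q ^ m <= A by rewrite mulSn; lia.
  have := leq_trans le (tail_count_anti _ _ le').
  case: (leqP b.+1 e) => leb'; last by rewrite tail_count_big //; lia.
  rewrite -[_ * _]addn0 tail_count_shiftn // tail_count_zero ?(leq_ltn_trans (leq_subr _ _)) // subnSK //.
  by lia.
move: le; rewrite eqA tail_count_rec // addnC leq_add2l => le.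
rewrite mulnDr mulnCA -expnS tail_count_rec //; last by rewrite expnS leq_mul2l ltx orbT.
by rewrite addnC leq_add2l (leq_trans le) // tail_count_mulq.
Qed.

End tail_count.

Local Open Scope ring_scope.

(** * Polynomial functions and hyperplanes *)

Section FunSpaces.
Variable F : finFieldType.
Notation Fun T := {ffun T -> F^o}.

Definition fmul (T : finType) (g f : Fun T) : Fun T := [ffun x => g x * f x].
Definition precomp (T T' : finType) (phi : T' -> T) (f : Fun T) : Fun T' :=
  [ffun x => f (phi x)].

Lemma fmul_is_linear (T : finType) (g : Fun T) : linear (fmul g).
Proof. by move=> a u v; apply/ffunP => x; rewrite !ffunE mulrDr -scalerAr. Qed.
HB.instance Definition _ (T : finType) (g : Fun T) :=
  GRing.isLinear.Build F (Fun T) (Fun T) _ (fmul g) (fmul_is_linear g).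

Lemma precomp_is_linear (T T' : finType) (phi : T' -> T) : linear (precomp phi).
Proof. by move=> a u v; apply/ffunP => x; rewrite !ffunE. Qed.
HB.instance Definition _ (T T' : finType) (phi : T' -> T) :=
  GRing.isLinear.Build F (Fun T) (Fun T') _ (precomp phi) (precomp_is_linear phi).

Definition fone (T : finType) : Fun T := [ffun=> 1].

Lemma fmulC (T : finType) : commutative (@fmul T).
Proof. by move=> f g; apply/ffunP => x; rewrite !ffunE mulrC. Qed.
Lemma fmulA (T : finType) : associative (@fmul T).
Proof. by move=> f g h; apply/ffunP => x; rewrite !ffunE mulrA. Qed.
Lemma fmul1 (T : finType) (f : Fun T) : fmul f (fone T) = f.
Proof. by apply/ffunP => x; rewrite !ffunE mulr1. Qed.
Lemma precompM (T T' : finType) (phi : T' -> T) (f g : Fun T) :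
  precomp phi (fmul f g) = fmul (precomp phi f) (precomp phi g).
Proof. by apply/ffunP => x; rewrite !ffunE. Qed.

Section Powers.
Variable T : finType.
Implicit Types (L V : {vspace Fun T}) (u v f g : Fun T).

(** Polynomial functions are obtained as powers of a space of linear ones: [aff] gives degree at
    most k, [lin] the forms of degree k. Restriction to a hyperplane and division by its equation
    can then be checked on generators. *)
Fixpoint pw L k : {vspace Fun T} :=
  if k is k'.+1 then <<[seq fmul u v | u <- vbasis L, v <- vbasis (pw L k')]>>%VS
  else <[fone T]>%VS.

Local Arguments pw : simpl never.

Lemma pwS_ind L k V :
  (forall u v, u \in L -> v \in pw L k -> fmul u v \in V) -> (pw L k.+1 <= V)%VS.
Proof.
move=> h; apply/span_subvP => f /allpairsP[[u v] /= [hu hv ->]].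
by apply: h; apply: vbasis_mem.
Qed.

Lemma mem_pwS L k u v : u \in L -> v \in pw L k -> fmul u v \in pw L k.+1.
Proof.
move=> uL vP; rewrite (coord_vbasis vP) linear_sum /=; apply: rpred_sum => j _.
rewrite linearZ /=; apply: rpredZ.
rewrite fmulC (coord_vbasis uL) linear_sum /=; apply: rpred_sum => i _.
rewrite linearZ /=; apply: rpredZ; rewrite /= fmulC.
by apply: memv_span; apply/allpairsP; exists ((vbasis L)`_i, (vbasis (pw L k))`_j);
  split => //=; apply: mem_nth; rewrite size_tuple.
Qed.

Lemma pw_incr L k : fone T \in L -> (pw L k <= pw L k.+1)%VS.
Proof.
move=> oneL; apply/subvP => f fP; rewrite -[f]fmul1 fmulC.
exact: mem_pwS.
Qed.

(** Think of rho as a projection onto l = 0. Divisibility of u - u' by l, where u' is u after rho,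
    passes to products by u v - u' v' = (u - u') v + u' (v - v'). *)
Lemma pw_div L l (rho : T -> T) k f :
    (forall u, u \in L -> precomp rho u \in L) ->
    (forall u, u \in L -> exists a, u - precomp rho u = a *: l) ->
  f \in pw L k.+1 -> exists2 g, g \in pw L k & f - precomp rho f = fmul l g.
Proof.
move=> stabL divL.
pose D := (\1 - linfun (precomp rho))%VF.
have DE g : D g = g - precomp rho g by rewrite !lfunE /= opp_lfunE !lfunE.
have main j : (pw L j.+1 <= D @^-1: (linfun (fmul l) @: pw L j))%VS.
  elim: j => [|j IH]; apply: pwS_ind => u v uL.
    rewrite -[pw L 0]/(<[_]>%VS) => /vlineP[b ->]; rewrite linearZ /= fmul1 -memv_preim linearZ /= DE.
    have [a ->] := divL u uL; rewrite !rpredZ // -{1}[l]fmul1.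
    by apply/memv_imgP; exists (fone T); rewrite ?lfunE //= memv_line.
  move=> vP; rewrite -memv_preim DE precompM.
  have [a eqa] := divL u uL.
  have := subvP IH v vP; rewrite -memv_preim DE => /memv_imgP[g gP]; rewrite lfunE /= => eqv.
  have -> : fmul u v - fmul (precomp rho u) (precomp rho v) =
     fmul l (a *: v + fmul (precomp rho u) g).
    have -> : fmul u v - fmul (precomp rho u) (precomp rho v) =
      fmul (u - precomp rho u) v + fmul (precomp rho u) (v - precomp rho v).
      by apply/ffunP => x; rewrite !ffunE mulrBl mulrBr addrA subrK.
    rewrite eqa eqv; apply/ffunP => x; rewrite !ffunE mulrDr mulrCA; congr (_ + _).
    by rewrite -scalerAl -scalerAr.
  apply/memv_imgP; exists (a *: v + fmul (precomp rho u) g); last by rewrite lfunE.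
  by rewrite rpredD ?rpredZ // mem_pwS // stabL.
move=> fP; have := subvP (main k) f fP.
by rewrite -memv_preim DE => /memv_imgP[g gP]; rewrite lfunE; exists g.
Qed.

Lemma pw_line l L k :
  (pw (<[l]> + L) k.+1 <= linfun (fmul l) @: pw (<[l]> + L) k + pw L k.+1)%VS.
Proof.
have in_l j v : v \in pw (<[l]> + L) j -> fmul l v \in (linfun (fmul l) @: pw (<[l]> + L) j)%VS.
  by move=> vP; apply/memv_imgP; exists v; rewrite ?lfunE.
elim: k => [|k IH]; apply: pwS_ind => u v /memv_addP[u1 /vlineP[a ->] [u2 u2L ->]] vP;
  rewrite fmulC linearD linearZ /= ![fmul v _]fmulC rpredD //.
- apply: rpredZ; apply: (subvP (addvSl _ _)). exact: in_l.
- by apply: (subvP (addvSr _ _)); exact: mem_pwS.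
- by apply: rpredZ; apply: (subvP (addvSl _ _)); exact: in_l.
have /memv_addP[v1 /memv_imgP[g gP ->] [v2 v2P ->]] := subvP IH v vP.
rewrite lfunE linearD /= rpredD //.
  rewrite fmulA [fmul u2 l]fmulC -fmulA (subvP (addvSl _ _)) // in_l // mem_pwS //.
  by rewrite (subvP (addvSr _ _)).
by rewrite (subvP (addvSr _ _)) // mem_pwS.
Qed.

(** Split off one generator l: a product either contains l or lies in a power of the remaining
    space, which is Pascal's rule for [pdim]. With no generator only k = 0 gives a nonzero space. *)
Lemma dim_pw n L k : (\dim L <= n)%N ->
  (\dim (pw L k) <= if n is n'.+1 then pdim n' k.+1 else nat_of_bool (k == 0))%N.
Proof.
elim: n L k => [|n IH] L k dimL.
  have -> : L = 0%VS by apply/eqP; rewrite -dimv_eq0 -leqn0.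
  case: k => [|k]; first by rewrite dim_vline leq_b1.
  rewrite leqn0 dimv_eq0 -subv0; apply: pwS_ind => u v; rewrite memv0 => /eqP-> _.
  by rewrite fmulC linear0 mem0v.
have mono j : ((if n is n'.+1 then pdim n' j.+1 else nat_of_bool (j == 0%N)) <= pdim n j.+1)%N.
  case: n {IH dimL} => [|n]; last by rewrite pdimS leq_addl.
  by rewrite /pdim bin0; apply: leq_b1.
move: dimL; rewrite leq_eqVlt => /orP[/eqP dimL|]; last first.
  by rewrite ltnS => le; apply: leq_trans (mono k); apply: IH.
elim: k => [|k IHk].
  rewrite dim_vline /pdim addn0 binn; exact: leq_b1.
have [l [L0 [eqL dimL0]]] : exists l L0, L = (<[l]> + L0)%VS /\ (\dim L0 <= n)%N.
  have := span_basis (vbasisP L); have := etrans (size_tuple (vbasis L)) dimL.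
  case: (tval (vbasis L)) => // l s [szs] eqL.
  exists l, <<s>>%VS; rewrite -span_cons eqL; split => //.
  by apply: leq_trans (dim_span _) _; rewrite szs.
rewrite eqL in IHk *; apply: leq_trans (dimvS (pw_line _ _ _)) _.
apply: leq_trans (dimv_add_leqif _ _).1 _.
have h1 : (\dim (linfun (fmul l) @: pw (<[l]> + L0) k) <= pdim n k.+1)%N.
  by apply: leq_trans IHk; rewrite -[leqRHS](limg_ker_dim (linfun (fmul l))) leq_addl.
apply: leq_trans (leq_add h1 (IH L0 k.+1 dimL0)) _.
by case: n {IH dimL dimL0 mono IHk h1} => [|n]; rewrite ?pdimS // /pdim !bin0.
Qed.

End Powers.

Lemma pw_precomp (T T' : finType) (phi : T' -> T) (L : {vspace Fun T}) (L' : {vspace Fun T'}) k f :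
  (forall u, u \in L -> precomp phi u \in L') ->
  f \in pw L k -> precomp phi f \in pw L' k.
Proof.
move=> LL'; have main : (pw L k <= linfun (precomp phi) @^-1: pw L' k)%VS.
  elim: k => [|k IH].
    apply/subvP => g /vlineP[a ->]; rewrite -memv_preim lfunE linearZ /= rpredZ //.
    by have -> : precomp phi (fone T) = fone T' by [apply/ffunP => x; rewrite !ffunE]; rewrite memv_line.
  apply: pwS_ind => u v uL vP; rewrite -memv_preim lfunE /= precompM mem_pwS ?LL' //.
  by have := subvP IH v vP; rewrite -memv_preim lfunE.
by move=> fP; have := subvP main f fP; rewrite -memv_preim lfunE.
Qed.

End FunSpaces.

(** * Hyperplanes of affine space and the Schwartz-Zippel bound *)

Section Affine.
Variable F : finFieldType.
Local Notation q := #|F|.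
Notation Fun T := {ffun T -> F^o}.
Notation fone := (fone F).

Definition afun n (c : 'cV[F]_n) (c0 : F) : Fun 'rV[F]_n := [ffun x => (x *m c) 0 0 + c0].
Definition lfun n (c : 'cV[F]_n) : Fun 'rV[F]_n := [ffun x => (x *m c) 0 0].

Lemma lfun_is_linear n : linear (@lfun n).
Proof. by move=> a u v; apply/ffunP => x; rewrite !ffunE mulmxDr -scalemxAr !mxE. Qed.
HB.instance Definition _ n :=
  GRing.isLinear.Build F 'cV[F]_n (Fun 'rV[F]_n) _ (@lfun n) (@lfun_is_linear n).

Definition lin n : {vspace Fun 'rV[F]_n} := limg (linfun (@lfun n)).
Definition aff n : {vspace Fun 'rV[F]_n} := (<[fone _]> + lin n)%VS.

Lemma linP n u : reflect (exists c, u = lfun c) (u \in lin n).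
Proof.
apply: (iffP memv_imgP) => [[c _ ->]|[c ->]]; exists c; rewrite ?lfunE //.
exact: memvf.
Qed.

Lemma lin_mem n c : lfun c \in lin n. Proof. by apply/linP; exists c. Qed.

Lemma afunE n c c0 : @afun n c c0 = c0 *: fone _ + lfun c.
Proof. by apply/ffunP => x; rewrite !ffunE addrC [_ *: _]mulr1. Qed.

Lemma affP n u : reflect (exists c c0, u = afun c c0) (u \in aff n).
Proof.
apply: (iffP memv_addP) => [[_ /vlineP[c0 ->] [_ /linP[c ->] ->]]|[c [c0 ->]]].
  by exists c, c0; rewrite afunE.
exists (c0 *: fone _); first by rewrite rpredZ ?memv_line.
by exists (lfun c); rewrite ?lin_mem ?afunE.
Qed.

Lemma aff_mem n c c0 : @afun n c c0 \in aff n.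
Proof. by apply/affP; exists c, c0. Qed.

Lemma fone_aff n : fone _ \in aff n.
Proof. by rewrite (subvP (addvSl _ _)) ?memv_line. Qed.

Lemma lin_sub_aff n : (lin n <= aff n)%VS.
Proof. exact: addvSr. Qed.

Lemma dim_lin n : (\dim (lin n) <= n)%N.
Proof.
have := limg_ker_dim (linfun (@lfun n)) fullv; rewrite dimvf dim_matrix => eqn.
rewrite -[leqRHS]muln1; exact: leq_trans (leq_addl _ _) (eq_leq eqn).
Qed.

Lemma dim_aff n : (\dim (aff n) <= n.+1)%N.
Proof.
apply: leq_trans (dimv_add_leqif _ _).1 _; apply: (@leq_add _ _ 1 n); last exact: dim_lin.
by rewrite dim_vline leq_b1.
Qed.

Definition Pol n k := pw (aff n) k.
Definition Hom n k := pw (lin n) k.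

Lemma dim_Pol n k : (\dim (Pol n k) <= pdim n k.+1)%N.
Proof. exact: dim_pw (dim_aff n). Qed.

Lemma Pol_incr n j k : (j <= k)%N -> (Pol n j <= Pol n k)%VS.
Proof.
move=> /subnKC <-; elim: (k - j)%N => [|i IH]; first by rewrite addn0.
by rewrite addnS; apply: subv_trans IH _; apply: pw_incr; apply: fone_aff.
Qed.

Lemma card_rV n : #|{: 'rV[F]_n}| = (q ^ n)%N.
Proof. by rewrite card_mx mul1n. Qed.

(** The matrix with columns c, P is inverse to the one with rows v, B. It is read off from the
    column echelon basis of c and the inverse of that basis. *)
Lemma col_split m (c : 'cV[F]_m.+1) : c != 0 ->
  exists (v : 'rV[F]_m.+1) (B : 'M[F]_(m, m.+1)) (P : 'M[F]_(m.+1, m)),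
    [/\ v *m c = 1%:M, v *m P = 0, B *m P = 1%:M, B *m c = 0 & c *m v + P *m B = 1%:M].
Proof.
move=> c0; have rk : \rank c = 1%N.
  by apply/eqP; rewrite eqn_leq rank_leq_col lt0n mxrank_eq0.
pose L : 'M[F]_(1 + m) := col_ebase c; pose a : 'M[F]_1 := row_ebase c.
have Lu : L \in unitmx := col_ebase_unit c.
have au : a \in unitmx := row_ebase_unit c.
have epid : pid_mx 1 = col_mx 1%:M 0 :> 'M[F]_(1 + m, 1).
  apply/matrixP => i j; rewrite !ord1 !mxE; case: splitP => k eqi; rewrite !mxE ?eqi /=.
    by rewrite !ord1.
  by [].
have eL : L *m (col_mx 1%:M 0 : 'M_(1 + m, 1)) = lsubmx L.
  by rewrite -[L in LHS]hsubmxK mul_row_col mulmx1 mulmx0 addr0.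
have eqc : c = lsubmx L *m a.
  by rewrite -{1}(mulmx_ebase c) rk -eL -epid.
have LV : L *m invmx L = 1%:M by rewrite mulmxV.
have VL : invmx L *m L = 1%:M by rewrite mulVmx.
rewrite -[invmx L]vsubmxK -[L]hsubmxK mul_row_col in LV.
rewrite -[invmx L]vsubmxK -[L]hsubmxK mul_col_row (@scalar_mx_block _ 1 m 1) in VL.
have [e1 e2 e3 e4] := eq_block_mx VL.
rewrite hsubmxK in LV, e1, e2, e3, e4.
exists (invmx a *m usubmx (invmx L)), (dsubmx (invmx L)), (rsubmx L); split.
- by rewrite eqc mulmxA -(mulmxA (invmx a)) e1 mulmx1 mulVmx.
- by rewrite -mulmxA e2 mulmx0.
- by [].
- by rewrite eqc mulmxA e3 mul0mx.
- by rewrite eqc mulmxA -(mulmxA _ a) mulmxV // mulmx1.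
Qed.

(* An affine parametrization phi of the hyperplane l = 0, with a left inverse pi. *)
Definition hyper_param n (l : Fun 'rV[F]_n.+1) (phi : 'rV[F]_n -> 'rV[F]_n.+1)
    (pi : 'rV[F]_n.+1 -> 'rV[F]_n) : Prop :=
  [/\ forall y, l (phi y) = 0, cancel phi pi,
      forall u, u \in aff n.+1 -> precomp phi u \in aff n,
      forall u, u \in aff n -> precomp pi u \in aff n.+1 &
      forall u, u \in aff n.+1 -> exists a, u - precomp (phi \o pi) u = a *: l].

Lemma hyper_exists n (c : 'cV[F]_n.+1) c0 : c != 0 ->
  exists phi pi, hyper_param (afun c c0) phi pi.
Proof.
move=> /col_split[v [B [P [vc vP BP Bc dec]]]].
(* The point - c0 *: v lies on the hyperplane, and the rows of [B] span its direction. *)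
exists (fun y => y *m B - c0 *: v), (fun x => x *m P); split.
- move=> y; rewrite !ffunE mulmxBl -mulmxA Bc mulmx0 sub0r -scalemxAl vc.
  by rewrite !mxE /= mulr1 addNr.
- by move=> y; rewrite mulmxBl -mulmxA BP mulmx1 -scalemxAl vP scaler0 subr0.
- move=> _ /affP[d [d0 ->]]; apply/affP.
  exists (B *m d), (d0 - c0 * (v *m d) 0 0); apply/ffunP => y; rewrite !ffunE.
  by rewrite mulmxBl -scalemxAl mulmxA !mxE -addrA; congr (_ + _); rewrite addrC.
- move=> _ /affP[d [d0 ->]]; apply/affP; exists (P *m d), d0; apply/ffunP => y.
  by rewrite !ffunE mulmxA.
- move=> _ /affP[d [d0 ->]]; exists ((v *m d) 0 0); apply/ffunP => x; rewrite !ffunE /=.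
  have -> : x *m P *m B = x - (x *m c) *m v.
    have := congr1 (mulmx x) dec; rewrite mulmxDr mulmx1 !mulmxA => e.
    by apply/eqP; rewrite eq_sym subr_eq addrC e.
  rewrite [x *m c]mx11_scalar mul_scalar_mx !mulmxBl -!scalemxAl.
  have -> (M N K : 'M[F]_1) (a b : F) : (M - a *: N - b *: K) 0 0 = M 0 0 - a * N 0 0 - b * K 0 0.
    by rewrite !mxE.
  rewrite [_ *: _]mulrDr [_%:M 0 0]mxE eqxx mulr1n.
  by move: ((x *m d) 0 0) ((x *m c) 0 0) ((v *m d) 0 0) => X Y Z; ring.
Qed.

Section Hyper.
Variables (n : nat) (l : Fun 'rV[F]_n.+1).
Variables (phi : 'rV[F]_n -> 'rV[F]_n.+1) (pi : 'rV[F]_n.+1 -> 'rV[F]_n).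
Hypothesis hp : hyper_param l phi pi.

Lemma hyper_phiK x : l x = 0 -> phi (pi x) = x.
Proof.
case: hp => _ _ _ _ sub lx; apply/rowP => i.
have [a /ffunP/(_ x)] := sub _ (aff_mem (delta_mx i 0) 0).
rewrite !ffunE /= lx !addr0 [a *: 0]mulr0.
rewrite -!colE !mxE => /eqP; rewrite subr_eq0 => /eqP <- //.
Qed.

Lemma hyper_card (A : {set 'rV[F]_n.+1}) :
  #|[set x in A | l x == 0]| = #|[set y | phi y \in A]|.
Proof.
case: (hp) => l0 phiK _ _ _.
rewrite -(card_imset _ (can_inj phiK)); apply: eq_card => x; rewrite !inE.
apply/andP/imsetP => [[xA /eqP lx]|[y + ->]].
  by exists (pi x); rewrite ?inE hyper_phiK.
by rewrite inE l0.
Qed.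

Lemma Pol_restr k f : f \in Pol n.+1 k -> precomp phi f \in Pol n k.
Proof. by case: hp => _ _ st _ _; apply: pw_precomp. Qed.

Lemma Pol_div k f : f \in Pol n.+1 k.+1 -> precomp phi f = 0 ->
  exists2 g, g \in Pol n.+1 k & f = fmul l g.
Proof.
case: hp => _ _ st1 st2 sub fP f0.
have [] := @pw_div _ _ (aff n.+1) l (phi \o pi) k f _ sub fP.
  move=> u uA; have -> : precomp (phi \o pi) u = precomp pi (precomp phi u).
    by apply/ffunP => x; rewrite !ffunE.
  by apply: st2; apply: st1.
move=> g gP; suff -> : precomp (phi \o pi) f = 0 by rewrite subr0; exists g.
by apply/ffunP => x; have /ffunP/(_ (pi x)) := f0; rewrite !ffunE.
Qed.

End Hyper.

Lemma Pol0P n f : f \in Pol n 0 -> exists a, forall x, f x = a.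
Proof. by move=> /vlineP[a ->]; exists a => x; rewrite !ffunE [_ *: _]mulr1. Qed.

Lemma card_fibers (T : finType) (A : {set T}) (g : T -> F) :
  #|A| = (\sum_(a : F) #|[set x in A | g x == a]|)%N.
Proof.
rewrite -sum1_card (partition_big g predT) //=; apply: eq_bigr => a _.
by rewrite -sum1_card; apply: eq_bigl => x; rewrite !inE.
Qed.

Lemma afun_slice n (c : 'cV[F]_n) a x : (afun c (- a) x == 0) = (afun c 0 x == a).
Proof. by rewrite !ffunE addr0 subr_eq0. Qed.

Lemma card_slices n (c : 'cV[F]_n.+1) (A : {set 'rV[F]_n.+1}) M :
  (forall a, #|[set x in A | afun c (- a) x == 0%R]| <= M)%N -> (#|A| <= q * M)%N.
Proof.
move=> h; rewrite (card_fibers A (afun c 0)) -sum_nat_const; apply: leq_sum => a _.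
rewrite (leq_trans _ (h a)) // subset_leq_card //; apply/subsetP => x.
by rewrite !inE afun_slice.
Qed.

Definition zeros (T : finType) (f : Fun T) : {set T} := [set x | f x == 0].

Lemma delta_neq0 n (i : 'I_n) : (delta_mx i 0 : 'cV[F]_n) != 0.
Proof.
apply/eqP => /matrixP/(_ i 0); rewrite !mxE !eqxx /= => /eqP.
by rewrite oner_eq0.
Qed.

(** Cut by the parallel hyperplanes x_0 = a. If f vanishes on none of them, induction on n bounds
    each slice; if it vanishes on one, divide by x_0 - a and use induction on k. *)
Lemma schwartz_zippel n k f : f \in Pol n k -> f != 0 -> (q * #|zeros f| <= k * q ^ n)%N.
Proof.
elim: n k f => [|n IHn] k f fP fn0.
  rewrite (_ : zeros f = set0) ?cards0 ?muln0 //.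
  apply/setP => x; rewrite !inE; apply: contraNF fn0 => /eqP fx.
  by apply/eqP/ffunP => y; rewrite (_ : y = x) ?fx ?ffunE // !thinmx0.
elim: k f fP fn0 => [|k IHk] f fP fn0.
  rewrite (_ : zeros f = set0) ?cards0 ?muln0 //.
  have [a fa] := Pol0P fP; apply/setP => x; rewrite !inE fa.
  apply: contraNF fn0 => /eqP a0.
  by apply/eqP/ffunP => y; rewrite fa a0 ffunE.
pose c : 'cV[F]_n.+1 := delta_mx ord0 0.
have hp a := hyper_exists (- a) (delta_neq0 (ord0 : 'I_n.+1)).
case: (boolP [forall a : F, [forall x, (afun c (- a) x == 0) ==> (f x == 0)] == false]).
  move=> /forallP nv.
  have -> : (k.+1 * q ^ n.+1 = q * (k.+1 * q ^ n))%N by rewrite expnS mulnCA.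
  rewrite leq_mul2l; apply/orP; right.
  have sl a : (q * #|[set x in zeros f | afun c (- a) x == 0%R]| <= k.+1 * q ^ n)%N.
    have [phi [pi hpa]] := hp a; rewrite (hyper_card hpa).
    have -> : [set y | phi y \in zeros f] = zeros (precomp phi f).
      by apply/setP => y; rewrite !inE ffunE.
    apply: IHn; first exact: Pol_restr hpa _ _ fP.
    have := nv a; rewrite eqbF_neg; apply: contraNneq => f0; apply/forallP => x.
    apply/implyP => /eqP lx; rewrite -(hyper_phiK hpa lx).
    by move/ffunP/(_ (pi x)): f0; rewrite !ffunE => ->.
  apply: leq_trans (leq_trunc_div (k.+1 * q ^ n) q).
  rewrite mulnC; apply: (@card_slices _ c) => a.
  have q0 : (0 < q)%N by apply/card_gt0P; exists 0.
  by rewrite leq_divRL // mulnC sl.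
move=> /forallPn[a]; rewrite eqbF_neg negbK => /forallP va.
have [phi [pi hpa]] := hp a.
have f0 : precomp phi f = 0.
  apply/ffunP => y; rewrite !ffunE; apply/eqP; apply: (implyP (va _)).
  by case: hpa => ->.
have [g gP eqf] := Pol_div hpa fP f0.
have gn0 : g != 0 by apply: contraNneq fn0 => g0; rewrite eqf g0 linear0.
have := IHk g gP gn0.
have : (#|zeros f| <= #|[set x in zeros f | afun c (- a) x == 0%R]| + #|zeros g|)%N.
  rewrite -cardsUI; apply: leq_trans (leq_addr _ _); apply: subset_leq_card.
  apply/subsetP => x; rewrite !inE {1}eqf ffunE mulf_eq0 => /orP[lx|->].
    by rewrite lx (implyP (va x) lx).
  by rewrite orbT.
have : (#|[set x in zeros f | afun c (- a) x == 0%R]| <= q ^ n)%N.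
  by rewrite (hyper_card hpa) -card_rV max_card.
rewrite expnS mulSn; move: (q ^ n)%N => Q; nia.
Qed.

End Affine.

Section DigitUpdate.
Local Open Scope nat_scope.
Variable q : nat.
Hypothesis q_gt1 : 1 < q.
Let q_gt0 : 0 < q := ltnW q_gt1.
Let qX_gt0 m : 0 < q ^ m. Proof. by rewrite expn_gt0 q_gt0. Qed.

Lemma dig_split i k : exists hi lo, [/\ k = (hi * q + dig q i k) * q ^ i + lo & lo < q ^ i].
Proof.
exists (k %/ q ^ i %/ q), (k %% q ^ i); rewrite ltn_mod qX_gt0; split => //.
by rewrite /dig -divn_eq -divn_eq.
Qed.

Lemma dig_ge i j a lo : lo < q ^ i -> dig q (i + j) (a * q ^ i + lo) = dig q j a.
Proof. by move=> lt; rewrite /dig expnD divnMA divnMDl // (divn_small lt) addn0. Qed.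

Lemma dig_upd i j hi d d' lo : lo < q ^ i -> d < q -> d' < q ->
  dig q j ((hi * q + d') * q ^ i + lo) =
  if j == i then d' else dig q j ((hi * q + d) * q ^ i + lo).
Proof.
move=> lt ltd ltd'; case: (ltngtP j i) => [lt1|lt1|->].
- by rewrite !dig_rest.
- by rewrite -(subnKC (ltnW lt1)) !dig_ge // -(prednK (_ : 0 < j - i)) ?subn_gt0 // !digS_last.
- by rewrite -{1}[i]addn0 dig_ge // dig0_last.
Qed.

Lemma dig_add i j k c : dig q i k + c < q -> dig q j (k + c * q ^ i) = dig q j k + (j == i) * c.
Proof.
move=> lt; have [hi [lo [eqk ltlo]]] := dig_split i k.
have ltd : dig q i k < q by rewrite ltn_mod.
rewrite {1}eqk addnAC -mulnDl -addnA (dig_upd j _ ltlo ltd lt) -eqk.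
by case: eqP => [->|_]; rewrite ?mul1n // mul0n addn0.
Qed.

Lemma dig_sub i j k c : c <= dig q i k -> dig q j (k - c * q ^ i) = dig q j k - (j == i) * c.
Proof.
move=> le; have [hi [lo [eqk ltlo]]] := dig_split i k.
have ltd : dig q i k < q by rewrite ltn_mod.
have -> : k - c * q ^ i = (hi * q + (dig q i k - c)) * q ^ i + lo.
  rewrite {1}eqk addnBA // mulnBl addnBAC // leq_mul2r; apply/orP; right.
  by apply: leq_trans le _; apply: leq_addl.
rewrite (dig_upd j _ ltlo ltd) -?eqk; last exact: leq_ltn_trans (leq_subr _ _) ltd.
by case: eqP => [->|_]; rewrite ?mul1n // mul0n subn0.
Qed.

Lemma add_lt m i k c : i < m -> k < q ^ m -> dig q i k + c < q -> k + c * q ^ i < q ^ m.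
Proof.
move=> ltim ltk lt; have [hi [lo [eqk ltlo]]] := dig_split i k.
have lt_hi : hi < q ^ (m - i.+1).
  rewrite -(ltn_pmul2r (qX_gt0 i.+1)) -expnD subnK //; apply: leq_ltn_trans ltk.
  rewrite eqk expnS mulnA; apply: leq_trans (leq_addr _ _).
  by rewrite leq_mul2r leq_addr orbT.
apply: leq_trans (_ : hi.+1 * q ^ i.+1 <= _); last first.
  by rewrite -(subnK ltim) expnD leq_mul2r lt_hi orbT.
rewrite eqk addnAC -mulnDl -addnA expnS mulnA.
apply: leq_trans (_ : (hi * q + (dig q i k + c)).+1 * q ^ i <= _).
  by rewrite mulSn addnC ltn_add2r.
by rewrite leq_mul2r mulSn [q + _]addnC ltn_add2l lt orbT.
Qed.

Lemma dsum_add m i k c : i < m -> dig q i k + c < q -> dsum q m (k + c * q ^ i) = dsum q m k + c.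
Proof.
move=> ltim lt; rewrite /dsum (eq_bigr _ (fun (j : 'I_m) _ => dig_add j lt)) big_split /=.
congr (_ + _); rewrite (bigD1 (Ordinal ltim)) //= eqxx mul1n big1 ?addn0 // => j.
by rewrite -val_eqE /= => /negPf->.
Qed.

Lemma dsum_sub m i k c : i < m -> c <= dig q i k -> dsum q m (k - c * q ^ i) = dsum q m k - c.
Proof.
move=> ltim le.
have ltd : dig q i k < q by rewrite ltn_mod.
have h : dig q i (k - c * q ^ i) + c = dig q i k by rewrite dig_sub // eqxx mul1n subnK.
have lek : c * q ^ i <= k.
  have [hi [lo [eqk ltlo]]] := dig_split i k.
  rewrite {1}eqk; apply: leq_trans (leq_addr _ _); rewrite leq_mul2r; apply/orP; right.
  by apply: leq_trans le _; apply: leq_addl.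
have := @dsum_add m i (k - c * q ^ i) c ltim; rewrite h subnK // => /(_ ltd) ->.
by rewrite addnK.
Qed.

End DigitUpdate.

(** * Reduced monomials span all functions *)

Section Footprint.
Variable F : finFieldType.
Local Notation q := #|F|.
Notation Fun T := {ffun T -> F^o}.
Notation fone := (fone F).

Lemma card_gt1 : (1 < q)%N.
Proof. exact: finNzRing_gt1. Qed.
Let q_gt1 := card_gt1.
Let q_gt0 : (0 < q)%N := ltnW q_gt1.

Lemma pw_mul (T : finType) (L : {vspace Fun T}) j k f g :
  f \in pw L j -> g \in pw L k -> fmul f g \in pw L (j + k).
Proof.
move=> fP gP; elim: j f fP => [|j IH] f fP.
  by move: fP => /vlineP[a ->]; rewrite fmulC linearZ /= fmul1 rpredZ.
have sub : (pw L j.+1 <= linfun (fmul g) @^-1: pw L (j.+1 + k))%VS.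
  apply: pwS_ind => u v uL vP; rewrite -memv_preim lfunE /= fmulC -fmulA.
  by apply: mem_pwS => //; apply: IH.
by have := subvP sub f fP; rewrite -memv_preim lfunE /= fmulC.
Qed.

Variable n : nat.
Implicit Types (x : 'rV[F]_n).

Definition coordf (i : 'I_n) : Fun 'rV[F]_n := lfun (delta_mx i 0).
Lemma coordfE i x : coordf i x = x 0 i.
Proof. by rewrite ffunE -colE mxE. Qed.

Definition mon (k : nat) : Fun 'rV[F]_n :=
  [ffun x : 'rV[F]_n => \prod_(i < n) x 0 i ^+ dig q i k : F^o].

Lemma mon_Pol k : mon k \in Pol F n (dsum q n k).
Proof.
have pow i a : [ffun x : 'rV[F]_n => x 0 i ^+ a : F^o] \in Pol F n a.
  elim: a => [|a IH]; first by rewrite (_ : finfun _ = fone _) ?memv_line //; apply/ffunP => x; rewrite !ffunE.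
  have -> : [ffun x : 'rV[F]_n => x 0 i ^+ a.+1 : F^o] = fmul (coordf i) [ffun x : 'rV[F]_n => x 0 i ^+ a : F^o] .
    by apply/ffunP => x; rewrite !ffunE -/(coordf i) exprS -coordfE ffunE.
  by apply: mem_pwS; rewrite // (subvP (lin_sub_aff _ _)) // lin_mem.
rewrite /mon /dsum.
have main (s : seq 'I_n) :
  [ffun x : 'rV[F]_n => \prod_(i <- s) x 0 i ^+ dig q i k : F^o] \in Pol F n (\sum_(i <- s) dig q i k).
  elim: s => [|i s IH].
    rewrite big_nil (_ : finfun _ = fone _) ?memv_line //.
    by apply/ffunP => x; rewrite !ffunE big_nil.
  have -> : [ffun x : 'rV[F]_n => \prod_(j <- i :: s) x 0 j ^+ dig q j k : F^o] =
     fmul [ffun x : 'rV[F]_n => x 0 i ^+ dig q i k : F^o] [ffun x : 'rV[F]_n => \prod_(j <- s) x 0 j ^+ dig q j k : F^o] .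
    by apply/ffunP => x; rewrite !ffunE big_cons.
  by rewrite big_cons; apply: pw_mul.
exact: main.
Qed.

Lemma dim_Fun (T : finType) : dim (Fun T) = #|T|.
Proof. by rewrite -[RHS]muln1. Qed.

(** On F the power x ^+ q is x, so a digit q - 1 raised by one becomes q and reduces to 1, that is,
    it drops by q - 2. *)
Lemma coord_mon i k : fmul (coordf i) (mon k) =
  mon (if (dig q i k).+1 < q then k + 1 * q ^ i else k - q.-2 * q ^ i)%N.
Proof.
have key (x : 'rV[F]_n) k' : (forall j : 'I_n, j != i -> dig q j k' = dig q j k) ->
    x 0 i * x 0 i ^+ dig q i k = x 0 i ^+ dig q i k' ->
    x 0 i * \prod_(j < n) x 0 j ^+ dig q j k = \prod_(j < n) x 0 j ^+ dig q j k'.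
  move=> hj hi; rewrite [LHS](congr1 (fun z => _ * z) (bigD1 i _)) //= mulrA hi [RHS](bigD1 i) //=.
  by congr (_ * _); apply: eq_bigr => j ji; rewrite hj.
apply/ffunP => x; rewrite [LHS]ffunE coordfE !(ffunE (fun x => \prod_(i < n) _)).
case: ifP => lt.
  apply: key => [j ji|]; rewrite dig_add ?addn1 //.
    by rewrite -val_eqE in ji; rewrite (negPf ji) mul0n addn0.
  by rewrite eqxx mul1n addn1 exprS.
have ltd : (dig q i k < q)%N by rewrite ltn_mod.
have eqd : dig q i k = q.-1 by lia.
apply: key => [j ji|]; rewrite dig_sub ?eqd //; try lia.
  by rewrite -val_eqE in ji; rewrite (negPf ji) mul0n subn0.
have -> : (q.-1 - (i == i) * q.-2)%N = 1%N by rewrite eqxx; lia.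
by rewrite expr1 -exprS prednK // expf_card.
Qed.

Definition Mspan := <<[seq mon k | k <- iota 0 (q ^ n)]>>%VS.

Lemma mon_Mspan k : (k < q ^ n)%N -> mon k \in Mspan.
Proof. by move=> lt; apply/memv_span/map_f; rewrite mem_iota. Qed.

Lemma coord_mon_range (i : 'I_n) k : (k < q ^ n)%N ->
  ((if (dig q i k).+1 < q then k + 1 * q ^ i else k - q.-2 * q ^ i) < q ^ n)%N.
Proof.
move=> ltk; case: ifP => lt; first by apply: add_lt; rewrite ?addn1.
exact: leq_ltn_trans (leq_subr _ _) ltk.
Qed.

(** The span of the reduced monomials is stable under multiplication by coordinates, hence by
    polynomials in them, and the indicator of a point a is the product of the 1 - (x_i - a_i) ^+ (q
    - 1). *)
Lemma Mspan_full : Mspan = fullv.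
Proof.
pose Cl (g : Fun 'rV[F]_n) := forall f, f \in Mspan -> fmul g f \in Mspan.
have Cl1 : Cl (fone _) by move=> f; rewrite fmulC fmul1.
have ClM g h : Cl g -> Cl h -> Cl (fmul g h).
  by move=> Cg Ch f fM; rewrite -fmulA; apply/Cg/Ch.
have ClD g h a : Cl g -> Cl h -> Cl (g + a *: h).
  move=> Cg Ch f fM; rewrite fmulC linearD linearZ /=.
  by rewrite ![fmul f _]fmulC rpredD ?rpredZ ?Cg ?Ch.
have Clc i : Cl (coordf i).
  move=> f fM; have sub : (Mspan <= linfun (fmul (coordf i)) @^-1: Mspan)%VS.
    apply/span_subvP => g /mapP[k]; rewrite mem_iota => ltk ->.
    by rewrite -memv_preim lfunE /= coord_mon mon_Mspan // coord_mon_range.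
  by have := subvP sub f fM; rewrite -memv_preim lfunE.
have one_mem : fone _ \in Mspan.
  have -> : fone _ = mon 0.
    apply/ffunP => x; rewrite !ffunE big1 // => i _.
    by rewrite /dig div0n mod0n expr0.
  by rewrite mon_Mspan ?expn_gt0 ?q_gt0.
have ind a : [ffun x : 'rV[F]_n => (x == a)%:R : F^o] \in Mspan.
  pose g i : Fun 'rV[F]_n := [ffun x : 'rV[F]_n => (x 0 i == a 0 i)%:R : F^o].
  have Clg i : Cl (g i).
    pose u : Fun 'rV[F]_n := coordf i + (- a 0 i) *: fone _.
    have uE x : u x = x 0 i - a 0 i by rewrite ffunE coordfE !ffunE [_ *: _]mulr1.
    have Clu : Cl u by apply: ClD.
    have Clp j : Cl (iter j (fmul u) (fone _)) by elim: j => // j IH; apply: ClM.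
    have -> : g i = fone _ + (-1) *: iter q.-1 (fmul u) (fone _).
      have pE j x : iter j (fmul u) (fone _) x = (x 0 i - a 0 i) ^+ j.
        by elim: j => [|j IH]; rewrite /= ffunE ?IH ?uE ?exprS.
      apply/ffunP => x; rewrite !ffunE pE [_ *: _]mulN1r.
      rewrite -subr_eq0; case: eqP => [->|/eqP nz].
        by rewrite expr0n (_ : (q.-1 == 0%N) = false) ?subr0 //; apply/eqP; have := q_gt1; lia.
      by rewrite (_ : _ ^+ q.-1 = 1) ?subrr //; apply: (mulfI nz); rewrite mulr1 -exprS prednK // expf_card.
    exact: ClD.
  have Cls (s : seq 'I_n) : [ffun x : 'rV[F]_n => \prod_(i <- s) g i x] \in Mspan.
    elim: s => [|i s IH].
      by rewrite (_ : finfun _ = fone _) //; apply/ffunP => x; rewrite !ffunE big_nil.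
    have -> : [ffun x : 'rV[F]_n => \prod_(j <- i :: s) g j x] = fmul (g i) [ffun x : 'rV[F]_n => \prod_(j <- s) g j x].
      by apply/ffunP => x; rewrite !ffunE big_cons ffunE.
    exact: Clg.
  suff -> : [ffun x : 'rV[F]_n => (x == a)%:R : F^o] = [ffun x : 'rV[F]_n => \prod_(i <- index_enum 'I_n) g i x] by [].
  apply/ffunP => x; rewrite !ffunE; case: eqP => [->|/eqP nx].
    by rewrite big1 // => i _; rewrite ffunE eqxx.
  have [i ni] : exists i, x 0 i != a 0 i.
    apply/existsP; apply: contraNT nx; rewrite negb_exists => /forallP h.
    by apply/eqP/rowP => i; apply/eqP; have := h i; rewrite negbK.
  by rewrite (bigD1 i) //= ffunE (negPf ni) mul0r.
apply/eqP; rewrite eqEsubv subvf; apply/subvP => f _.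
have -> : f = \sum_a f a *: [ffun x : 'rV[F]_n => (x == a)%:R : F^o].
  apply/ffunP => x; rewrite sum_ffunE (bigD1 x) //= !ffunE eqxx [_ *: _]mulr1 big1 ?addr0 // => a.
  by rewrite !ffunE eq_sym => /negPf->; rewrite [_ *: _]mulr0.
by apply: rpred_sum => a _; apply: rpredZ.
Qed.

End Footprint.

(** * The affine bound via footprints *)

Section ZeroSets.
Variables (F : finFieldType) (T : finType).
Notation Fun T := {ffun T -> F^o}.
Implicit Types (U W : {vspace Fun T}).

Definition zset W : {set T} := [set x | all (fun f : Fun T => f x == 0) (vbasis W)].

Lemma zsetP W x : reflect (forall f, f \in W -> f x = 0) (x \in zset W).
Proof.
rewrite inE; apply: (iffP allP) => [h f fW|h f /vbasis_mem fW]; last by apply/eqP/h.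
rewrite (coord_vbasis fW) sum_ffunE big1 // => i _; rewrite ffunE.
have /eqP -> : (vbasis W)`_i x == 0 by apply: h; rewrite mem_nth ?size_tuple.
by rewrite scaler0.
Qed.

Lemma zset_anti U W : (U <= W)%VS -> zset W \subset zset U.
Proof.
move=> sub; apply/subsetP => x /zsetP h; apply/zsetP => f fU; apply: h.
exact: (subvP sub).
Qed.

Lemma zset_sub W f : f \in W -> zset W \subset zeros f.
Proof. by move=> fW; apply/subsetP => x /zsetP h; rewrite inE h. Qed.

End ZeroSets.

Section Footprint.
Variables (F : finFieldType) (n : nat).
Local Notation q := #|F|.
Notation Fun T := {ffun T -> F^o}.
Let q_gt1 := card_gt1 F.
Let q_gt0 : (0 < q)%N := ltnW q_gt1.
Let qn_gt0 : (0 < q ^ n)%N. Proof. by rewrite expn_gt0 q_gt0. Qed.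
Variable X : {set 'rV[F]_n}.
Notation mon := (mon F n).

Definition XT : finType := {x : 'rV[F]_n | x \in X}.
Definition resX := linfun (precomp (val : XT -> 'rV[F]_n) : Fun _ -> Fun XT).

(* Degree first, ties broken lexicographically. *)
Definition graded_key (k : nat) : nat := (dsum q n k * q ^ n + k)%N.

Definition below (k : nat) : {vspace Fun XT} :=
  <<[seq resX (mon j) | j <- iota 0 (q ^ n) & (graded_key j < graded_key k)%N]>>%VS.

(* The standard monomials of X: those whose restriction to X is not spanned by the
   restrictions of smaller monomials. *)
Definition footprint : pred nat := fun k => resX (mon k) \notin below k.

Lemma graded_key_inj j k : (j < q ^ n)%N -> (k < q ^ n)%N -> graded_key j = graded_key k -> j = k.
Proof. by move=> ltj ltk /(congr1 (modn^~ (q ^ n)%N)); rewrite !modnMDl !modn_small. Qed.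

(** If a monomial is spanned on X by smaller ones, so is its product with x_i: multiplication by x_i
    preserves the graded order, and the reduction of x_i ^+ q only makes a monomial smaller. *)
Lemma footprint_dclosed : dclosed q n footprint.
Proof.
move=> i k lti ltk fk dk; apply: contraLR fk; rewrite !negbK => below_k'.
pose io := Ordinal lti; set k' := (k - q ^ i)%N in below_k'.
have eqk : (k' + 1 * q ^ io)%N = k by rewrite mul1n subnK // dig_gt0_le.
have ltk' : (k' < q ^ n)%N by apply: leq_ltn_trans (leq_subr _ _) ltk.
have dk' : (dig q io k').+1 = dig q i k.
  have := @dig_sub _ q_gt1 i i k 1 dk; rewrite mul1n eqxx mul1n -/k' /= => ->.
  by rewrite subn1 prednK.
have dkq : (dig q i k < q)%N by rewrite ltn_mod.
have sk : dsum q n k = (dsum q n k').+1.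
  by rewrite -[in LHS]eqk dsum_add ?addn1 //= dk'.
have gk : graded_key k = (graded_key k' + q ^ n + q ^ i)%N.
  by rewrite /graded_key sk mulSn; have := eqk; rewrite mul1n /=; lia.
have -> : mon k = fmul (coordf F io) (mon k') by rewrite coord_mon dk' dkq eqk.
pose D := linfun (fmul (resX (coordf F io))).
have resM f : resX (fmul (coordf F io) f) = D (resX f) by rewrite !lfunE /= precompM.
rewrite resM; have sub : (below k' <= D @^-1: below k)%VS.
  apply/span_subvP => f /mapP[j]; rewrite mem_filter mem_iota => /andP[ltjk' ltj] ->.
  rewrite -memv_preim -resM coord_mon; apply/memv_span/map_f.
  rewrite mem_filter mem_iota (coord_mon_range io ltj) leq0n !andbT gk.
  case: ifP => ltd.
    by move: ltjk'; rewrite /graded_key dsum_add ?addn1 // mulSn mul1n /=; lia.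
  apply: (@leq_ltn_trans (graded_key j)); last by lia.
  rewrite /graded_key leq_add ?leq_subr // leq_mul2r dsum_sub ?leq_subr ?orbT //=.
  by have : (dig q i j < q)%N by [rewrite ltn_mod]; move: ltd => /=; lia.
by have := subvP sub _ below_k'; rewrite -memv_preim.
Qed.

Lemma resX_full : limg resX = fullv.
Proof.
apply/eqP; rewrite eqEsubv subvf; apply/subvP => f _; apply/memv_imgP.
exists ([ffun x => if insub x is Some y then f y else 0] : Fun 'rV[F]_n); first exact: memvf.
by apply/ffunP => y; rewrite lfunE !ffunE valK.
Qed.

Lemma resX_mon_span k : (k < q ^ n)%N ->
  resX (mon k) \in <<[seq resX (mon j) | j <- iota 0 (q ^ n) & footprint j]>>%VS.
Proof.
have [N] := ubnP (graded_key k); elim: N k => // N IH k ltN ltk.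
case: (boolP (footprint k)) => [fk|].
  by apply/memv_span/map_f; rewrite mem_filter fk mem_iota.
rewrite negbK; apply: subvP; apply/span_subvP => f /mapP[j].
rewrite mem_filter mem_iota => /andP[ltjk ltj] ->.
by apply: IH => //; apply: leq_trans ltjk _.
Qed.

Lemma count_nsize (A : pred nat) M : size (filter A (iota 0 M)) = nsize M A.
Proof.
by rewrite size_filter -sum1_count big_mkcond /nsize -(big_mkord xpredT (fun n => nat_of_bool (A n))) /index_iota subn0;
  apply: eq_bigr => i _; case: (A i).
Qed.

(** The standard monomials span all functions on X, because every function on X extends to the whole
    space. *)
Lemma card_footprint : (#|X| <= nsize (q ^ n) footprint)%N.
Proof.
have -> : #|X| = \dim (limg resX).
  by rewrite resX_full dimvf dim_Fun card_sig.
rewrite -count_nsize -(size_map (fun j => resX (mon j))).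
apply: leq_trans (dim_span _); apply: dimvS.
rewrite -(Mspan_full F n) limg_span; apply/span_subvP => f /mapP[_ /mapP[k + ->] ->].
by rewrite mem_iota => ltk; apply: resX_mon_span.
Qed.

(** With the largest monomial first, the head is never in the span of the smaller monomials that
    follow. *)
Lemma free_footprint (s : seq nat) : {subset s <= iota 0 (q ^ n)} -> all footprint s -> uniq s ->
  sorted (fun j k => graded_key k <= graded_key j)%N s -> free [seq resX (mon j) | j <- s].
Proof.
elim: s => [|k s IH] sub; first by rewrite nil_free.
move=> /andP[fk fs] /andP[ks us] ps.
rewrite map_cons free_cons IH ?(path_sorted ps) //; last by move=> j js; apply: sub; rewrite inE js orbT.
rewrite andbT; apply: contra fk; apply: subvP; apply/span_subvP => f /mapP[j js ->].
apply/memv_span/map_f; rewrite mem_filter sub ?inE ?js ?orbT // andbT.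
have trans : transitive (fun j k => graded_key k <= graded_key j)%N.
  by move=> a b c h1 h2; apply: leq_trans h2 h1.
have := order_path_min trans ps => /allP/(_ j js).
rewrite leq_eqVlt => /orP[/eqP eqk|//].
have ltj : (j < q ^ n)%N by have := sub j; rewrite inE js orbT mem_iota => /(_ isT).
have ltk : (k < q ^ n)%N by have := sub k; rewrite inE eqxx mem_iota => /(_ isT).
by rewrite -(graded_key_inj ltj ltk eqk) js in ks.
Qed.

Lemma low_count_footprint e : (low_count q n e footprint <= \dim (resX @: Pol F n e))%N.
Proof.
pose s := sort (fun j k => graded_key k <= graded_key j)%N [seq k <- iota 0 (q ^ n) | footprint k && (dsum q n k <= e)%N].
have -> : low_count q n e footprint = size [seq resX (mon j) | j <- s].
  by rewrite size_map size_sort count_nsize.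
have mem_s k : k \in s -> [/\ k \in iota 0 (q ^ n), footprint k & (dsum q n k <= e)%N].
  by rewrite mem_sort mem_filter => /andP[/andP[]].
have fs : free [seq resX (mon j) | j <- s].
  apply: free_footprint.
  - by move=> k /mem_s[].
  - by apply/allP => k /mem_s[].
  - by rewrite sort_uniq filter_uniq ?iota_uniq.
  - by apply: sort_sorted => j k; apply: leq_total.
rewrite -(eqP fs); apply: dimvS; apply/span_subvP => f /mapP[k /mem_s[_ _ le] ->].
by apply: memv_img; apply: (subvP (Pol_incr _ _ le)); apply: mon_Pol.
Qed.

(** [W] lies in the kernel of restriction to X on polynomials of degree at most e. The image has
    dimension at least the low count of the footprint, hence at least that of the first #|X|
    vectors. *)
Theorem affine_hilbert e W : (e * e <= q)%N -> (W <= Pol F n e)%VS -> X \subset zset W ->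
  (\dim W <= tail_count q n e #|X|)%N.
Proof.
move=> le_e WP XW.
have lt_e : (e < q)%N.
  case: e le_e {WP} => [|[|e]] // le; apply: leq_trans le; by rewrite ltn_Pmull.
have h1 : (low_count q n e (fun k => k < #|X|)%N <= \dim (resX @: Pol F n e))%N.
  apply: leq_trans (low_count_footprint e); apply: leq_trans (low_count_initial q_gt1 le_e footprint_dclosed).
  by apply: low_count_mono => k _ lt; apply: leq_trans lt card_footprint.
have WK : (W <= Pol F n e :&: lker resX)%VS.
  rewrite subv_cap WP; apply/subvP => f fW; rewrite memv_ker lfunE; apply/eqP/ffunP => y.
  by rewrite !ffunE; apply: (zsetP _ _ (subsetP XW _ (valP y))).
have := dimvS WK; have := limg_ker_dim resX (Pol F n e); have := dim_Pol F n e.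
rewrite -(tail_count_zero q_gt1) // -(tail_count_compl q n e #|X|).
move=> h2 h3 h4; rewrite -(leq_add2l (low_count q n e (fun k => k < #|X|)%N)).
by apply: leq_trans h2; rewrite -h3 addnC leq_add.
Qed.

End Footprint.

(** * Restriction to a hyperplane and division by its equation *)

Section Restrict.
Variable F : finFieldType.
Local Notation q := #|F|.
Notation Fun T := {ffun T -> F^o}.
Notation Pol := (Pol F).
Notation afun := (@afun F _).

Definition vanish (T : finType) (A : {set T}) : {vspace Fun T} :=
  lker (linfun (fmul [ffun x => (x \in A)%:R : F^o])).

Lemma vanishP (T : finType) (A : {set T}) (f : Fun T) :
  reflect (forall x, x \in A -> f x = 0) (f \in vanish A).
Proof.
rewrite memv_ker lfunE /=; apply: (iffP eqP) => [/ffunP h x xA|h].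
  by have := h x; rewrite !ffunE xA mul1r.
apply/ffunP => x; rewrite !ffunE; case: (boolP (x \in A)) => [/h->|_]; first by rewrite mulr0.
by rewrite mul0r.
Qed.

Definition hplane n (c : 'cV[F]_n) (c0 : F) : {set 'rV[F]_n} := [set x | afun c c0 x == 0].

Definition restr n m (phi : 'rV[F]_n -> 'rV[F]_m) (U : {vspace Fun 'rV[F]_m}) :
  {vspace Fun 'rV[F]_n} :=
  (linfun (precomp phi) @: U)%VS.

Lemma afun_inj n (c d : 'cV[F]_n) c0 d0 : afun c c0 = afun d d0 -> c = d.
Proof.
move=> /ffunP h; have e0 := h 0; rewrite !ffunE !mul0mx !mxE !add0r in e0.
apply/matrixP => i j; rewrite ord1; have := h (delta_mx 0 i); rewrite !ffunE e0 => /addIr.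
by rewrite -!rowE !mxE.
Qed.

Section OneHyper.
Variables (n : nat) (c : 'cV[F]_n.+1) (c0 : F).
Variables (phi : 'rV[F]_n -> 'rV[F]_n.+1) (pi : 'rV[F]_n.+1 -> 'rV[F]_n).
Hypothesis hp : hyper_param (afun c c0) phi pi.
Variables (k : nat) (U : {vspace Fun 'rV[F]_n.+1}).

Lemma lker_restr : lker (linfun (precomp phi : Fun _ -> Fun _)) = vanish (hplane c c0).
Proof.
apply/vspaceP => f; apply/idP/vanishP.
  rewrite memv_ker lfunE => /eqP/ffunP h x; rewrite inE => /eqP lx.
  by have := h (pi x); rewrite !ffunE (hyper_phiK hp lx).
move=> h; rewrite memv_ker lfunE; apply/eqP/ffunP => y; rewrite !ffunE.
by apply: h; rewrite inE; case: hp => ->.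
Qed.

Lemma dim_restr :
  (\dim (U :&: vanish (hplane c c0)) + \dim (restr phi U))%N = \dim U.
Proof. by rewrite -lker_restr limg_ker_dim. Qed.

Lemma restr_Pol : (U <= Pol n.+1 k)%VS -> (restr phi U <= Pol n k)%VS.
Proof.
move=> sub; apply/subvP => f /memv_imgP[g gU ->]; rewrite lfunE.
by apply: (Pol_restr hp); apply: (subvP sub).
Qed.

Lemma zset_restr y : (y \in zset (restr phi U)) = (phi y \in zset U).
Proof.
apply/zsetP/zsetP => h f fU.
  have := h (precomp phi f); rewrite ffunE; apply.
  by apply/memv_imgP; exists f; rewrite ?lfunE.
by move/memv_imgP: fU => [g gU ->]; rewrite lfunE ffunE h.
Qed.

Lemma card_zset_restr : #|zset U :&: hplane c c0| = #|zset (restr phi U)|.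
Proof.
rewrite -[LHS](_ : #|[set x in zset U | afun c c0 x == 0]| = _).
  by rewrite (hyper_card hp); apply: eq_card => y; rewrite inE zset_restr.
by apply: eq_card => x; rewrite !inE.
Qed.

(** V consists of all g of degree at most k whose product with the equation lies in [U];
    multiplication maps it onto the elements of [U] vanishing on the hyperplane. *)
Lemma quot_exists : (U <= Pol n.+1 k.+1)%VS ->
  exists V : {vspace Fun 'rV[F]_n.+1},
    [/\ (V <= Pol n.+1 k)%VS, (\dim (U :&: vanish (hplane c c0)) <= \dim V)%N &
        forall x, x \in zset U -> x \notin hplane c c0 -> x \in zset V].
Proof.
move=> UP; pose M := linfun (fmul (afun c c0)).
exists (Pol n.+1 k :&: M @^-1: U)%VS; split; first exact: capvSl.
  have sub : (U :&: vanish (hplane c c0) <= M @: (Pol n.+1 k :&: M @^-1: U))%VS.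
    apply/subvP => f; rewrite memv_cap -lker_restr memv_ker lfunE => /andP[fU /eqP f0].
    have [g gP eqf] := Pol_div hp (subvP UP _ fU) f0.
    apply/memv_imgP; exists g; last by rewrite lfunE.
    by rewrite memv_cap gP -memv_preim lfunE /= -eqf.
  apply: leq_trans (dimvS sub) _.
  by rewrite -[leqRHS](limg_ker_dim M) leq_addl.
move=> x /zsetP h; rewrite inE => lx; apply/zsetP => g.
rewrite memv_cap -memv_preim lfunE => /andP[_ /h/=]; rewrite ffunE => /eqP.
by rewrite mulf_eq0 (negPf lx) => /eqP.
Qed.

End OneHyper.

Lemma card_zset_le n k (U : {vspace Fun 'rV[F]_n}) : (U <= Pol n k)%VS -> (0 < \dim U)%N ->
  (q * #|zset U| <= k * q ^ n)%N.
Proof.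
rewrite lt0n dimv_eq0 -subv0 => UP /subvPn[f fU]; rewrite memv0 => f0.
apply: leq_trans (schwartz_zippel (subvP UP _ fU) f0); rewrite leq_mul2l; apply/orP; right.
exact/subset_leq_card/zset_sub.
Qed.

Lemma zset_dim0 (U : {vspace Fun 'rV[F]_0}) : (0 < \dim U)%N -> #|zset U| = 0%N.
Proof.
rewrite lt0n dimv_eq0 -subv0 => /subvPn[f fU]; rewrite memv0 => f0.
apply: eq_card0 => x; apply: contraNF f0 => /zsetP/(_ f fU) fx.
by apply/eqP/ffunP => y; rewrite (_ : y = x) ?fx ?ffunE // !thinmx0.
Qed.

Lemma Pol0_zset n (U : {vspace Fun 'rV[F]_n}) x : (U <= Pol n 0)%VS -> (0 < \dim U)%N ->
  x \notin zset U.
Proof.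
rewrite lt0n dimv_eq0 -subv0 => UP /subvPn[f fU]; rewrite memv0 => f0.
have [a fa] := Pol0P (subvP UP _ fU).
apply: contraNN f0 => /zsetP/(_ f fU) fx; apply/eqP/ffunP => y.
by rewrite fa -(fa x) fx ffunE.
Qed.

Lemma sq_lt e : (e * e <= q)%N -> (e < q)%N.
Proof.
have q_gt1 := card_gt1 F; case: e => [|[|e]] // le; first exact: ltnW.
by apply: leq_trans le; rewrite ltn_Pmull.
Qed.

(** The affine bound cut down to its two leading terms, the form in which the later estimates use
    it. *)
Lemma class_bound n e b (U : {vspace Fun 'rV[F]_n}) : (e * e <= q)%N -> (U <= Pol n e)%VS ->
  (pdim n (e - b) < \dim U)%N ->
  (q ^ 2 * #|zset U| <= b * q ^ n.+1 + (e - b) * q ^ n)%N.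
Proof.
move=> le_e UP lt; apply: tail_count_ub; [exact: card_gt1|exact: sq_lt|].
by apply: leq_trans lt _; apply: affine_hilbert.
Qed.

(** Pascal's rule: if few elements of [U] vanish on the hyperplane, the restriction still exceeds
    the same class one dimension lower. *)
Lemma class_bound_restr n e a c c0 phi pi (U : {vspace Fun 'rV[F]_n.+1}) :
  hyper_param (afun c c0) phi pi -> (pdim n.+1 (e - a) < \dim U)%N ->
  (\dim (U :&: vanish (hplane c c0)) <= pdim n.+1 (e - a - 1))%N ->
  (pdim n (e - a) < \dim (restr phi U))%N.
Proof.
move=> hp; rewrite -(dim_restr hp U); move: (\dim _) (\dim _) => s t.
case: (e - a)%N => [|f]; first by move=> + /=; rewrite leqn0 => + /eqP s0; rewrite s0 add0n.
rewrite subn1 pdimS /= => lt le; rewrite -(ltn_add2l (pdim n.+1 f)).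
by apply: leq_trans lt _; rewrite leq_add2r.
Qed.

(** Inside the hyperplane of cG, the locus where cm vanishes too is a hyperplane on which all of [U]
    vanishes. Division by its equation lowers the degree to e, and [class_bound] applies with b = a
    - 1. *)
Lemma pencil_piece n e a cG cG0 cm cm0 phi pi (U : {vspace Fun 'rV[F]_n.+1}) :
  (e.+1 * e.+1 <= q)%N -> (0 < a)%N -> (a <= e.+1)%N ->
  hyper_param (afun cG cG0) phi pi -> (forall b, cm != b *: cG) ->
  (U <= Pol n.+1 e.+1)%VS -> (pdim n (e.+1 - a) < \dim (restr phi U))%N ->
  hplane cG cG0 :&: hplane cm cm0 \subset zset U ->
  (q ^ 2 * #|[set x in zset U | (x \in hplane cG cG0) && (x \notin hplane cm cm0)]|
     <= (a - 1) * q ^ n.+1 + (e.+1 - a) * q ^ n)%N.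
Proof.
move=> le_e a0 lea hp indep UP lt_dim subU.
have [l0 phiK st _ div] := hp.
have /affP[d [d0 eqd]] := st _ (aff_mem cm cm0).
(* Were the second equation constant on the first hyperplane, cm would be a multiple of cG. *)
have dn0 : d != 0.
  apply/eqP => d_0; have [b] := div _ (aff_mem cm cm0) => /eqP; rewrite subr_eq => /eqP eqb.
  have : afun cm cm0 = afun (b *: cG) (b * cG0 + d0).
    rewrite eqb; apply/ffunP => x; rewrite !ffunE /=.
    have := congr1 (fun f : Fun _ => f (pi x)) eqd; rewrite /= !ffunE d_0 mulmx0 => ->.
    by rewrite -scalemxAr !mxE add0r [_ *: _]mulrDr addrA.
  by move=> /afun_inj eqc; have := indep b; rewrite eqc eqxx.
case: n cG cm phi pi U hp indep UP lt_dim subU l0 phiK st div d eqd dn0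
  => [|n] cG cm phi pi U hp indep UP lt_dim subU l0 phiK st div d eqd dn0.
  by rewrite flatmx0 eqxx in dn0.
have [phi' [pi' hp']] := hyper_exists d0 dn0.
have [V [VP dimV zV]] := quot_exists hp' (restr_Pol hp UP).
have all_van : (restr phi U <= vanish (hplane d d0))%VS.
  apply/subvP => f fU; apply/vanishP => y; rewrite inE => /eqP dy.
  have : y \in zset (restr phi U).
    rewrite (zset_restr phi U); apply: (subsetP subU); rewrite !inE l0 eqxx /=.
    by have := congr1 (fun f : Fun _ => f y) eqd; rewrite /= [precomp _ _ _]ffunE => ->; rewrite dy.
  by move=> /zsetP; apply.
have dimV' : (pdim n.+1 (e - (a - 1)) < \dim V)%N.
  apply: leq_trans dimV; rewrite (capv_idPl all_van).
  by have -> : (e - (a - 1) = e.+1 - a)%N by lia.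
have le_e' : (e * e <= q)%N by apply: leq_trans le_e; rewrite leq_mul.
have := class_bound le_e' VP dimV'.
have -> : (e - (a - 1) = e.+1 - a)%N by lia.
apply: leq_trans.
rewrite leq_mul2l; apply/orP; right.
have -> : #|[set x in zset U | (x \in hplane cG cG0) && (x \notin hplane cm cm0)]| =
    #|[set x in zset U :\: hplane cm cm0 | afun cG cG0 x == 0]|.
  by apply: eq_card => x; rewrite !inE andbCA -andbA andbC -andbA andbCA.
rewrite (hyper_card hp); apply: subset_leq_card; apply/subsetP => y.
rewrite inE in_setD -(zset_restr phi U) inE => /andP[ny yU]; apply: zV => //.
by rewrite inE; have := congr1 (fun f : Fun _ => f y) eqd; rewrite /= [precomp _ _ _]ffunE => <-.
Qed.

End Restrict.

(** * Zero sets containing no hyperplane *)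

(** Coefficient of the second-order term in [stability]. For a = 1 it is e * e, at most q; for a > 1
    a further e is saved, which pays for the section at infinity in [chart_zeros]. *)
Definition slack (e a : nat) : nat := (e * e - (1 < a) * e)%N.

Section Stability.
Variable F : finFieldType.
Local Notation q := #|F|.
Notation Fun T := {ffun T -> F^o}.
Notation Pol := (Pol F).
Notation afun := (@afun F _).
Notation vanish := (vanish F).
Let q_gt1 := card_gt1 F.

Definition has_hplane n (U : {vspace Fun 'rV[F]_n}) : bool :=
  [exists c, exists c0, (c != 0) && (hplane c c0 \subset zset U)].

Lemma has_hplaneP n (U : {vspace Fun 'rV[F]_n}) :
  reflect (exists c c0, c != 0 /\ hplane c c0 \subset zset U) (has_hplane U).
Proof.
apply: (iffP existsP) => [[c /existsP[c0 /andP[c0n sub]]]|[c [c0 [cn sub]]]].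
  by exists c, c0.
by exists c; apply/existsP; exists c0; rewrite cn.
Qed.

Lemma hplane_vanish n c c0 (U : {vspace Fun 'rV[F]_n}) :
  hplane c c0 \subset zset U -> (U :&: vanish (hplane c c0) = U)%VS.
Proof.
move=> sub; apply/capv_idPl/subvP => f fU; apply/vanishP => x xH.
by have /zsetP/(_ f fU) := subsetP sub _ xH.
Qed.

Lemma restr_pos n c c0 phi pi (U : {vspace Fun 'rV[F]_n.+1}) :
  hyper_param (afun c c0) phi pi -> ~~ (hplane c c0 \subset zset U) ->
  (0 < \dim (restr phi U))%N.
Proof.
move=> hp /subsetPn[x]; rewrite inE => /eqP lx; rewrite -(hyper_phiK hp lx) -zset_restr => nz.
rewrite lt0n dimv_eq0; apply: contraNneq nz => ->; apply/zsetP => f.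
by rewrite memv0 => /eqP->; rewrite ffunE.
Qed.

Lemma card_cut (T : finType) (Z H V : {set T}) :
  (forall x, x \in Z -> x \notin H -> x \in V) -> (#|Z| <= #|Z :&: H| + #|V|)%N.
Proof.
move=> h; rewrite -(cardsID H Z) leq_add2l; apply: subset_leq_card.
by apply/subsetP => x; rewrite inE => /andP[/[swap]]; apply: h.
Qed.

Lemma card_hplane n (c : 'cV[F]_n) c0 : c != 0 -> (q * #|hplane c c0| = q ^ n)%N.
Proof.
case: n c => [|n] c cn0; first by rewrite flatmx0 eqxx in cn0.
have [phi [pi hp]] := hyper_exists c0 cn0.
have -> : #|hplane c c0| = #|[set x in [set: 'rV[F]_n.+1] | afun c c0 x == 0]|.
  by apply: eq_card => x; rewrite !inE.
rewrite (hyper_card hp) expnS; congr muln.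
by rewrite -card_rV; apply: eq_card => y; rewrite !inE.
Qed.

(** A cut by one hyperplane costs e.+1 in the second-order coefficient, and [slack] grows at least
    this much from e to e.+1. *)
Lemma arith_one_cut e a Q z z1 z2 : (0 < a -> a <= e.+1 -> z <= z1 + z2 ->
  q * z1 <= e.+1 * Q -> q ^ 2 * z2 <= (a - 1) * (q * (q * Q)) + slack e a * (q * Q) ->
  q ^ 2 * z <= (a - 1) * (q * (q * Q)) + slack e.+1 a * (q * Q))%N.
Proof.
move=> a0 lea lez h1 h2; have h3 : (slack e a + e.+1 <= slack e.+1 a)%N.
  by rewrite /slack; case: (ltnP 1 a) => ?; nia.
have h4 := leq_mul (leqnn (q * Q)) h3.
apply: (@leq_trans (q ^ 2 * (z1 + z2))); first by rewrite leq_mul2l lez orbT.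
have h5 : (q ^ 2 * z1 <= e.+1 * (q * Q))%N by rewrite -mulnn -mulnA mulnCA leq_mul2l h1 orbT.
by rewrite mulnDr; nia.
Qed.

(** The two cuts cost e.+2 each. For e = 0 the last quotients have no zeros, so z3 = 0; if moreover
    a = 2, the cost 4 exceeds [slack] and is absorbed by the leading term, as q >= 4. *)
Lemma arith_two_cuts e a Q z z1 z2 z3 : (0 < a -> a <= e.+2 -> e.+2 * e.+2 <= q ->
  z <= z1 + (z2 + z3) ->
  q * z1 <= e.+2 * Q -> q * z2 <= e.+2 * Q ->
  q ^ 2 * z3 <= (a - 1) * (q * (q * Q)) + (e - (a - 1)) * (q * Q) ->
  q * z3 <= e * (q * Q) ->
  q ^ 2 * z <= (a - 1) * (q * (q * Q)) + slack e.+2 a * (q * Q))%N.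
Proof.
move=> a0 lea le_e lez h1 h2 h3 h3'.
apply: (@leq_trans (q ^ 2 * (z1 + (z2 + z3)))); first by rewrite leq_mul2l lez orbT.
have h5 : (q ^ 2 * z1 <= e.+2 * (q * Q))%N by rewrite -mulnn -mulnA mulnCA leq_mul2l h1 orbT.
have h6 : (q ^ 2 * z2 <= e.+2 * (q * Q))%N by rewrite -mulnn -mulnA mulnCA leq_mul2l h2 orbT.
rewrite !mulnDr; case: (posnP e) => [e0|e0]; last first.
  have h4 : (e.+2 + e.+2 + (e - (a - 1)) <= slack e.+2 a)%N.
    by rewrite /slack; case: (ltnP 1 a) => ?; nia.
  have h7 := leq_mul (leqnn (q * Q)) h4; nia.
subst e; have z30 : z3 = 0%N by move: h3'; rewrite mul0n leqn0 muln_eq0 => /orP[|/eqP//]; have := q_gt1; lia.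
rewrite z30 muln0 addn0; case: (ltnP 1 a) => a1.
  have -> : a = 2 by lia.
  rewrite /slack /= mul1n; have h7 := leq_mul le_e (leqnn (q * Q)); nia.
have -> : a = 1%N by lia.
rewrite /slack subnn !mul0n add0n subn0.
by move: (q ^ 2 * z1)%N (q ^ 2 * z2)%N (q * Q)%N h5 h6 => x y t; lia.
Qed.

Lemma arith_pencil e a Q z : (0 < a -> a <= e.+1 -> e.+1 * e.+1 <= q ->
  q ^ 2 * z <= q * Q + q.+1 * ((a - 1) * (q * Q) + (e.+1 - a) * Q) ->
  q ^ 2 * z <= (a - 1) * (q * (q * Q)) + slack e.+1 a * (q * Q))%N.
Proof.
move=> a0 lea le_e h; apply: leq_trans h _.
have h : (q * a + q.+1 * (e.+1 - a) <= slack e.+1 a * q)%N.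
  have -> : (q * a + q.+1 * (e.+1 - a) = q * e.+1 + (e.+1 - a))%N by nia.
  rewrite /slack; case: (ltnP 1 a) => ?.
    case: e lea le_e => [|[|e]] lea le_e; nia.
  have -> : a = 1%N by lia.
  case: e lea le_e => [|e] lea le_e; nia.
have h4 := leq_mul h (leqnn Q); nia.
Qed.

Lemma scalemx00 (b : F) (A : 'M[F]_1) : (b *: A) 0 0 = b * A 0 0.
Proof. exact: mxE. Qed.

(* If the section of the zero set by one hyperplane contains a hyperplane L of it,
   the q + 1 hyperplanes through L cover the space, and on each of them the
   equation of L can be divided out. *)
Lemma pencil_bound n e a (U : {vspace Fun 'rV[F]_n.+1}) c c0 phi pi :
  (e.+1 * e.+1 <= q)%N -> (0 < a)%N -> (a <= e.+1)%N -> (U <= Pol n.+1 e.+1)%VS ->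
  (forall c c0 phi pi, c != 0 -> hyper_param (afun c c0) phi pi ->
     (pdim n (e.+1 - a) < \dim (restr phi U))%N) ->
  c != 0 -> hyper_param (afun c c0) phi pi -> has_hplane (restr phi U) ->
  (q ^ 2 * #|zset U| <= q ^ n.+1 + q.+1 * ((a - 1) * q ^ n.+1 + (e.+1 - a) * q ^ n))%N.
Proof.
move=> le_e a0 lea UP big cn0 hp /has_hplaneP[d [d0 [dn0 subd]]].
have [l0 phiK st1 st2 div] := hp.
have /affP[c2 [c02 eq2]] := st2 _ (aff_mem d d0).
have eq2' y : afun c2 c02 (phi y) = afun d d0 y by rewrite -eq2 ffunE phiK.
have indep b : c2 != b *: c.
  apply: contraNneq dn0 => eqc.
  have : afun d d0 = afun 0 (c02 - b * c0).
    apply/ffunP => y; rewrite -eq2' eqc !ffunE -scalemxAr mulmx0 scalemx00 [(0 : 'M_1) 0 0]mxE add0r.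
    have := l0 y; rewrite ffunE => /eqP; rewrite addr_eq0 => /eqP->.
    by rewrite mulrN addrC.
  by move=> /afun_inj->.
have indep1 b b' : c != b' *: (c2 - b *: c).
  apply/eqP => eqc; case: (eqVneq b' 0) => [b0|bn0].
    by rewrite b0 scale0r in eqc; rewrite eqc eqxx in cn0.
  have := indep (b'^-1 + b); rewrite scalerDl [X in b'^-1 *: X]eqc scalerA mulVf // scale1r.
  by rewrite subrK eqxx.
have nz b : c2 - b *: c != 0 by rewrite subr_eq0.
have c2n0 : c2 != 0 by have := indep 0; rewrite scale0r.
pose L := hplane c c0 :&: hplane c2 c02.
have subL : L \subset zset U.
  apply/subsetP => x /setIP[]; rewrite inE => /eqP lx; rewrite inE => l2x.
  rewrite -(hyper_phiK hp lx) -zset_restr; apply: (subsetP subd).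
  by rewrite inE -eq2' (hyper_phiK hp lx).
pose M := ((a - 1) * q ^ n.+1 + (e.+1 - a) * q ^ n)%N.
pose G b := [set x in zset U | (x \in hplane (c2 - b *: c) (c02 - b * c0)) && (x \notin hplane c c0)].
pose G' := [set x in zset U | (x \in hplane c c0) && (x \notin hplane c2 c02)].
have lin_eq b x : afun (c2 - b *: c) (c02 - b * c0) x = afun c2 c02 x - b * afun c c0 x.
  rewrite !ffunE mulmxBr -scalemxAr.
  have -> (A B : 'M[F]_1) : (A - b *: B) 0 0 = A 0 0 - b * B 0 0 by rewrite !mxE.
  by move: ((x *m c2) 0 0) ((x *m c) 0 0) => u v; ring.
have cG b : (q ^ 2 * #|G b| <= M)%N.
  have [phi' [pi' hp']] := hyper_exists (c02 - b * c0) (nz b).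
  apply: (pencil_piece le_e a0 lea hp') => //; first exact: big hp'.
  apply: subset_trans subL; apply/subsetP => x; rewrite !inE lin_eq => /andP[h /eqP lx].
  by rewrite lx mulr0 subr0 in h; rewrite lx eqxx h.
have cG' : (q ^ 2 * #|G'| <= M)%N.
  by apply: (pencil_piece le_e a0 lea hp) => //; exact: big hp.
have cL : (q ^ 2 * #|L| <= q ^ n.+1)%N.
  have -> : #|L| = #|[set x in hplane c2 c02 | afun c c0 x == 0]|.
    by apply: eq_card => x; rewrite !inE andbC.
  rewrite (hyper_card hp) [(q ^ n.+1)%N]expnS -mulnn -mulnA leq_mul2l; apply/orP; right.
  rewrite -(card_hplane d0 dn0) leq_mul2l; apply/orP; right.
  by apply: subset_leq_card; apply/subsetP => y; rewrite !inE eq2'.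
have cover : (#|zset U| <= #|L| + (#|G'| + \sum_(b : F) #|G b|))%N.
  have : zset U \subset L :|: (G' :|: \bigcup_(b : F) G b).
    apply/subsetP => x xU; rewrite in_setU in_setU [x \in L]inE [x \in G']inE xU /=.
    case: (boolP (x \in hplane c c0)) => lx /=; first by case: (x \in hplane _ _).
    apply/bigcupP; exists (afun c2 c02 x / afun c c0 x) => //.
    have ln0 : afun c c0 x != 0 by move: lx; rewrite inE.
    by rewrite inE xU lx andbT inE lin_eq divfK // subrr /=.
  move=> /subset_leq_card/leq_trans; apply.
  apply: leq_trans (leq_card_setU _ _) _; rewrite leq_add2l.
  apply: leq_trans (leq_card_setU _ _) _; rewrite leq_add2l.
  elim/big_rec2: _ => [|b s A _ IH]; first by rewrite cards0.
  by apply: leq_trans (leq_card_setU _ _) _; rewrite leq_add2l.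
apply: leq_trans (leq_mul (leqnn (q ^ 2)) cover) _; rewrite -/M; clearbody M.
rewrite !mulnDr leq_add // mulSn leq_add // big_distrr /= -sum_nat_const.
by apply: leq_sum.
Qed.

(* Either enough elements of U are divisible by the equation of one hyperplane, and
   the quotients have lower degree, or every hyperplane restriction of U is large;
   then a pencil or a family of parallel hyperplanes bounds the zero set. *)
Theorem stability e n a (U : {vspace Fun 'rV[F]_n}) :
  (e * e <= q)%N -> (0 < a)%N -> (U <= Pol n e)%VS -> (pdim n (e - a) < \dim U)%N ->
  ~~ has_hplane U ->
  (q ^ 2 * #|zset U| <= (a - 1) * q ^ n.+1 + slack e a * q ^ n)%N.
Proof.
elim: e n a U => [|e IHe] n a U le_e a0 UP dimU noH.
  have := card_zset_le UP (leq_ltn_trans (leq0n _) dimU).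
  rewrite mul0n leqn0 muln_eq0 => /orP[|/eqP->]; last by rewrite muln0.
  by have := q_gt1; case: (q).
have posU := leq_ltn_trans (leq0n _) dimU.
(* For a > e.+1 the leading term alone is at least the bound of [schwartz_zippel]. *)
case: (leqP a e.+1) => [lea|lta]; last first.
  apply: leq_trans (leq_addr _ _); rewrite -mulnn -mulnA expnS mulnCA leq_mul2l; apply/orP; right.
  by apply: leq_trans (card_zset_le UP posU) _; rewrite leq_mul2r; apply/orP; right; lia.
elim: n U UP dimU noH posU => [|n IHn] U UP dimU noH posU.
  by rewrite zset_dim0 // muln0.
have e1 : (q ^ n.+1 = q * q ^ n)%N by rewrite expnS.
have e2 : (q ^ n.+2 = q * (q * q ^ n))%N by rewrite !expnS.
have noH' c c0 : c != 0 -> ~~ (hplane c c0 \subset zset U).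
  by move=> cn0; apply: contra noH => sub; apply/has_hplaneP; exists c, c0.
have le_e' : (e * e <= q)%N by apply: leq_trans le_e; rewrite leq_mul.
case: (boolP [exists c, exists c0, (c != 0) &&
    (pdim n.+1 (e.+1 - a - 1) < \dim (U :&: vanish (hplane c c0)))%N]).
  move=> /existsP[c /existsP[c0 /andP[cn0 big]]].
  have [phi [pi hp]] := hyper_exists c0 cn0.
  have [V [VP dimV zV]] := quot_exists hp UP.
  have cutU := card_cut zV; rewrite (card_zset_restr hp) in cutU.
  have sz1 := card_zset_le (restr_Pol hp UP) (restr_pos hp (noH' _ _ cn0)).
  have dimV' : (pdim n.+1 (e - a) < \dim V)%N.
    by apply: leq_trans dimV; move: big; have -> : (e.+1 - a - 1 = e - a)%N by lia.
  case: (boolP (has_hplane V)) => [|noHV]; last first.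
    have := IHe _ a V le_e' a0 VP dimV' noHV; rewrite e2 e1 => h2.
    exact: (arith_one_cut a0 lea cutU sz1 h2).
  (* The quotients vanish on a second hyperplane: divide by its equation too. The zeros of [U] then
     lie on one of two hyperplanes or are zeros of the second quotients. *)
  move=> /has_hplaneP[d [d0 [dn0 subd]]].
  have posV := leq_ltn_trans (leq0n _) dimV'.
  case: e IHe {IHn} UP le_e lea dimU big VP dimV' le_e' sz1 => [|e] IHe UP le_e lea dimU big VP dimV' le_e' sz1.
    have [phi' [pi' hp']] := hyper_exists d0 dn0.
    have : phi' 0 \in zset V by apply: (subsetP subd); rewrite inE; case: hp' => ->.
    by rewrite (negPf (Pol0_zset _ VP posV)).
  have [phi' [pi' hp']] := hyper_exists d0 dn0.
  have [V' [VP' dim_V' zV']] := quot_exists hp' VP.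
  rewrite (hplane_vanish subd) in dim_V'.
  have dimV2 : (pdim n.+1 (e - (a - 1)) < \dim V')%N.
    by apply: leq_trans dim_V'; move: dimV'; have -> : (e.+1 - a = e - (a - 1))%N by lia.
  have le_e2 : (e * e <= q)%N by apply: leq_trans le_e'; rewrite leq_mul.
  have cb := class_bound le_e2 VP' dimV2.
  have sz3 := card_zset_le VP' (leq_ltn_trans (leq0n _) dimV2).
  have sz2 := card_zset_le (restr_Pol hp' UP) (restr_pos hp' (noH' _ _ dn0)).
  have cut2 : (#|zset U| <= #|zset (restr phi U)| + (#|zset (restr phi' U)| + #|zset V'|))%N.
    rewrite -(card_zset_restr hp) -(card_zset_restr hp').
    apply: leq_trans (card_cut (H := hplane c c0) (V := (zset U :&: hplane d d0) :|: zset V') _) _.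
      move=> x xU xH; rewrite in_setU in_setI xU /=.
      by case: (boolP (x \in hplane d d0)) => //= xd; apply: zV' => //; apply: zV.
    by rewrite leq_add2l; apply: leq_card_setU.
  rewrite ?e2 ?e1 in cb sz3 *.
  exact: (arith_two_cuts a0 lea le_e cut2 sz1 sz2 cb sz3).
rewrite negb_exists => /forallP allB.
have big c c0 phi pi : c != 0 -> hyper_param (afun c c0) phi pi ->
    (pdim n (e.+1 - a) < \dim (restr phi U))%N.
  move=> cn0 hp; apply: (class_bound_restr hp) => //.
  have := allB c; rewrite negb_exists => /forallP/(_ c0).
  by rewrite cn0 /= -leqNgt.
pose B := ((a - 1) * q ^ n.+1 + slack e.+1 a * q ^ n)%N.
pose dl : 'cV[F]_n.+1 := delta_mx ord0 0.
have dn0 : dl != 0 by apply: delta_neq0.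
(* If all sections by one parallel family obey the bound, add them up. Otherwise induction on n
   shows that an offending section contains a hyperplane, and the pencil through it applies. *)
case: (boolP [forall b : F, q ^ 2 * #|zset U :&: hplane dl (- b)| <= B]%N) => [/forallP h|].
  have qq : (0 < q ^ 2)%N by rewrite expn_gt0 ltnW.
  have : (#|zset U| <= q * (B %/ q ^ 2))%N.
    apply: (@card_slices _ _ dl) => b; rewrite leq_divRL // mulnC.
    apply: leq_trans (h b); rewrite leq_mul2l; apply/orP; right.
    by apply: subset_leq_card; apply/subsetP => x; rewrite !inE.
  move=> le; apply: leq_trans (leq_mul (leqnn _) le) _.
  rewrite mulnCA [(q ^ 2 * _)%N]mulnC.
  apply: leq_trans (leq_mul (leqnn q) (leq_trunc_div B (q ^ 2))) _.
  by rewrite /B mulnDr ![(q * (_ * _))%N]mulnCA -!expnS.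
move=> /forallPn[b]; rewrite -ltnNge => lt.
have [phi [pi hp]] := hyper_exists (- b) dn0.
have hpl : has_hplane (restr phi U).
  apply: contraLR lt => noHr; rewrite -leqNgt (card_zset_restr hp).
  have bigr := big _ _ _ _ dn0 hp.
  by apply: IHn => //; [exact: restr_Pol hp _ _ UP | exact: leq_ltn_trans bigr].
have := pencil_bound le_e a0 lea UP big dn0 hp hpl; rewrite e2 e1 => h.
exact: arith_pencil h.
Qed.

End Stability.

(** * The projective bound *)

Section Projective.
Variable F : finFieldType.
Local Notation q := #|F|.
Notation Fun T := {ffun T -> F^o}.
Notation Pol := (Pol F).
Notation Hom := (Hom F).
Notation afun := (@afun F _).
Notation vanish := (vanish F).
Let q_gt1 := card_gt1 F.
Let q_gt0 : (0 < q)%N := ltnW q_gt1.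

(* x |-> x *m c is a coordinate with v at 1 and kernel the row space of B. *)
Definition split_of m (c : 'cV[F]_m.+1) (v : 'rV[F]_m.+1) (B : 'M[F]_(m, m.+1))
    (P : 'M[F]_(m.+1, m)) : Prop :=
  [/\ v *m c = 1%:M, v *m P = 0, B *m P = 1%:M, B *m c = 0 & c *m v + P *m B = 1%:M].

Lemma Hom_scale n d (f : Fun 'rV[F]_n) a x : f \in Hom n d -> f (a *: x) = a ^+ d * f x.
Proof.
move=> fH; pose D := linfun (precomp (fun y : 'rV[F]_n => a *: y) : Fun _ -> Fun _).
have main : (Hom n d <= lker (D - (a ^+ d) *: \1)%VF)%VS.
  elim: d {fH} => [|d IH].
    apply/subvP => g /vlineP[b ->]; rewrite memv_ker; apply/eqP/ffunP => y.
    by rewrite expr0 scale1r add_lfunE opp_lfunE id_lfunE lfunE !ffunE subrr.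
  apply: pwS_ind => u g /linP[c ->] gP; rewrite memv_ker; apply/eqP/ffunP => y.
  have := subvP IH g gP; rewrite memv_ker => /eqP/ffunP/(_ y).
  rewrite !add_lfunE !opp_lfunE !scale_lfunE !id_lfunE !lfunE !ffunE => /eqP.
  rewrite subr_eq0 => /eqP->; rewrite -scalemxAl scalemx00 exprS.
  apply/eqP; rewrite subr_eq0; apply/eqP.
  exact: mulrACA.
have := subvP main f fH; rewrite memv_ker => /eqP/ffunP/(_ x).
rewrite add_lfunE opp_lfunE scale_lfunE id_lfunE lfunE !ffunE => /eqP.
by rewrite subr_eq0 => /eqP->.
Qed.

Lemma zset_scale n d (W : {vspace Fun 'rV[F]_n}) a x : (W <= Hom n d)%VS -> a != 0 ->
  (a *: x \in zset W) = (x \in zset W).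
Proof.
move=> WH an0; apply/zsetP/zsetP => h f fW; have fH := subvP WH _ fW.
  have := h f fW; rewrite (Hom_scale _ _ fH) => /eqP.
  by rewrite mulf_eq0 expf_eq0 (negPf an0) andbF => /eqP.
by rewrite (Hom_scale _ _ fH) h ?mulr0.
Qed.

Lemma zset_0 n d (W : {vspace Fun 'rV[F]_n}) : (W <= Hom n d.+1)%VS -> 0 \in zset W.
Proof.
move=> WH; apply/zsetP => f fW; have := Hom_scale 0 0 (subvP WH _ fW).
by rewrite scale0r exprS !mul0r.
Qed.

Section Chart.
Variables (n : nat) (c : 'cV[F]_n.+1) (v : 'rV[F]_n.+1).
Variables (B : 'M[F]_(n, n.+1)) (P : 'M[F]_(n.+1, n)).
Hypothesis sp : split_of c v B P.

Definition inclB (y : 'rV[F]_n) : 'rV[F]_n.+1 := y *m B.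
Definition chart (y : 'rV[F]_n) : 'rV[F]_n.+1 := v + y *m B.

Lemma split_dec x : x = (x *m c) 0 0 *: v + x *m P *m B.
Proof.
case: sp => _ _ _ _ /(congr1 (mulmx x)); rewrite mulmxDr mulmx1 !mulmxA => {1}<-.
by rewrite {1}[x *m c]mx11_scalar mul_scalar_mx.
Qed.

Lemma hyper_inclB : hyper_param (afun c 0) inclB (mulmx^~ P).
Proof.
have [vc vP BP Bc dec] := sp; split.
- by move=> y; rewrite ffunE addr0 -mulmxA Bc mulmx0 mxE.
- by move=> y; rewrite /inclB -mulmxA BP mulmx1.
- move=> _ /affP[d [d0 ->]]; apply/affP; exists (B *m d), d0.
  by apply/ffunP => y; rewrite !ffunE mulmxA.
- move=> _ /affP[d [d0 ->]]; apply/affP; exists (P *m d), d0.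
  by apply/ffunP => y; rewrite !ffunE mulmxA.
- move=> _ /affP[d [d0 ->]]; exists ((v *m d) 0 0); apply/ffunP => x.
  rewrite !ffunE /= addr0 {1}[x]split_dec mulmxDl -scalemxAl mxE scalemx00 /inclB.
  by rewrite [_ *: _]mulrC opprD addrACA subrr addr0 addrK.
Qed.

Lemma lin_inclB u : u \in lin F n.+1 -> precomp inclB u \in lin F n.
Proof.
move=> /linP[d ->]; apply/linP; exists (B *m d).
by apply/ffunP => y; rewrite !ffunE mulmxA.
Qed.

Lemma lin_chart u : u \in lin F n.+1 -> precomp chart u \in aff F n.
Proof.
move=> /linP[d ->]; apply/affP; exists (B *m d), ((v *m d) 0 0).
by apply/ffunP => y; rewrite !ffunE mulmxDl mxE mulmxA addrC.
Qed.

Variables (d : nat) (W : {vspace Fun 'rV[F]_n.+1}).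

Lemma restr_inclB_Hom : (W <= Hom n.+1 d)%VS -> (restr inclB W <= Hom n d)%VS.
Proof.
move=> WH; apply/subvP => f /memv_imgP[g gW ->]; rewrite lfunE.
exact: pw_precomp lin_inclB (subvP WH _ gW).
Qed.

Lemma restr_chart_Pol : (W <= Hom n.+1 d)%VS -> (restr chart W <= Pol n d)%VS.
Proof.
move=> WH; apply/subvP => f /memv_imgP[g gW ->]; rewrite lfunE.
exact: pw_precomp lin_chart (subvP WH _ gW).
Qed.

Lemma chart_c y : (chart y *m c) 0 0 = 1.
Proof. by case: sp => vc _ _ Bc _; rewrite mulmxDl vc -mulmxA Bc mulmx0 addr0 mxE. Qed.

Lemma chart_P y : chart y *m P = y.
Proof. by case: sp => _ vP BP _ _; rewrite mulmxDl vP -mulmxA BP mulmx1 add0r. Qed.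

Lemma chartK x : (x *m c) 0 0 != 0 -> (x *m c) 0 0 *: chart (((x *m c) 0 0)^-1 *: (x *m P)) = x.
Proof.
move=> xc; rewrite [RHS]split_dec /chart scalerDr -scalemxAl scalerA divff //.
by rewrite scale1r.
Qed.

(** Counting takes place on the cone: for each of the q - 1 nonzero values a of the coordinate given
    by c, the zeros with this value are the chart zeros multiplied by a. *)
Lemma card_proj_cut : (W <= Hom n.+1 d.+1)%VS ->
  #|zset W :\ 0| = (#|zset (restr inclB W) :\ 0%R| + q.-1 * #|zset (restr chart W)|)%N.
Proof.
move=> WH; rewrite -(cardsID (hplane c 0%R)); congr addn.
  have -> : #|(zset W :\ 0) :&: hplane c 0%R| = #|[set x in zset W :\ 0 | afun c 0 x == 0]|.
    by apply: eq_card => x; rewrite in_setI [RHS]inE; congr andb; rewrite inE.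
  rewrite (hyper_card hyper_inclB); apply: eq_card => y.
  rewrite inE !in_setD1 zset_restr; congr (_ && _).
  have [_ phiK _ _ _] := hyper_inclB.
  by rewrite -[in RHS](inj_eq (can_inj phiK)) [inclB 0]mul0mx.
rewrite (card_fibers _ (afun c 0)) (bigD1 0) //=.
rewrite eq_card0 ?add0n => [|x]; last first.
  by rewrite inE in_setD inE; case: (_ == 0); rewrite ?andbF.
rewrite (eq_bigr (fun=> #|zset (restr chart W)|)).
  by rewrite sum_nat_const -cardsE (_ : [set _ | _] = [set~ 0]) ?cardsC1 //; apply/setP => a; rewrite !inE.
move=> a an0; rewrite -(card_imset _ (_ : injective (fun y => a *: chart y))); last first.
  by move=> y y' /(scalerI an0)/(congr1 (mulmx^~ P)); rewrite !chart_P.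
apply: eq_card => x; rewrite inE in_setD [x \in hplane _ _]inE; apply/andP/imsetP.
  move=> [/andP[_ xZ] /eqP xc]; rewrite ffunE addr0 in xc.
  have xc0 : (x *m c) 0 0 != 0 by rewrite xc.
  exists (a^-1 *: (x *m P)); last by rewrite -xc chartK.
  rewrite zset_restr -(zset_scale _ WH an0) -xc chartK //.
  by move: xZ; rewrite in_setD1 => /andP[].
move=> [y yZ ->]; rewrite ffunE addr0 -scalemxAl scalemx00 chart_c mulr1 eqxx an0; split => //=.
rewrite in_setD1 (zset_scale _ WH an0) -zset_restr yZ andbT scaler_eq0 negb_or an0 /=.
apply/eqP => y0; have := chart_c y; rewrite y0 mul0mx mxE => /eqP.
by rewrite eq_sym oner_eq0.
Qed.

(** On the chart the equation of the hyperplane is 1, so the quotients by it are the restrictions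
    themselves, now seen to have degree at most d. No dimension is lost: a form is determined by its
    values on the chart and on the hyperplane. *)
Lemma chart_quot : (W <= Hom n.+1 d.+1)%VS ->
  exists V : {vspace Fun 'rV[F]_n},
  [/\ (V <= Pol n d)%VS, (\dim (W :&: vanish (hplane c 0%R)) <= \dim V)%N &
      zset (restr chart W) \subset zset V].
Proof.
move=> WH; exists (restr chart (W :&: vanish (hplane c 0%R))); split.
- apply/subvP => f /memv_imgP[g + ->]; rewrite lfunE /= memv_cap => /andP[gW gv].
  have [] := @pw_div _ _ (lin F n.+1) (afun c 0) (inclB \o mulmx^~ P) d g _ _ (subvP WH _ gW).
  + move=> u /linP[a ->]; apply/linP; exists (P *m (B *m a)).
    by apply/ffunP => x; rewrite !ffunE /= /inclB !mulmxA.
  + move=> u /(subvP (lin_sub_aff _ _)); case: hyper_inclB => _ _ _ _; exact.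
  move=> h hP eqg; have g0 : precomp (inclB \o mulmx^~ P) g = 0.
    apply/ffunP => x; rewrite !ffunE; apply: (vanishP _ _ gv); rewrite inE.
    by case: hyper_inclB => ->.
  rewrite g0 subr0 in eqg.
  have -> : precomp chart g = precomp chart h.
    by rewrite eqg; apply/ffunP => y; rewrite !ffunE addr0 chart_c mul1r.
  exact: pw_precomp lin_chart hP.
- rewrite limg_dim_eq //; apply/eqP; rewrite -subv0; apply/subvP => f.
  rewrite memv_cap memv_ker lfunE memv_cap => /andP[/andP[fW /vanishP fv] /eqP/ffunP f0].
  rewrite memv0; apply/eqP/ffunP => x; rewrite [RHS]ffunE.
  case: (eqVneq ((x *m c) 0 0) 0) => [xc|xc].
    by apply: fv; rewrite inE ffunE xc addr0.
  rewrite -(chartK xc) (Hom_scale _ _ (subvP WH _ fW)).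
  by have := f0 ((((x *m c) 0 0)^-1 *: (x *m P))); rewrite !ffunE => ->; rewrite mulr0.
- by apply/zset_anti/limgS/capvSl.
Qed.

End Chart.

Lemma split_exists n (c : 'cV[F]_n.+1) : c != 0 -> exists v B P, split_of c v B P.
Proof. exact: col_split. Qed.

Lemma card_ker n (c : 'cV[F]_n.+1) : c != 0 -> #|hplane c 0%R| = (q ^ n)%N.
Proof.
move=> /(card_hplane 0)/eqP; rewrite expnS eqn_mul2l eqn0Ngt q_gt0 /=.
by move=> /eqP.
Qed.

(** Double counting of incidences: a nonzero x is killed by q ^ n - 1 of the q ^ n.+1 - 1 nonzero
    c. *)
Lemma averaging n (Z : {set 'rV[F]_n.+1}) : 0 \notin Z ->
  exists2 c, c != 0 & (#|Z| * (q ^ n).-1 <= (q ^ n.+1).-1 * #|Z :&: hplane c 0%R|)%N.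
Proof.
move=> Z0; case: (boolP [exists c : 'cV[F]_n.+1, (c != 0) &&
  (#|Z| * (q ^ n).-1 <= (q ^ n.+1).-1 * #|Z :&: hplane c 0%R|)%N]).
  by move=> /existsP[c /andP[]]; exists c.
rewrite negb_exists => /forallP h0; exfalso.
have {h0} h (c : 'cV[F]_n.+1) : c != 0 ->
    ~~ (#|Z| * (q ^ n).-1 <= (q ^ n.+1).-1 * #|Z :&: hplane c 0%R|)%N.
  by move=> cn0; have := h0 c; rewrite cn0.
have cardc : #|[set c : 'cV[F]_n.+1 | c != 0]| = (q ^ n.+1).-1.
  rewrite (_ : [set _ | _] = [set~ 0]); first by rewrite cardsC1 card_mx muln1.
  by apply/setP => c; rewrite !inE.
have cnt x : x \in Z -> (\sum_(c : 'cV[F]_n.+1 | c != 0%R) (x \in hplane c 0%R) = (q ^ n).-1)%N.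
  move=> xZ; have xn0 : x^T != 0.
    by apply: contraNneq Z0 => /(congr1 trmx); rewrite trmxK trmx0 => <-.
  have tr (c : 'cV[F]_n.+1) : (x \in hplane c 0%R) = (c^T \in hplane x^T 0).
    by rewrite !inE !ffunE !addr0 -trmx_mul [(_ *m _)^T _ _]mxE.
  rewrite -(card_ker xn0) -(@card_imset _ _ (fun c : 'rV[F]_n.+1 => c^T)); last exact: trmx_inj.
  rewrite -[RHS]subn1 (cardsD1 0%R [set _ | _ in _]).
  have -> : 0 \in [set y^T | y in hplane x^T 0].
    by apply/imsetP; exists 0; rewrite ?trmx0 // inE ffunE mul0mx mxE add0r.
  rewrite add1n subn1 /= -sum1_card big_mkcond [RHS]big_mkcond; apply: eq_bigr => c _.
  rewrite in_setD1 tr; case: (c == 0) => //=.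
  rewrite (_ : (c \in _) = (c^T \in hplane x^T 0)); first by case: ifP.
  apply/imsetP/idP => [[y yH ->]|cH]; first by rewrite trmxK.
  by exists c^T; rewrite ?trmxK.
have e1 : (\sum_(c : 'cV[F]_n.+1 | c != 0%R) #|Z :&: hplane c 0%R| = #|Z| * (q ^ n).-1)%N.
  under eq_bigr => c _ do rewrite -sum1_card big_mkcond /=.
  rewrite exchange_big /= -sum_nat_const big_mkcond [RHS]big_mkcond /=; apply: eq_bigr => x _.
  case: (boolP (x \in Z)) => xZ.
    rewrite -(cnt x xZ); apply: eq_bigr => c _.
    by rewrite in_setI xZ /=; case: (x \in _).
  by rewrite big1 // => c _; rewrite in_setI (negPf xZ).
set K := (q ^ n.+1).-1 in h cardc *; set S := (#|Z| * (q ^ n).-1)%N in h e1 *.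
have c1 : (delta_mx ord0 0 : 'cV[F]_n.+1) != 0 by apply: delta_neq0.
have S0 : (0 < S)%N by have := h _ c1; rewrite -ltnNge; apply: leq_ltn_trans.
have K0 : (0 < K)%N.
  by rewrite -cardc; apply/card_gt0P; exists (delta_mx ord0 0); rewrite inE.
have : (K * S <= K * S.-1)%N.
  rewrite -{1}e1 big_distrr /= -{2}cardc cardsE -sum_nat_const.
  apply: leq_sum => c cn0; have := h c cn0; rewrite -ltnNge => lt.
  by rewrite -ltnS prednK.
by rewrite leq_mul2l eqn0Ngt K0 /= leqNgt prednK // leqnn.
Qed.

End Projective.

(** * Counting projective points *)

Section ProjBound.
Variable F : finFieldType.
Local Notation q := #|F|.
Notation Fun T := {ffun T -> F^o}.
Notation Hom := (Hom F).
Notation afun := (@afun F _).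
Notation vanish := (vanish F).
Let q_gt1 := card_gt1 F.
Let q_gt0 : (0 < q)%N := ltnW q_gt1.
Let q1_gt0 : (0 < q.-1)%N. Proof. by rewrite -ltnS prednK. Qed.

Local Notation psum n := (\sum_(i < n) q ^ i)%N.

Lemma psumE n : (q.-1 * psum n)%N = (q ^ n).-1.
Proof. by rewrite predn_exp. Qed.

Lemma psumS n : psum n.+1 = (1 + q * psum n)%N.
Proof.
rewrite big_ord_recl expn0 big_distrr; congr addn; apply: eq_bigr => i _.
exact: expnS.
Qed.

(* Exact division when W consists of forms of positive degree. *)
Definition pcount n (W : {vspace Fun 'rV[F]_n}) : nat := (#|zset W :\ 0%R| %/ q.-1)%N.

Lemma pcountE n d (W : {vspace Fun 'rV[F]_n}) : (W <= Hom n d.+1)%VS ->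
  (q.-1 * pcount W)%N = #|zset W :\ 0|.
Proof.
move=> WH; rewrite mulnC /pcount divnK //.
elim: n W WH => [|n IH] W WH.
  rewrite (_ : _ :\ 0 = set0) ?cards0 //; apply/setP => x.
  by rewrite !inE (_ : x = 0) ?eqxx // thinmx0.
have [v [B [P sp]]] := split_exists (delta_neq0 F (ord0 : 'I_n.+1)).
rewrite (card_proj_cut sp WH) dvdn_addl ?dvdn_mulr //.
exact: IH (restr_inclB_Hom B WH).
Qed.

Lemma pcount_cut n d c v B P (W : {vspace Fun 'rV[F]_n.+1}) :
  @split_of F n c v B P -> (W <= Hom n.+1 d.+1)%VS ->
  pcount W = (pcount (restr (inclB B) W) + #|zset (restr (chart v B) W)|)%N.
Proof.
move=> sp WH; apply/eqP; rewrite -(eqn_pmul2l q1_gt0) mulnDr.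
by rewrite (pcountE WH) (pcountE (restr_inclB_Hom B WH)) (card_proj_cut sp WH).
Qed.

Lemma pcount_le n d (W : {vspace Fun 'rV[F]_n}) : (W <= Hom n d.+1)%VS -> (pcount W <= psum n)%N.
Proof.
move=> WH; rewrite -(leq_pmul2l q1_gt0) (pcountE WH) psumE.
rewrite -subn1 -card_rV -cardsT [X in (_ <= X - _)%N](cardsD1 0%R) inE addKn.
by apply: subset_leq_card; apply: setSD; apply: subsetT.
Qed.

Lemma dim_cut n c v B P (W : {vspace Fun 'rV[F]_n.+1}) : @split_of F n c v B P ->
  (\dim (W :&: vanish (hplane c 0%R)) + \dim (restr (inclB B) W))%N = \dim W.
Proof. by move=> sp; rewrite (dim_restr (hyper_inclB sp)). Qed.

Lemma restr_inclB_pos n c v B P (W : {vspace Fun 'rV[F]_n.+1}) : @split_of F n c v B P ->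
  ~~ (W <= vanish (hplane c 0%R))%VS -> (0 < \dim (restr (inclB B) W))%N.
Proof.
move=> sp; apply: contraNltn; rewrite leqn0 => /eqP d0; have := dim_cut W sp.
rewrite d0 addn0 => eqd; apply/capv_idPl; apply/eqP; rewrite eqEdim capvSl /=.
by rewrite eqd.
Qed.

(** Write q ^ n.+2 - 1 as (q - 1) + q * (q ^ n.+1 - 1) in [averaging]; the part q - 1 times the
    section count is at most q ^ n.+1 - 1 and yields the summand 1. *)
Lemma averaging_pcount n d (W : {vspace Fun 'rV[F]_n.+2}) : (W <= Hom n.+2 d.+1)%VS ->
  exists2 c, c != 0 & forall v B P, @split_of F n.+1 c v B P ->
    (pcount W <= 1 + q * pcount (restr (inclB B) W))%N.
Proof.
move=> WH; have [|c cn0 avg] := @averaging F n.+1 (zset W :\ 0); first by rewrite !inE eqxx.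
exists c => // v B P sp.
have WH' := restr_inclB_Hom B WH.
have -> : pcount W = (#|zset W :\ 0%R| %/ q.-1)%N by [].
have hZ : #|(zset W :\ 0) :&: hplane c 0| = (q.-1 * pcount (restr (inclB B) W))%N.
  rewrite (pcountE WH') [LHS](_ : _ = #|[set x in zset W :\ 0 | afun c 0 x == 0]|).
    rewrite (hyper_card (hyper_inclB sp)); apply: eq_card => y.
    rewrite inE !in_setD1 zset_restr; congr (_ && _).
    have [_ phiK _ _ _] := hyper_inclB sp.
    by rewrite -[in RHS](inj_eq (can_inj phiK)) [inclB B 0]mul0mx.
  by apply: eq_card => x; rewrite in_setI [RHS]inE; congr andb; rewrite inE.
move: avg; rewrite hZ -(pcountE WH) mulKn // !mulnA => avg.
have leN := pcount_le WH'.
set N := pcount W in avg *; set M := pcount _ in avg leN *.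
have {}avg : (N * (q ^ n.+1).-1 <= (q ^ n.+2).-1 * M)%N.
  rewrite -(leq_pmul2l q1_gt0); move: avg; rewrite -!mulnA => /leq_trans; apply.
  by rewrite mulnCA.
have leM : (q.-1 * M <= (q ^ n.+1).-1)%N by rewrite -psumE leq_mul2l leN orbT.
have Q0 : (0 < (q ^ n.+1).-1)%N.
  by rewrite -psumE muln_gt0 q1_gt0 psumS.
have eqQ : (q ^ n.+2).-1 = (q.-1 + q * (q ^ n.+1).-1)%N.
  by rewrite -!psumE [X in (_ * X)%N]psumS mulnDr muln1 mulnCA.
rewrite -(leq_pmul2r Q0); apply: leq_trans avg _.
by rewrite eqQ !mulnDl mul1n leq_add // mulnAC.
Qed.

(** Homogenize the equation of the hyperplane to c2. The restriction of W to c2 = 0 is nonzero but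
    would vanish at all q ^ n points off infinity, too many for the projective bound one dimension
    lower, which is the hypothesis on W'. *)
Lemma chart_hplane e n c v B P d d0 (W : {vspace Fun 'rV[F]_n.+2}) :
  (1 < e)%N -> (e * e <= q)%N ->
  (forall W' : {vspace Fun 'rV[F]_n.+1}, (W' <= Hom n.+1 e.+1)%VS -> (0 < \dim W')%N ->
     (q * (pcount W' - psum n) <= e * q ^ n)%N) ->
  (W <= Hom n.+2 e.+1)%VS ->
  (forall c, c != 0 -> ~~ (W <= vanish (hplane c 0%R))%VS) ->
  @split_of F n.+1 c v B P -> d != 0 ->
  ~~ (hplane d d0 \subset zset (restr (chart v B) W)).
Proof.
move=> e_gt1 le_e IH WH nv sp dn0; apply/negP => sub.
have [vc vP BP Bc dec] := sp.
pose c2 := P *m d + d0 *: c.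
have Bc2 : B *m c2 = d by rewrite mulmxDr mulmxA BP mul1mx -scalemxAr Bc scaler0 addr0.
have c2n0 : c2 != 0 by apply: contraNneq dn0 => c20; rewrite -Bc2 c20 mulmx0.
have [v2 [B2 [P2 sp2]]] := split_exists c2n0.
have [vc2 _ _ Bc20 dec2] := sp2.
pose W2 := restr (inclB B2) W.
have W2H : (W2 <= Hom n.+1 e.+1)%VS by apply: restr_inclB_Hom.
have posW2 : (0 < \dim W2)%N by apply: (restr_inclB_pos sp2); apply: nv.
have Bcn0 : B2 *m c != 0.
  apply/eqP => B2c; have eqc : c = c2 *m (v2 *m c).
    by have := congr1 (mulmx^~ c) dec2; rewrite mulmxDl mul1mx -!mulmxA B2c mulmx0 addr0.
  have : B *m c2 *m (v2 *m c) = 0 by rewrite -mulmxA -eqc.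
  rewrite Bc2 [v2 *m c]mx11_scalar mul_mx_scalar => /eqP; rewrite scaler_eq0 (negPf dn0) orbF.
  move=> /eqP z; rewrite [v2 *m c]mx11_scalar z mul_mx_scalar scale0r in eqc.
  by have := vc; rewrite eqc mulmx0 => /matrixP/(_ 0 0)/eqP; rewrite !mxE eq_sym oner_eq0.
have subZ : ~: hplane (B2 *m c) 0 \subset zset W2 :\ 0.
  apply/subsetP => y; rewrite in_setC inE ffunE addr0 mulmxA => yc.
  rewrite in_setD1; apply/andP; split.
    by apply: contraNneq yc => ->; rewrite !mul0mx mxE.
  rewrite zset_restr /inclB -(chartK sp yc) (zset_scale _ WH yc) -zset_restr.
  apply: (subsetP sub); set y' := _ *: _.
  have eq0 : chart v B y' *m c2 = 0.
    have : y *m B2 *m c2 = 0 by rewrite -mulmxA Bc20 mulmx0.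
    rewrite -{1}(chartK sp yc) -scalemxAl => /eqP; rewrite scaler_eq0 (negPf yc) /=.
    by move=> /eqP.
  rewrite inE ffunE; have := congr1 (fun M : 'M_1 => M 0 0) eq0.
  rewrite /= mulmxDr mulmxA (chart_P sp) -scalemxAr mxE scalemx00 (chart_c sp) mulr1 => ->.
  by rewrite mxE.
have big : (q ^ n <= pcount W2)%N.
  rewrite -(leq_pmul2l q1_gt0) (pcountE W2H); apply: leq_trans (subset_leq_card subZ).
  rewrite cardsCs setCK card_rV card_ker // expnS -{3}[(q ^ n)%N]mul1n -mulnBl.
  by rewrite subn1.
have h := IH W2 W2H posW2.
have ps := psumE n; have Q0 : (0 < q ^ n)%N by rewrite expn_gt0 q_gt0.
(* This follows from e > 1 and e * e <= q; it makes q ^ n - psum n larger than e * q ^ (n - 1). *)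
have le2 : (e + 2 <= q)%N by nia.
move: h big ps Q0; move: (psum n) (pcount W2) (q ^ n)%N => S N Q h big ps Q0.
have h' : (q * (Q - S) <= e * Q)%N by apply: leq_trans h; rewrite leq_mul2l leq_sub2r ?orbT.
have q1 : q.-1.+1 = q by rewrite prednK.
have sQ : (S <= Q)%N by nia.
have h2 : (q * Q <= e * Q + q * S)%N by rewrite mulnBr leq_subLR addnC in h'.
have h3 : (q.-1 * (2 * Q) <= q.-1 * (q * S))%N by rewrite leq_mul2l; apply/orP; right; nia.
have h4 : (q.-1 * (q * S) = q * Q.-1)%N by rewrite mulnCA ps.
move: h3; rewrite h4 -{2}q1; move: q1_gt0; move: q.-1 => p p0.
by case: Q Q0 {h big ps h' sQ h2 h4} => // Q _ /=; nia.
Qed.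

End ProjBound.

Section ProjBound.
Variable F : finFieldType.
Local Notation q := #|F|.
Notation Fun T := {ffun T -> F^o}.
Notation Pol := (Pol F).
Notation Hom := (Hom F).
Notation vanish := (vanish F).
Let q_gt1 := card_gt1 F.
Let q_gt0 : (0 < q)%N := ltnW q_gt1.
Let q1_gt0 : (0 < q.-1)%N. Proof. by rewrite -ltnS prednK. Qed.
Local Notation psum n := (\sum_(i < n) q ^ i)%N.

Lemma class_exists n e r : (0 < r)%N -> (r <= pdim n e.+1)%N ->
  exists j, [/\ (j <= e)%N, (pdim n j < r)%N & (r <= pdim n j.+1)%N].
Proof.
move=> r0 ler; have ex : exists j, (r <= pdim n j.+1)%N by exists e.
have [j lej minj] := ex_minnP ex; exists j; split => //; first exact: minj.
case: j lej minj => [|j] lej minj; first exact: r0.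
by rewrite ltnNge; apply/negP => /minj; rewrite ltnn.
Qed.

Lemma Pol1_aff n : (Pol n 1 <= aff F n)%VS.
Proof.
apply: pwS_ind => u f uA /vlineP[a ->].
by rewrite linearZ /= fmul1 rpredZ.
Qed.

(** The critical case, where [class_bound] for V overshoots (e - j).+1 * q ^ n. If the zeros of V
    contain no hyperplane, use [stability] with a = (e - j).+1; otherwise divide V by its equation
    and bound Y on that hyperplane by the hypothesis on Y. For j = e there is no room for A, whence
    the alternative. *)
Lemma chart_zeros e n j (Y : {set 'rV[F]_n.+1}) (V : {vspace Fun 'rV[F]_n.+1}) (A : nat) :
  (e * e <= q)%N -> (j <= e)%N ->
  (V <= Pol n.+1 e)%VS -> Y \subset zset V -> (pdim n.+1 j.-1 < \dim V)%N ->
  ((1 < e)%N -> forall d d0, d != 0 -> (q * #|Y :&: hplane d d0| <= e.+1 * q ^ n)%N) ->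
  (q * A <= e * q ^ n)%N ->
  (0 < j)%N -> (#|Y| <= q ^ n)%N /\ j = e \/ (#|Y| + A <= (e - j).+1 * q ^ n)%N.
Proof.
move=> le_e lej VP YV big hY hA j0.
have posV := leq_ltn_trans (leq0n _) big.
have cY : (#|Y| <= #|zset V|)%N by apply: subset_leq_card.
have Q0 : (0 < q ^ n)%N by rewrite expn_gt0 q_gt0.
have e0 : (0 < e)%N by apply: leq_trans lej.
have qq0 : (0 < q * q)%N by rewrite muln_gt0 q_gt0.
have expE1 : (q ^ n.+1 = q * q ^ n)%N by rewrite expnS.
have expE2 : (q ^ n.+2 = q * (q * q ^ n))%N by rewrite !expnS.
have A2 : (q * q * A <= e * (q * q ^ n))%N.
  by rewrite -mulnA mulnCA leq_mul2l hA orbT.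
case: (leqP e 1) => e1.
  left; have ee : e = 1%N by lia.
  split; last by lia.
  have := card_zset_le VP posV; rewrite ee mul1n expE1 leq_mul2l.
  by rewrite eqn0Ngt q_gt0 /=; apply: leq_trans.
case: (boolP (has_hplane V)) => [|noH]; last first.
  have st : (q ^ 2 * #|zset V| <= (e - j).+1.-1 * q ^ n.+2 + slack e (e - j).+1 * q ^ n.+1)%N.
    rewrite -subn1; apply: (stability le_e) => //.
    by move: big; have -> : (e - (e - j).+1 = j.-1)%N by lia.
  rewrite -mulnn /= expE1 expE2 in st.
  have {}st : (q * q * #|Y| <= (e - j) * (q * (q * q ^ n)) + slack e (e - j).+1 * (q * q ^ n))%N.
    by apply: leq_trans st; rewrite leq_mul2l cY orbT.
  case: (posnP (e - j)) => ej.
    left; split; last by lia.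
    rewrite ej mul0n add0n /slack ltnn mul0n subn0 in st.
    rewrite -(leq_pmul2l qq0); apply: leq_trans st _.
    by rewrite -[(q * q * _)%N]mulnA leq_mul2r le_e orbT.
  right; rewrite -(leq_pmul2l qq0) mulnDr; apply: leq_trans (leq_add st A2) _.
  rewrite /slack ltnS ej mul1n -addnA -mulnDl subnK; last by rewrite leq_pmull.
  have h := leq_mul le_e (leqnn (q * q ^ n)).
  apply: leq_trans (leq_add (leqnn _) h) _; apply/eq_leq; ring.
move=> /has_hplaneP[d [d0 [dn0 subd]]].
have [phi [pi hp]] := hyper_exists d0 dn0.
case: e le_e lej VP hY hA e0 A2 e1 => // e le_e lej VP hY hA e0 A2 e1.
have [V' [VP' dimV' zV']] := quot_exists hp VP.
rewrite (hplane_vanish subd) in dimV'.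
have le_e' : (e * e <= q)%N by apply: leq_trans le_e; rewrite leq_mul.
have big' : (pdim n.+1 (e - (e.+1 - j)) < \dim V')%N.
  by apply: leq_trans dimV'; move: big; have -> : (e - (e.+1 - j) = j.-1)%N by lia.
have cb := class_bound le_e' VP' big'.
rewrite -mulnn expE1 expE2 in cb.
have cutY : (#|Y| <= #|Y :&: hplane d d0| + #|zset V'|)%N.
  apply: card_cut => x xY xH; apply: zV' => //; exact: (subsetP YV).
have hE := hY e1 _ d0 dn0.
have E2 : (q * q * #|Y :&: hplane d d0| <= e.+2 * (q * q ^ n))%N.
  by rewrite -mulnA mulnCA leq_mul2l hE orbT.
have Y2 : (q * q * #|Y| <= e.+2 * (q * q ^ n) + ((e.+1 - j) * (q * (q * q ^ n)) +
    (e - (e.+1 - j)) * (q * q ^ n)))%N.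
  by apply: leq_trans (leq_add E2 cb); rewrite -mulnDr leq_mul2l cutY orbT.
case: (posnP (e.+1 - j)) => ej.
  left; split; last by lia.
  rewrite ej mul0n add0n subn0 in Y2.
  rewrite -(leq_pmul2l qq0); apply: leq_trans Y2 _.
  rewrite -mulnDl -[(q * q * _)%N]mulnA leq_mul2r; apply/orP; right.
  by apply: leq_trans le_e; nia.
(* For original degree 2, now e = 1, the second-order coefficients 3 + 2 may exceed q. Then V'
   contains a nonzero polynomial of degree at most 1, so the rest of Y is empty or lies on a second
   hyperplane, where the hypothesis on Y applies again: 3 + 3 + 2 <= 2 * q. *)
right; case: (leqP e 1) => e2; last first.
  rewrite -(leq_pmul2l qq0) mulnDr; apply: leq_trans (leq_add Y2 A2) _.
  have hh : (e.+2 + (e - (e.+1 - j)) + e.+1 <= q)%N by apply: leq_trans le_e; nia.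
  have h := leq_mul hh (leqnn (q * q ^ n)).
  rewrite addnCA -addnA; apply: (@leq_trans ((e.+1 - j) * (q * (q * q ^ n)) + q * (q * q ^ n))).
    by rewrite leq_add2l; apply: leq_trans h; rewrite !mulnDl addnA.
  by apply/eq_leq; ring.
have ee : e = 1%N by lia.
have ej1 : j = 1%N by lia.
subst e j => {Y2 big' lej e0 e1 e2 ej cb}.
have posV' : (0 < \dim V')%N by apply: leq_trans dimV'.
have E3 : (q * #|Y :&: zset V'| <= 3 * q ^ n)%N.
  move: posV'; rewrite lt0n dimv_eq0 -subv0 => /subvPn[f fV]; rewrite memv0 => f0.
  have /affP[g [g0 eqf]] := subvP (Pol1_aff _) _ (subvP VP' _ fV).
  case: (eqVneq g 0) => [g_0|gn0].
    suff -> : Y :&: zset V' = set0 by rewrite cards0 muln0.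
    apply/eqP/set0Pn => -[x /setIP[_ /zsetP/(_ f fV) fx]].
    have fE y : f y = g0 by rewrite eqf ffunE g_0 mulmx0 mxE add0r.
    case/negP: f0; apply/eqP/ffunP => y; by rewrite fE -(fE x) fx ffunE.
  apply: leq_trans (hY isT g g0 gn0); rewrite leq_mul2l; apply/orP; right.
  apply/subset_leq_card/setIS/subsetP => x /zsetP/(_ f fV) fx.
  by rewrite inE -eqf fx.
have cutY' : (#|Y| <= #|Y :&: hplane d d0| + #|Y :&: zset V'|)%N.
  apply: card_cut => x xY xH; rewrite inE xY; apply: zV' => //; exact: (subsetP YV).
rewrite -(leq_pmul2l q_gt0).
have := leq_mul (leqnn q) cutY'; have := leq_mul le_e (leqnn (q ^ n)).
move: hE E3 hA; rewrite !mulnDr.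
move: (q ^ n)%N (q * #|Y|)%N (q * #|Y :&: hplane d d0|)%N (q * #|Y :&: zset V'|)%N (q * A)%N.
move=> Q y1 y2 y3 a h1 h2 h3 h4 h5.
have : (q * ((1.+1 - 1).+1 * Q) = 2 * (q * Q))%N by rewrite mulnCA.
by move: (q * _)%N (q * _)%N h4 => u w h4; lia.
Qed.

(* With pdim n j < r <= pdim n j.+1: if no hyperplane divides more than pdim n j.-1
   dimensions of W, average over all hyperplane sections; otherwise bound the
   section by induction, and the complement, an affine chart, through the forms
   divisible by the equation of the hyperplane. *)
Theorem proj_bound e n r (W : {vspace Fun 'rV[F]_n.+1}) :
  (e * e <= q)%N -> (W <= Hom n.+1 e.+1)%VS -> (0 < r)%N -> (r <= \dim W)%N ->
  (r <= pdim n e.+1)%N -> (r <= tail_count q n e (pcount W - psum n))%N.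
Proof.
move=> le_e; have lt_e := sq_lt le_e.
elim: n r W => [|n IH] r W WH r0 rW rc.
  have [v [B [P sp]]] := split_exists (delta_neq0 F (ord0 : 'I_1)).
  suff -> : pcount W = 0%N by rewrite sub0n tail_count_zero.
  have : (pcount (restr (inclB B) W) <= psum 0)%N := pcount_le (restr_inclB_Hom B WH).
  rewrite (pcount_cut sp WH) big_ord0 leqn0 => /eqP->; apply/eqP; rewrite -leqn0 add0n.
  have [V [VP dimV sub]] := chart_quot sp WH.
  apply: leq_trans (subset_leq_card sub) _; rewrite zset_dim0 //.
  apply: leq_trans dimV; rewrite (capv_idPl _) ?(leq_trans r0) //.
  apply/subvP => f fW; apply/vanishP => x; rewrite inE ffunE addr0 => /eqP xc.
  have -> : x = 0 by rewrite [x](split_dec sp) xc scale0r add0r (_ : x *m P = 0) ?mul0mx // thinmx0.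
  by have /zsetP := zset_0 WH; apply.
have psS : psum n.+1 = (q ^ n + psum n)%N by rewrite big_ord_recr addnC.
(* If all of [W] vanishes on a hyperplane, the affine bound on the chart suffices, since the
   hyperplane has psum n.+1 points. *)
case: (boolP [exists c, (c != 0) && (W <= vanish (hplane c 0%R))%VS]).
  move=> /existsP[c /andP[cn0 Wv]].
  have [v [B [P sp]]] := split_exists cn0.
  have [V [VP dimV sub]] := chart_quot sp WH.
  rewrite (capv_idPl Wv) in dimV.
  apply: leq_trans rW _; apply: leq_trans dimV _.
  apply: leq_trans (affine_hilbert le_e VP (subxx _)) _; apply: tail_count_anti.
  rewrite (pcount_cut sp WH) leq_subLR leq_add ?subset_leq_card //.
  exact: pcount_le (restr_inclB_Hom B WH).
rewrite negb_exists => /forallP nv0.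
have nv c : c != 0 -> ~~ (W <= vanish (hplane c 0%R))%VS.
  by move=> cn0; have := nv0 c; rewrite cn0.
have [j [lej ltj leS]] := class_exists r0 rc.
have IHc c v B P : @split_of F n.+1 c v B P -> c != 0 ->
  let W' := restr (inclB B) W in
  (0 < \dim W')%N /\ (minn (\dim W') (pdim n e.+1) <= tail_count q n e (pcount W' - psum n))%N.
  move=> sp cn0 W'; have pos : (0 < \dim W')%N := restr_inclB_pos sp (nv _ cn0).
  split => //; apply: IH; [exact: restr_inclB_Hom| |exact: geq_minl|exact: geq_minr].
  by rewrite leq_min pos /pdim bin_gt0 leq_addr.
have r'0 : (0 < r - pdim n.+1 j)%N by rewrite subn_gt0.
have r'le : (r - pdim n.+1 j <= pdim n j.+1)%N by rewrite leq_subLR -pdimS.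
case: (boolP [exists c, (c != 0) && (pdim n.+1 j.-1 < \dim (W :&: vanish (hplane c 0%R)))%N]); last first.
  rewrite negb_exists => /forallP small.
  have [c cn0 avg] := averaging_pcount WH.
  have [v [B [P sp]]] := split_exists cn0.
  have [pos ih] := IHc _ _ _ _ sp cn0.
  set W' := restr (inclB B) W in pos ih.
  (* For j > 0 Pascal's rule turns the left side into r - pdim n.+1 j.-1. *)
  have dimW' : (r - pdim n.+1 j + pdim n j <= \dim W')%N.
    have := small c; rewrite cn0 /= -leqNgt => sm.
    have dc := dim_cut W sp; rewrite -/W' in dc.
    have hr : (r <= pdim n.+1 j.-1 + \dim W')%N.
      by apply: leq_trans rW _; rewrite -dc leq_add2r.
    move: hr ltj; case: (j) => [|i]; first by rewrite /= subn0 addn0.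
    rewrite pdimS /= => hr lt; move: (\dim W') hr => D hr; lia.
  have := @tail_count_avg q q_gt1 n e (e - j) (r - pdim n.+1 j) (pcount W' - psum n) lt_e (leq_subr _ _) r'0.
  rewrite subKn // => /(_ r'le).
  have -> : (r - pdim n.+1 j + pdim n.+1 j = r)%N by rewrite subnK // ltnW.
  move=> ravg; apply: leq_trans (ravg _) _.
    apply: leq_trans ih; rewrite leq_min geq_minr andbT.
    exact: leq_trans (geq_minl _ _) dimW'.
  apply: tail_count_anti; rewrite psumS mulnBr leq_subLR addnAC.
  apply: leq_trans (avg _ _ _ sp) _; rewrite -/W'; move: (q * _)%N (q * _)%N => x y; lia.
move=> /existsP[c /andP[cn0 big]].
have [v [B [P sp]]] := split_exists cn0.
have [pos ih] := IHc _ _ _ _ sp cn0.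
set W' := restr (inclB B) W in pos ih.
set A := (pcount W' - psum n)%N in ih *.
have [V [VP dimV sub]] := chart_quot sp WH.
have eqN := pcount_cut sp WH; rewrite -/W' in eqN.
set Y := zset (restr (chart v B) W) in sub eqN.
have capn : (0 < pdim n e.+1)%N by rewrite /pdim bin_gt0 leq_addr.
have hA : (q * A <= e * q ^ n)%N.
  by apply: tail_count_pos => //; apply: leq_trans ih; rewrite leq_min pos.
have leNh : (pcount W' <= A + psum n)%N by rewrite addnC -leq_subLR.
(* It is enough to bound the excess by (e - j) * q ^ n, where [tail_count] is pdim n.+1 j.+1, the
   upper end of the class of r. *)
have fin : (#|Y| + A <= (e - j).+1 * q ^ n)%N -> (r <= tail_count q n.+1 e (pcount W - psum n.+1))%N.
  move=> h; apply: leq_trans leS _.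
  have -> : pdim n.+1 j.+1 = tail_count q n.+1 e ((e - j) * q ^ n).
    rewrite -[((e - j) * _)%N]addn0 tail_count_shiftn ?leq_subr // subKn // tail_count_zero //.
    exact: leq_ltn_trans lej lt_e.
  apply: tail_count_anti; rewrite psS eqN leq_subLR; rewrite mulSn in h.
  by move: h leNh; move: (q ^ n)%N (_ * _)%N (psum n) => a b s; lia.
(* Above pdim n.+1 j the affine bound has leading digit e - j, and j + e <= q absorbs the
   second-order terms. *)
case: (leqP (\dim (W :&: vanish (hplane c 0%R))) (pdim n.+1 j)) => tj; last first.
  apply: fin.
  have bigV : (pdim n.+1 (e - (e - j)) < \dim V)%N.
    by rewrite subKn //; apply: leq_trans tj dimV.
  have := class_bound le_e VP bigV; rewrite subKn // => cb.
  have cY : (#|Y| <= #|zset V|)%N := subset_leq_card sub.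
  have qq0 : (0 < q * q)%N by rewrite muln_gt0 q_gt0.
  have e2q : (e + e <= q)%N.
    by case: (e) le_e => [|[|i]] le_i; [|exact: q_gt1|apply: leq_trans le_i; nia].
  rewrite -(leq_pmul2l qq0) mulnDr.
  have h1 : (q * q * #|Y| <= (e - j) * (q * (q * q ^ n)) + j * (q * q ^ n))%N.
    rewrite -!expnS mulnn; apply: leq_trans cb; by rewrite leq_mul2l cY orbT.
  have h2 : (q * q * A <= e * (q * q ^ n))%N by rewrite -mulnA mulnCA leq_mul2l hA orbT.
  apply: leq_trans (leq_add h1 h2) _.
  have h3 : ((j + e) * (q * q ^ n) <= q * (q * q ^ n))%N.
    by rewrite leq_mul2r; apply/orP; right; apply: leq_trans e2q; rewrite leq_add2r.
  rewrite -addnA -mulnDl; apply: leq_trans (leq_add (leqnn _) h3) _.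
  by apply/eq_leq; ring.
have j0 : (0 < j)%N.
  by case: (j) big tj => //= big; rewrite leqn0 => /eqP e0; rewrite e0 in big.
have := @chart_zeros e n j Y V A le_e lej VP sub (leq_trans big dimV).
case=> //; [|move=> [leY je]].
  move=> e1 d d0 dn0.
  have [phi [pi hp]] := hyper_exists d0 dn0.
  rewrite (card_zset_restr hp); apply: card_zset_le.
    by apply: (restr_Pol hp); apply: restr_chart_Pol.
  have IH1 (W1 : {vspace Fun 'rV[F]_n.+1}) : (W1 <= Hom n.+1 e.+1)%VS -> (0 < \dim W1)%N ->
      (q * (pcount W1 - psum n) <= e * q ^ n)%N.
    by move=> W1H pos1; have := IH 1%N W1 W1H isT pos1 capn; apply: tail_count_pos.
  exact: (restr_pos hp (@chart_hplane F e n c v B P d d0 W e1 le_e IH1 WH nv sp dn0)).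
(* Here #|Y| <= q ^ n, so the excess of [W] is at most that of the section; the two parts of the
   dimension of [W] match the two terms of [tail_count_rec]. *)
rewrite je in ltj tj *.
have leA : (A <= q ^ n)%N.
  rewrite -(leq_pmul2l q_gt0); apply: leq_trans hA _.
  by rewrite leq_mul2r (ltnW lt_e) orbT.
apply: leq_trans (_ : tail_count q n.+1 e A <= _)%N; last first.
  apply: tail_count_anti; rewrite psS eqN leq_subLR addnC -addnA leq_add //.
  by rewrite addnC.
have -> : tail_count q n.+1 e A = (pdim n.+1 e + tail_count q n e A)%N.
  by rewrite -[A in LHS]add0n -[0%N](mul0n (q ^ n)%N) tail_count_rec // subn0.
rewrite -leq_subLR; apply: leq_trans ih; rewrite leq_min -je r'le andbT.
rewrite leq_subLR; apply: leq_trans rW _; rewrite -(dim_cut W sp) -/W'.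
by rewrite leq_add2r je.
Qed.

End ProjBound.

(** * The numbers H_r *)

Section OmegaNumbers.
Local Open Scope nat_scope.
Variable q : nat.
Hypothesis q_gt1 : 1 < q.
Let q_gt0 : 0 < q := ltnW q_gt1.

Definition qval (s : nat -> nat) (m : nat) : nat := \sum_(i < m) s i * q ^ (m - i.+1).

Lemma qvalS s m : qval s m.+1 = qval s m * q + s m.
Proof.
rewrite /qval big_ord_recr /= subnn expn0 muln1 big_distrl; congr (_ + _).
by apply: eq_bigr => i _; rewrite subSS /= -mulnA -expnSr -subnSK.
Qed.

Lemma qval_lt s m : (forall i, i < m -> s i < q) -> qval s m < q ^ m.
Proof.
elim: m => [|m IH] h; first by rewrite /qval big_ord0.
rewrite qvalS; apply: last_lt; first exact: h.
by apply: IH => i lti; apply: h; apply: ltnW.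
Qed.

Lemma eq_qval s s' m : (forall i, i < m -> s i = s' i) -> qval s m = qval s' m.
Proof. by move=> h; apply: eq_bigr => i _; rewrite h. Qed.

Lemma leq_qval s s' m : (forall i, i < m -> s i <= s' i) -> qval s m <= qval s' m.
Proof. by move=> h; apply: leq_sum => i _; rewrite leq_mul2r h ?orbT. Qed.

Lemma qval_lex s s' m k : k < m -> (forall i, i < k -> s i = s' i) -> s k < s' k ->
  (forall i, i < m -> s i < q) -> qval s m < qval s' m.
Proof.
elim: m => // m IH ltk eqs lts h; rewrite !qvalS.
move: ltk; rewrite ltnS leq_eqVlt => /orP[/eqP eqk|ltk].
  by rewrite -eqk (eq_qval eqs) ltn_add2l.
have lt : qval s m < qval s' m by apply: IH => // i lti; apply: h; apply: ltnW.
apply: leq_trans (_ : (qval s m).+1 * q <= _).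
  by rewrite mulSn addnC ltn_add2r h.
by apply: leq_trans (leq_addr _ _); rewrite leq_mul2r lt orbT.
Qed.

Lemma dsum_qval s m : (forall i, i < m -> s i < q) -> dsum q m (qval s m) = \sum_(i < m) s i.
Proof.
elim: m => [|m IH] h; first by rewrite /dsum !big_ord0.
rewrite qvalS dsum_last ?h // IH ?big_ord_recr // => i lti.
by apply: h; apply: ltnW.
Qed.

Lemma qval_dig m n : n < q ^ m -> qval (fun i => dig q (m - i.+1) n) m = n.
Proof.
elim: m n => [|m IH] n ltn; first by rewrite /qval big_ord0; case: n ltn.
rewrite qvalS subnn {2}/dig expn0 divn1 [RHS](divn_eq n q); congr (_ * _ + _).
rewrite -[RHS]IH; last by rewrite ltn_divLR // -expnSr.
by apply: eq_qval => i lti; rewrite subSS -subnSK // /dig expnS divnMA.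
Qed.

Variables (e m : nat).
Hypothesis lt_e : e < q.
Local Notation Tup := (m.+1.-tuplelexi 'I_e.+1).
Implicit Types g : Tup.

Definition entry g (i : nat) : nat := tnth g (inord i).
Definition omega_val g : nat := qval (entry g) m.

Lemma entry_le g i : entry g i <= e.
Proof. by rewrite -ltnS ltn_ord. Qed.

Lemma entry_lt g i : entry g i < q.
Proof. exact: leq_ltn_trans (entry_le g i) lt_e. Qed.

Lemma entry_sum g : g \in Omega e m -> \sum_(i < m.+1) entry g i = e.
Proof.
rewrite inE => /eqP eqe; rewrite -[RHS]eqe.
by apply: eq_bigr => i _; rewrite /entry inord_val.
Qed.

Lemma HrE r : Hr q r e m = omega_val (Omega_nth r e m).
Proof.
apply: eq_bigr => i _; congr (_ * _); rewrite /entry; congr (nat_of_ord (tnth _ _)).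
by apply: val_inj; rewrite /= inordK // ltnW // ltnS.
Qed.

Lemma omega_val_mono g g' : (g <= g')%O -> omega_val g <= omega_val g'.
Proof.
rewrite le_eqVlt => /orP[/eqP->//|/ltxi_tuplePlt[k eqk ltk]].
have eqe i : i < k -> entry g i = entry g' i.
  move=> lti; rewrite /entry eqk //= inordK //.
  exact: ltn_trans lti (ltn_ord k).
have lte : entry g k < entry g' k by rewrite /entry inord_val.
(* [omega_val] ignores the last entry: if the tuples first differ there, the values agree. *)
case: (ltnP k m) => ltkm; first by apply/ltnW/(qval_lex ltkm eqe lte) => i _; apply: entry_lt.
rewrite /omega_val (@eq_qval _ (entry g')) // => i lti; apply: eqe.
exact: leq_trans lti ltkm.
Qed.

(** Inverse of [omega_val] on numbers of digit sum at most e; the last entry fills the sum up to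
    e. *)
Definition of_num (n : nat) : Tup :=
  [tuple inord (if i < m then dig q (m - i.+1) n else e - dsum q m n) | i < m.+1].

Lemma entry_of_num n i : dsum q m n <= e -> i < m -> entry (of_num n) i = dig q (m - i.+1) n.
Proof.
move=> le lti; have lt1 : i < m.+1 by apply: ltnW.
rewrite /entry tnth_mktuple (inordK lt1) lti inordK //; apply: leq_trans (_ : _ <= dsum q m n) le.
have ltj : m - i.+1 < m by rewrite -subSn // subSS leq_subr.
by rewrite /dsum (bigD1 (Ordinal ltj)) //= leq_addr.
Qed.

Lemma omega_val_of_num n : n < q ^ m -> dsum q m n <= e -> omega_val (of_num n) = n.
Proof.
by move=> ltn le; rewrite -[RHS](qval_dig ltn); apply: eq_qval => i; apply: entry_of_num.
Qed.

Lemma of_num_Omega n : n < q ^ m -> dsum q m n <= e -> of_num n \in Omega e m.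
Proof.
move=> ltn le; rewrite inE big_ord_recr /=.
rewrite (eq_bigr (fun i : 'I_m => dig q (m - i.+1) n)) => [|i _]; last first.
  rewrite -(entry_of_num le (ltn_ord i)) /entry; congr (nat_of_ord (tnth _ _)).
  by apply: val_inj; rewrite /= (inordK (leqW (ltn_ord i))).
rewrite tnth_mktuple /= ltnn inordK ?ltnS ?leq_subr //.
rewrite -(@dsum_qval (fun i => dig q (m - i.+1) n)) => [|i _]; last exact: dig_lt.
by rewrite qval_dig // subnKC.
Qed.

Lemma R_Omega N : tail_count q m e N <= #|[set g in Omega e m | N <= omega_val g]|.
Proof.
have -> : tail_count q m e N = #|[set n : 'I_(q ^ m) | (N <= n) && (dsum q m n <= e)]|.
  by rewrite -sum1_card /tail_count /low_count [RHS]big_mkcond; apply: eq_bigr => i _; rewrite inE; case: (_ && _).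
rewrite -(@card_in_imset _ _ (fun n : 'I_(q ^ m) => of_num n)) => [|x y]; last first.
  rewrite !inE => /andP[_ lx] /andP[_ ly] eqg; apply: val_inj.
  by rewrite /= -(omega_val_of_num (ltn_ord x) lx) eqg omega_val_of_num.
apply: subset_leq_card; apply/subsetP => g /imsetP[x]; rewrite inE => /andP[leN lx] ->.
by rewrite inE of_num_Omega // omega_val_of_num.
Qed.

Definition Omega_seq : seq Tup := sort >=%O (enum (Omega e m)).

Lemma Omega_seq_sorted : sorted >=%O Omega_seq.
Proof. by apply: sort_sorted => x y; apply: le_total. Qed.

Lemma mem_Omega_seq g : (g \in Omega_seq) = (g \in Omega e m).
Proof. by rewrite mem_sort mem_enum. Qed.

Lemma Omega_seq_uniq : uniq Omega_seq.
Proof. by rewrite sort_uniq enum_uniq. Qed.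

Lemma size_Omega_seq : pdim m e.+1 <= size Omega_seq.
Proof.
rewrite size_sort -cardE -(tail_count_zero q_gt1 m lt_e); apply: leq_trans (R_Omega 0) _.
by apply: subset_leq_card; apply/subsetP => g; rewrite inE => /andP[].
Qed.

Lemma Omega_seq_le r (i : nat) g0 : 0 < r -> r <= size Omega_seq -> i < r ->
  (nth g0 Omega_seq r.-1 <= nth g0 Omega_seq i)%O.
Proof.
move=> r0 ler lti; have := sorted_leq_nth _ _ g0 Omega_seq_sorted.
move=> /(_ ge_trans ge_refl i r.-1); rewrite !inE; apply.
- exact: leq_trans lti ler.
- by rewrite prednK.
- by rewrite -ltnS prednK.
Qed.

(** If H_r were below N, the elements of value at least N, r or more of them, would all be strictly
    larger than the r-th largest one, but only r.-1 are. *)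
Lemma tail_count_Hr r N : 0 < r -> r <= pdim m e.+1 -> r <= tail_count q m e N -> N <= Hr q r e m.
Proof.
move=> r0 ler leR; rewrite HrE leqNgt; apply/negP => ltN.
have szr : r <= size Omega_seq := leq_trans ler size_Omega_seq.
set b := Omega_nth r e m in ltN.
have : tail_count q m e N <= r.-1.
  apply: leq_trans (R_Omega N) _.
  apply: leq_trans (_ : count (fun g => (b < g)%O) Omega_seq <= _).
    rewrite -size_filter cardE; apply: uniq_leq_size; first exact: enum_uniq.
    move=> g; rewrite mem_enum inE mem_filter mem_Omega_seq => /andP[-> leg]; rewrite andbT.
    rewrite ltNge; apply/negP => /omega_val_mono le; move: ltN; rewrite ltnNge => /negP[].
    exact: leq_trans leg le.
  have lt : r.-1 < size Omega_seq by rewrite prednK.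
  rewrite -{1}(cat_take_drop r.-1 Omega_seq) count_cat.
  rewrite [X in _ + X](_ : _ = 0) ?addn0.
    apply: leq_trans (count_size _ _) _; by rewrite size_take lt.
  apply/eqP; rewrite -leqn0 leqNgt -has_count; apply/hasPn => g.
  have ds := drop_sorted r.-1 Omega_seq_sorted.
  rewrite (drop_nth [tuple ord0 | i < m.+1] lt) in ds *.
  rewrite inE -leNgt => /orP[/eqP->//|gd].
  by have /allP := order_path_min ge_trans ds; apply.
by move=> /(leq_trans leR); rewrite leqNgt prednK ?leqnn.
Qed.

End OmegaNumbers.

(** * Forms as functions *)

Section Evaluation.
Variable F : finFieldType.
Local Notation q := #|F|.
Notation Fun T := {ffun T -> F^o}.
Notation Hom := (Hom F).
Let q_gt1 := card_gt1 F.
Let q_gt0 : (0 < q)%N := ltnW q_gt1.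

Lemma mon_free n : free [seq mon F n k | k <- iota 0 (q ^ n)].
Proof.
by rewrite /free -/(Mspan F n) Mspan_full dimvf dim_Fun card_rV size_map size_iota.
Qed.

Definition code n (a : 'I_n -> nat) : nat := (\sum_(i < n) a i * q ^ i)%N.

Lemma codeS n (a : 'I_n.+1 -> nat) : code a = (code (fun i => a (lift ord0 i)) * q + a ord0)%N.
Proof.
rewrite /code big_ord_recl muln1 addnC; congr (_ + _)%N; rewrite big_distrl.
by apply: eq_bigr => i _; rewrite /= -mulnA -expnSr.
Qed.

Lemma code_lt n (a : 'I_n -> nat) : (forall i, a i < q)%N -> (code a < q ^ n)%N.
Proof.
elim: n a => [|n IH] a h; first by rewrite /code big_ord0.
by rewrite codeS; apply: last_lt; rewrite ?h // IH.
Qed.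

Lemma dig_code n (a : 'I_n -> nat) (i : 'I_n) : (forall i, a i < q)%N -> dig q i (code a) = a i.
Proof.
elim: n a i => [|n IH] a i h; first by case: i.
rewrite codeS; case: (unliftP ord0 i) => [j ->|->]; last by rewrite dig0_last.
by rewrite -[nat_of_ord (lift _ _)]/(j.+1) digS_last // IH.
Qed.

(* The reduction of exponents modulo x ^+ q = x for exponents at most q. *)
Definition redexp (k : nat) : nat := if k == q then 1%N else k.

Lemma redexp_lt k : (k <= q)%N -> (redexp k < q)%N.
Proof. by rewrite /redexp leq_eqVlt; case: eqP. Qed.

Lemma expr_redexp (x : F) k : x ^+ redexp k = x ^+ k.
Proof. by rewrite /redexp; case: eqP => [->|//]; rewrite expf_card. Qed.

Lemma mdeg_le n (m : 'X_{1..n}) i : (m i <= mdeg m)%N.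
Proof. by rewrite mdegE (bigD1 i) //= leq_addr. Qed.

(** In degree d <= q an exponent q occurs only in x_i ^+ q, and then d = q; its reduction x_i is the
    reduction of no other monomial of degree q. *)
Lemma redexp_inj n (m m' : 'X_{1..n}) d : (d <= q)%N -> mdeg m = d -> mdeg m' = d ->
  (forall i, redexp (m i) = redexp (m' i)) -> m = m'.
Proof.
move=> led dm dm' eqr.
have full (k : 'X_{1..n}) i : mdeg k = d -> k i = q -> forall j, j != i -> k j = 0%N.
  move=> dk ki j ji; have := dk; rewrite mdegE (bigD1 i) //= ki (bigD1 j) //=.
  move=> eqd; apply/eqP; rewrite -leqn0 -(leq_add2l q) addn0; apply: leq_trans led.
  by rewrite -eqd addnA leq_addr.
have main (k k' : 'X_{1..n}) i : mdeg k = d -> mdeg k' = d ->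
    (forall i, redexp (k i) = redexp (k' i)) -> k i = q -> k' i = q.
  move=> dk dk' eqk ki; apply/eqP/negPn/negP => nq.
  have k'i : k' i = 1%N.
    by have := eqk i; rewrite /redexp ki eqxx (negPf nq).
  have k'j j : j != i -> k' j = 0%N.
    move=> ji; have := eqk j; rewrite (full k i dk ki j ji) /redexp eq_sym (gtn_eqF q_gt0).
    by case: eqP.
  have : d = 1%N by rewrite -dk' mdegE (bigD1 i) //= k'i big1.
  by have := mdeg_le k i; rewrite dk ki; have := q_gt1; lia.
apply/mnmP => i; case: (eqVneq (m i) q) => [mq|nmq].
  by rewrite mq (main m m').
case: (eqVneq (m' i) q) => [mq|nmq']; first by rewrite mq (main m' m).
by have := eqr i; rewrite /redexp (negPf nmq) (negPf nmq').
Qed.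

Variables (n d : nat).
Local Notation form := (dhomog n.+1 F d).

Definition feval (f : form) : Fun 'rV[F]_n.+1 :=
  [ffun x : 'rV[F]_n.+1 => (mpoly_of_dhomog f).@[x 0] : F^o].

Lemma feval_is_linear : linear feval.
Proof.
move=> a f g; apply/ffunP => x; rewrite !ffunE.
transitivity ((a *: mpoly_of_dhomog f + mpoly_of_dhomog g).@[x 0]); last by rewrite mevalD mevalZ.
by congr (_.@[_]); apply: linearP. Qed.
HB.instance Definition _ := GRing.isLinear.Build F form (Fun 'rV[F]_n.+1) _ feval feval_is_linear.

(** The monomials of f reduce to distinct reduced monomials, which are linearly independent as
    functions. *)
Lemma feval_inj (f : form) : (d <= q)%N -> feval f = 0 -> f = 0.
Proof.
move=> led ev0; apply/val_inj/eqP; rewrite /= -msupp_eq0; apply/eqP.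
set p := mpoly_of_dhomog f.
have hp : p \is d.-homog by apply: dhomog_is_dhomog.
have dm m : m \in msupp p -> mdeg m = d by move/dhomogP: hp; apply.
pose cd (m : 'X_{1..n.+1}) := code (fun i => redexp (m i)).
have ltc m : m \in msupp p -> (cd m < q ^ n.+1)%N.
  by move=> mp; apply: code_lt => i; apply: redexp_lt; rewrite (leq_trans (mdeg_le _ _)) ?dm.
have injc m m' : m \in msupp p -> m' \in msupp p -> cd m = cd m' -> m = m'.
  move=> mp mp' eqc; apply: (@redexp_inj _ m m' d) => //; try exact: dm.
  move=> i; rewrite -(@dig_code _ (fun i => redexp (m i))) => [|j]; last first.
    by apply: redexp_lt; rewrite (leq_trans (mdeg_le _ _)) ?dm.
  rewrite -(@dig_code _ (fun i => redexp (m' i))) => [|j]; last first.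
    by apply: redexp_lt; rewrite (leq_trans (mdeg_le _ _)) ?dm.
  by rewrite -/(cd m) eqc.
have sum0 : \sum_(m <- msupp p) p@_m *: mon F n.+1 (cd m) = 0.
  rewrite -[RHS]ev0; apply/ffunP => x; rewrite sum_ffunE ffunE mevalE.
  rewrite !big_seq; apply: eq_bigr => m mp; rewrite !ffunE; congr (_ * _).
  apply: eq_bigr => i _; rewrite -[RHS]expr_redexp dig_code // => j.
  by apply: redexp_lt; rewrite (leq_trans (mdeg_le _ _)) ?dm.
have /(@freeP _ _ _ (in_tuple [seq mon F n.+1 k | k <- iota 0 (q ^ n.+1)])) fr := mon_free n.+1.
pose k (i : 'I_(size [seq mon F n.+1 k | k <- iota 0 (q ^ n.+1)])) : F :=
  \sum_(m <- msupp p | cd m == i) p@_m.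
have szs : size [seq mon F n.+1 k | k <- iota 0 (q ^ n.+1)] = (q ^ n.+1)%N.
  by rewrite size_map size_iota.
have k0 : forall i, k i = 0.
  apply: fr; rewrite -[RHS]sum0.
  rewrite (eq_bigr (fun i : 'I_(size [seq mon F n.+1 k | k <- iota 0 (q ^ n.+1)]) =>
      \sum_(m <- msupp p | cd m == i) p@_m *: mon F n.+1 (cd m))); last first.
    move=> i _; rewrite scaler_suml; apply: eq_bigr => m /eqP ->.
    have lti : (i < q ^ n.+1)%N := leq_trans (ltn_ord i) (eq_leq szs).
    by rewrite (nth_map 0%N) ?size_iota // nth_iota.
  rewrite (exchange_big_dep predT) //= !big_seq; apply: eq_bigr => m mp.
  have lt : (cd m < size [seq mon F n.+1 k | k <- iota 0 (q ^ n.+1)])%N by rewrite szs ltc.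
  by rewrite (big_pred1 (Ordinal lt)) // => i; rewrite eq_sym.
case E: (msupp p) => [//|m s].
have mp : m \in msupp p by rewrite E mem_head.
have lt : (cd m < size [seq mon F n.+1 k | k <- iota 0 (q ^ n.+1)])%N by rewrite szs ltc.
have := k0 (Ordinal lt); rewrite /k /= (big_rem m) //= eqxx big_seq_cond big1 ?addr0.
  by move/eqP; rewrite mcoeff_eq0 mp.
move=> m' /andP[m's /eqP eqc].
have m'p : m' \in msupp p := mem_rem m's.
have eqm := injc _ _ m'p mp eqc; rewrite eqm in m's.
by move: m's; rewrite mem_rem_uniq ?msupp_uniq // inE eqxx.
Qed.

Lemma feval_Hom (f : form) : feval f \in Hom n.+1 d.
Proof.
have hp : mpoly_of_dhomog f \is d.-homog by apply: dhomog_is_dhomog.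
have pow i a : [ffun x : 'rV[F]_n.+1 => x 0 i ^+ a : F^o] \in Hom n.+1 a.
  elim: a => [|a IH].
    by rewrite (_ : finfun _ = fone F _) ?memv_line //; apply/ffunP => x; rewrite !ffunE.
  have -> : [ffun x : 'rV[F]_n.+1 => x 0 i ^+ a.+1 : F^o] =
      fmul (coordf F i) [ffun x : 'rV[F]_n.+1 => x 0 i ^+ a : F^o].
    by apply/ffunP => x; rewrite [RHS]ffunE coordfE !ffunE exprS.
  by apply: mem_pwS; rewrite // lin_mem.
have mono (m : 'X_{1..n.+1}) (s : seq 'I_n.+1) :
  [ffun x : 'rV[F]_n.+1 => \prod_(i <- s) x 0 i ^+ m i : F^o] \in Hom n.+1 (\sum_(i <- s) m i).
  elim: s => [|i s IH].
    rewrite big_nil (_ : finfun _ = fone F _) ?memv_line //.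
    by apply/ffunP => x; rewrite !ffunE big_nil.
  have -> : [ffun x : 'rV[F]_n.+1 => \prod_(j <- i :: s) x 0 j ^+ m j : F^o] =
     fmul [ffun x : 'rV[F]_n.+1 => x 0 i ^+ m i : F^o]
       [ffun x : 'rV[F]_n.+1 => \prod_(j <- s) x 0 j ^+ m j : F^o].
    by apply/ffunP => x; rewrite !ffunE big_cons.
  by rewrite big_cons; apply: pw_mul.
have -> : feval f = \sum_(m <- msupp (mpoly_of_dhomog f))
    (mpoly_of_dhomog f)@_m *: [ffun x : 'rV[F]_n.+1 => \prod_i x 0 i ^+ m i : F^o].
  by apply/ffunP => x; rewrite sum_ffunE ffunE mevalE; apply: eq_bigr => m _; rewrite !ffunE.
rewrite big_seq; apply: rpred_sum => m mp; apply: rpredZ.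
have hm : mdeg m = d by move/dhomogP: hp => /(_ m mp).
by rewrite -hm mdegE; apply: mono.
Qed.

End Evaluation.

(** * From tuples of forms to spaces of functions *)

Section RationalZeros.
Variable F : finFieldType.
Local Notation q := #|F|.
Notation Fun T := {ffun T -> F^o}.
Let q_gt1 := card_gt1 F.
Let q1_gt0 : (0 < q.-1)%N. Proof. by rewrite -ltnS prednK // ltnW. Qed.
Variables (n e r : nat).
Hypothesis lee : (e.+1 <= q)%N.
Local Notation form := (dhomog n.+1 F e.+1).
Variable t : r.-tuple form.

Definition eval_space : {vspace Fun 'rV[F]_n.+1} := <<[seq feval f | f <- t]>>%VS.

Lemma eval_space_Hom : (eval_space <= Hom F n.+1 e.+1)%VS.
Proof. by apply/span_subvP => f /mapP[g _ ->]; apply: feval_Hom. Qed.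

Lemma dim_eval_space : free (t : seq (finvect_type form)) -> \dim eval_space = r.
Proof.
move=> ft; have ft' : free (t : seq form) by [].
have -> : eval_space = (linfun (@feval F n e.+1) @: <<t>>)%VS.
  by rewrite limg_span; congr span; apply: eq_map => f; rewrite lfunE.
rewrite limg_dim_eq; first by have := eqP ft'; rewrite size_tuple.
apply/eqP; rewrite -subv0; apply/subvP => f; rewrite memv_cap memv_ker lfunE => /andP[_ /eqP f0].
by rewrite memv0; apply/eqP; apply: feval_inj f0.
Qed.

Lemma zset_eval x : (x \in zset eval_space) = [forall i, (tnth t i).@[x 0] == 0].
Proof.
apply/zsetP/forallP => [h i|h f].
  have := h (feval (tnth t i)); rewrite ffunE => -> //.
  by apply/memv_span/map_f/mem_tnth.
have sub : (eval_space <= vanish F [set x])%VS.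
  apply/span_subvP => g /mapP[p /tnthP[i ->] ->]; apply/vanishP => y; rewrite inE => /eqP->.
  by rewrite ffunE; apply/eqP.
by move=> fW; have /vanishP := subvP sub f fW; apply; rewrite inE.
Qed.

Lemma proportional_equiv :
  {in [set x : 'rV[F]_n.+1 | x != 0] & &, equivalence_rel (@proportional F n)}.
Proof.
move=> x y z _ _ _; split.
  by apply/existsP; exists 1; rewrite oner_eq0 scale1r eqxx.
move=> /existsP[c /andP[c0 /eqP ->]]; apply/existsP/existsP => -[b /andP[b0 /eqP->]].
  exists (b / c); rewrite mulf_neq0 ?invr_eq0 //= scalerA divfK //.
by exists (b * c); rewrite mulf_neq0 //= scalerA.
Qed.

(** Each point consists of q - 1 coordinate vectors, and the points in the zero set partition its
    nonzero vectors. *)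
Lemma card_rational_zeros : #|rational_zeros t| = pcount eval_space.
Proof.
have WH := eval_space_Hom.
apply/eqP; rewrite -(eqn_pmul2l q1_gt0) (pcountE WH) mulnC; apply/eqP/esym.
have partP := equivalence_partitionP proportional_equiv.
have [/eqP covP trivP n0P] := and3P partP.
have sub : rational_zeros t \subset proj_space F n by apply/subsetP => p; rewrite inE => /andP[].
have classE (p : {set 'rV[F]_n.+1}) : p \in proj_space F n -> exists2 x, x != 0 &
    p = [set y in [set x | x != 0] | proportional x y].
  by move=> /imsetP[x]; rewrite inE => x0 ->; exists x.
apply: card_uniform_partition => [p /(subsetP sub)/classE[x x0 ->]|].
  have -> : q.-1 = #|[set~ (0 : F)]| by rewrite cardsC1.
  rewrite -(card_imset _ (_ : injective (fun c : F => c *: x))); last first.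
    by move=> c c' /eqP; rewrite -subr_eq0 -scalerBl scaler_eq0 (negPf x0) orbF subr_eq0 => /eqP.
  apply: eq_card => y; rewrite !inE; apply/andP/imsetP.
    by move=> [_ /existsP[c /andP[c0 /eqP->]]]; exists c; rewrite ?inE.
  move=> [c]; rewrite !inE => c0 ->; rewrite scaler_eq0 negb_or c0 x0; split => //.
  by apply/existsP; exists c; rewrite c0 eqxx.
apply/and3P; split; last by apply: contra n0P; apply: (subsetP sub).
  apply/eqP/setP => x; rewrite in_setD1; apply/bigcupP/andP.
    move=> [p pr xp]; have /classE[x' _ eqp] := subsetP sub _ pr.
    move: pr xp; rewrite inE => /andP[_ /forallP h] xp; split.
      by move: xp; rewrite eqp !inE => /andP[].
    rewrite zset_eval; apply/forallP => i.
    by have /forallP/(_ x) := h i; rewrite xp.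
  move=> [x0 xz]; exists [set y in [set x | x != 0] | proportional x y].
    rewrite inE; apply/andP; split; first by apply/imsetP; exists x; rewrite ?inE.
    apply/forallP => i; apply/forallP => y; apply/implyP; rewrite !inE => /andP[_ /existsP[c /andP[c0 /eqP->]]].
    by have := xz; rewrite -(zset_scale _ WH c0) zset_eval => /forallP.
  by rewrite !inE x0; apply/existsP; exists 1; rewrite oner_eq0 scale1r eqxx.
exact: trivIsetS sub trivP.
Qed.

End RationalZeros.

(** * Extremal families *)

Section LowerBound.
Variable F : finFieldType.
Local Notation q := #|F|.
Let q_gt1 := card_gt1 F.
Let q_gt0 : (0 < q)%N := ltnW q_gt1.
Let q1_gt0 : (0 < q.-1)%N. Proof. by rewrite -ltnS prednK. Qed.

Definition enum_elt (j : nat) : F := nth 0 (enum F) j.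

Lemma enum_elt_inj i j : (i < q)%N -> (j < q)%N -> enum_elt i = enum_elt j -> i = j.
Proof.
by move=> lti ltj /eqP; rewrite nth_uniq -?cardE ?enum_uniq // => /eqP.
Qed.

Variables (n e : nat).
Hypothesis lt_e : (e < q)%N.
Local Notation Tup := (n.+1.-tuplelexi 'I_e.+1).
Local Notation form := (dhomog n.+1 F e.+1).
Implicit Types g : Tup.

Definition shift_form (i : 'I_n) (j : nat) : {mpoly F[n.+1]} :=
  'X_(lift ord0 i) - enum_elt j *: 'X_ord0.

(** The last entry of g supplies the power of x_0 that brings every form to degree e.+1. *)
Definition prod_form g : {mpoly F[n.+1]} :=
  'X_ord0 * (\prod_(i < n) \prod_(j < entry g i) shift_form i j) * 'X_ord0 ^+ entry g n.

Lemma dhomog_bigprod (I : Type) (s : seq I) (f : I -> {mpoly F[n.+1]}) (dg : I -> nat) :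
  (forall i, f i \is (dg i).-homog) -> \prod_(i <- s) f i \is (\sum_(i <- s) dg i).-homog.
Proof.
move=> h; elim: s => [|i s IH]; first by rewrite !big_nil dhomog1.
by rewrite !big_cons; apply: dhomogM.
Qed.

Lemma dhomogXi (i : 'I_n.+1) : ('X_i : {mpoly F[n.+1]}) \is 1.-homog.
Proof. by rewrite dhomogX /= mdeg1. Qed.

Lemma prod_form_homog g : g \in Omega e n -> prod_form g \is e.+1.-homog.
Proof.
move=> gO; have -> : (e.+1 = 1 + \sum_(i < n) entry g i + entry g n)%N.
  by have := entry_sum gO; rewrite big_ord_recr /= -addnA => ->.
apply: dhomogM; last first.
  by have := dhomogMn (entry g n) (dhomogXi ord0); rewrite mul1n.
apply: dhomogM; first exact: dhomogXi.
apply: (@dhomog_bigprod _ _ (fun i : 'I_n => \prod_(j < entry g i) shift_form i j) (fun i => entry g i)) => i.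
have ltE : (\sum_(j < entry g i) 1)%N = entry g i by rewrite sum1_card card_ord.
rewrite -[X in X.-homog]ltE.
apply: (@dhomog_bigprod _ _ (fun j : 'I_(entry g i) => shift_form i j) (fun=> 1%N)) => j.
rewrite /shift_form rpredB ?dhomogXi //.
by rewrite rpredZ ?dhomogXi.
Qed.

Definition dhomog_prod_form g : form := insubd (0 : form) (prod_form g).

Lemma dhomog_prod_formE g : g \in Omega e n -> mpoly_of_dhomog (dhomog_prod_form g) = prod_form g.
Proof. by move=> gO; rewrite [LHS]insubdK //; apply: prod_form_homog. Qed.

Lemma prod_form_eval g (x : 'rV[F]_n.+1) : (prod_form g).@[x 0] =
  x 0 ord0 * (\prod_(i < n) \prod_(j < entry g i) (x 0 (lift ord0 i) - enum_elt j * x 0 ord0))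
    * x 0 ord0 ^+ entry g n.
Proof.
rewrite /prod_form !mevalM mevalXU rmorphXn /= mevalXU rmorph_prod /=; congr (_ * _ * _).
apply: eq_bigr => i _; rewrite rmorph_prod; apply: eq_bigr => j _ /=.
by rewrite mevalB mevalZ !mevalXU.
Qed.

Definition affine_pt (a : nat -> nat) : 'rV[F]_n.+1 :=
  \row_i (if unlift ord0 i is Some j then enum_elt (a j) else 1).

Lemma affine_pt0 a : affine_pt a 0 ord0 = 1. Proof. by rewrite mxE unlift_none. Qed.
Lemma affine_ptS a i : affine_pt a 0 (lift ord0 i) = enum_elt (a i).
Proof. by rewrite mxE liftK. Qed.

(** The factor with index j vanishes exactly if j is a i, so those with j below entry i of g are all
    nonzero exactly if that entry is at most a i. *)
Lemma prod_form_pt g a : (forall i, (i < n)%N -> (a i < q)%N) ->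
  ((prod_form g).@[affine_pt a 0] != 0) = [forall i : 'I_n, (entry g i <= a i)%N].
Proof.
move=> lta; rewrite prod_form_eval affine_pt0 expr1n mul1r mulr1.
apply/prodf_neq0/forallP => h i.
  have /prodf_neq0 hi := h i isT; rewrite leqNgt; apply/negP => lt.
  have := hi (Ordinal lt) isT; rewrite affine_ptS /= mulr1 subrr eqxx //.
move=> _; apply/prodf_neq0 => j _; rewrite affine_ptS mulr1 subr_eq0.
have ltj : (j < a i)%N by apply: leq_trans (h i).
apply/eqP => /enum_elt_inj eqj; move: ltj.
by rewrite -eqj ?ltnn ?lta // (leq_trans (ltn_ord j)) // (leq_trans (entry_le g i)) // ltnW.
Qed.

(** Otherwise the first n entries of g are at most those of g'. As g' < g, the two would first
    differ in the last entry, which equality of the sums excludes. *)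
Lemma prod_form_entry g g' : g \in Omega e n -> g' \in Omega e n -> (g' < g)%O ->
  (prod_form g).@[affine_pt (entry g') 0] = 0.
Proof.
move=> gO gO' lt; apply/eqP/negPn/negP; rewrite prod_form_pt => [|i _]; last exact: entry_lt.
move=> /forallP le; have /ltxi_tuplePlt[k eqk ltk] := lt.
have eqe i : (i < k)%N -> entry g' i = entry g i.
  move=> lti; rewrite /entry eqk //= inordK //.
  exact: ltn_trans lti (ltn_ord k).
have lte : (entry g' k < entry g k)%N by rewrite /entry inord_val.
case: (ltnP k n) => ltkn.
  by have := le (Ordinal ltkn); rewrite /= leqNgt lte.
have ekn : nat_of_ord k = n by apply/eqP; rewrite eqn_leq ltkn -ltnS ltn_ord.
have := etrans (entry_sum gO) (esym (entry_sum gO')); rewrite !big_ord_recr /=.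
rewrite (eq_bigr (fun i : 'I_n => entry g' i)) => [|i _]; last by rewrite eqe ?ekn.
by move=> /addnI eqn; rewrite ekn eqn ltnn in lte.
Qed.

Lemma prod_form_entry_neq0 g : (prod_form g).@[affine_pt (entry g) 0] != 0.
Proof. by rewrite prod_form_pt => [|i _]; [apply/forallP|apply: entry_lt]. Qed.

Variable r : nat.
Hypothesis r_gt0 : (0 < r)%N.
Hypothesis r_le : (r <= pdim n e.+1)%N.

Definition Omega_item (i : nat) : Tup := nth [tuple ord0 | i < n.+1] (Omega_seq e n) i.

Lemma r_le_size : (r <= size (Omega_seq e n))%N.
Proof. exact: leq_trans r_le (size_Omega_seq q_gt1 n lt_e). Qed.

Lemma Omega_item_in i : (i < r)%N -> Omega_item i \in Omega e n.
Proof. by move=> lti; rewrite -mem_Omega_seq mem_nth // (leq_trans lti r_le_size). Qed.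

Lemma Omega_item_lt i j : (i < j)%N -> (j < r)%N -> (Omega_item j < Omega_item i)%O.
Proof.
move=> ltij ltj; have szj := leq_trans ltj r_le_size.
rewrite lt_neqAle; apply/andP; split.
  by rewrite nth_uniq ?Omega_seq_uniq ?(ltn_trans ltij) // gtn_eqF.
have := sorted_leq_nth _ _ ([tuple ord0 | i < n.+1] : Tup) (Omega_seq_sorted e n).
by move=> /(_ ge_trans ge_refl i j); rewrite !inE (ltn_trans ltij szj) szj => /(_ isT isT (ltnW ltij)).
Qed.

Definition extremal_forms : r.-tuple form := [tuple dhomog_prod_form (Omega_item i) | i < r].

Lemma extremal_forms_free : free (extremal_forms : seq (finvect_type form)).
Proof.
have ff : free (extremal_forms : seq form); last by [].
apply/freeP => c sum0 i; apply/eqP/negPn/negP => ci.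
(* Evaluate the relation at the point of item j, with j the last index of a nonzero coefficient:
   forms of smaller index vanish there, and coefficients of larger index are zero. *)
case: (@arg_maxnP _ i (fun i => c i != 0) (fun i => i : nat) ci) => j cj maxj {i ci}.
have := congr1 (fun f : form => (mpoly_of_dhomog f).@[affine_pt (entry (Omega_item j)) 0]) sum0.
have mlin (f g : form) a : mpoly_of_dhomog (a *: f + g) = a *: mpoly_of_dhomog f + mpoly_of_dhomog g.
  exact: linearP.
have -> : (mpoly_of_dhomog (\sum_(i < r) c i *: extremal_forms`_i)).@[affine_pt (entry (Omega_item j)) 0]
   = \sum_(i < r) c i * (prod_form (Omega_item i)).@[affine_pt (entry (Omega_item j)) 0].
  rewrite (big_morph (fun f : form => (mpoly_of_dhomog f).@[affine_pt (entry (Omega_item j)) 0]) (id1 := 0) (op1 := +%R)).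
  - apply: eq_bigr => i _; rewrite -[c i *: _]addr0 mlin mevalD mevalZ meval0 addr0.
    by rewrite -tnth_nth tnth_mktuple dhomog_prod_formE // Omega_item_in.
  - by move=> f g; have := mlin f g 1; rewrite !scale1r => /= ->; rewrite mevalD.
  - exact: meval0.
rewrite /= meval0 (bigD1 j) //= big1 ?addr0 => [|i ij]; last first.
  case: (ltngtP i j) => lt; last by rewrite (val_inj lt) eqxx in ij.
    by rewrite (prod_form_entry (Omega_item_in _) (Omega_item_in _)) ?mulr0 // Omega_item_lt.
  case: (eqVneq (c i) 0) => [->|/maxj]; first by rewrite mul0r.
  by rewrite /geq /= leqNgt lt.
by move/eqP; rewrite mulf_eq0 (negPf cj) (negPf (prod_form_entry_neq0 _)).
Qed.

Let cE : 'cV[F]_(1 + n) := col_mx 1%:M 0.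
Let vE : 'rV[F]_(1 + n) := row_mx 1%:M 0.
Let BE : 'M[F]_(n, 1 + n) := row_mx 0 1%:M.
Let PE : 'M[F]_(1 + n, n) := col_mx 0 1%:M.

Lemma split_std : @split_of F n cE vE BE PE.
Proof.
have e1 : vE *m cE = 1%:M by rewrite mul_row_col mulmx0 mulmx1 addr0.
have e2 : vE *m PE = 0 by rewrite mul_row_col mulmx0 mul0mx addr0.
have e3 : BE *m PE = 1%:M by rewrite mul_row_col mulmx0 mulmx1 add0r.
have e4 : BE *m cE = 0 by rewrite mul_row_col mulmx0 mul0mx addr0.
have e5 : cE *m vE + PE *m BE = 1%:M.
  rewrite !mul_col_row !mulmx0 !mul0mx !mulmx1 add_block_mx !addr0 !add0r.
  by rewrite -scalar_mx_block.
by split.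
Qed.

Lemma row_mx_ord0 (a : 'M[F]_1) (y : 'rV[F]_n) : (row_mx a y : 'rV[F]_n.+1) 0 ord0 = a 0 0.
Proof.
by rewrite -[RHS](row_mxEl a y); congr (fun_of_matrix _ _ _); apply: val_inj.
Qed.

Lemma row_mx_lift (a : 'M[F]_1) (y : 'rV[F]_n) i :
  (row_mx a y : 'rV[F]_n.+1) 0 (lift ord0 i) = y 0 i.
Proof.
by rewrite -[RHS](row_mxEr a y); congr (fun_of_matrix _ _ _); apply: val_inj.
Qed.

Lemma mul_BE (y : 'rV[F]_n) : y *m BE = row_mx (0 : 'M_1) y.
Proof. by rewrite mul_mx_row mulmx0 mulmx1. Qed.

Lemma pcount_extremal_forms :
  (Hr q r e n + \sum_(i < n) q ^ i <= pcount (eval_space extremal_forms))%N.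
Proof.
have WH : (eval_space extremal_forms <= Hom F n.+1 e.+1)%VS := eval_space_Hom extremal_forms.
have zE (x : 'rV[F]_n.+1) : (forall i, (i < r)%N -> (prod_form (Omega_item i)).@[x 0] = 0) ->
    x \in zset (eval_space extremal_forms).
  move=> h; rewrite zset_eval; apply/forallP => i.
  by rewrite tnth_mktuple dhomog_prod_formE ?Omega_item_in // h.
rewrite (pcount_cut split_std WH) addnC leq_add //.
  rewrite -(leq_pmul2l q1_gt0) (pcountE (restr_inclB_Hom BE WH)) -predn_exp.
  rewrite -subn1 -card_rV -cardsT [X in (X - _ <= _)%N](cardsD1 0%R) inE addKn.
  apply: subset_leq_card; apply: setSD; apply/subsetP => y _.
  rewrite zset_restr; apply: zE => i _; rewrite prod_form_eval.
  have -> : inclB BE y 0 ord0 = 0.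
    by rewrite /inclB mul_BE row_mx_ord0 mxE.
  by rewrite !mul0r.
have lth : (Hr q r e n < q ^ n)%N.
  by rewrite HrE; apply: qval_lt => // i _; apply: entry_lt.
(* One chart point for each number k below H_r, with the digits of k, leading digit first, as
   indices of its coordinates. *)
pose y (k : 'I_(Hr q r e n)) : 'rV[F]_n := \row_i enum_elt (dig q (n - i.+1) k).
have inj_y : injective y.
  move=> k k' /rowP eqy; apply: val_inj => /=.
  rewrite -(qval_dig q_gt1 (ltn_trans (ltn_ord k) lth)) -(qval_dig q_gt1 (ltn_trans (ltn_ord k') lth)).
  apply: eq_qval => i lti; have := eqy (Ordinal lti); rewrite !mxE /=.
  by apply: enum_elt_inj; apply: dig_lt.
rewrite -[leqLHS]card_ord -(card_imset _ inj_y); apply: subset_leq_card.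
apply/subsetP => _ /imsetP[k _ ->]; rewrite zset_restr.
have -> : chart vE BE (y k) = affine_pt (fun i => dig q (n - i.+1) k).
  rewrite /chart mul_BE; apply/rowP => i; rewrite mxE.
  case: (unliftP ord0 i) => [j ->|->]; first by rewrite affine_ptS !row_mx_lift !mxE add0r.
  by rewrite affine_pt0 !row_mx_ord0 !mxE addr0.
apply: zE => i lti; apply/eqP/negPn/negP; rewrite prod_form_pt => [|j _]; last exact: dig_lt.
(* If a form does not vanish at the point of k, the digits of k dominate its item, whose value is
   then at most k; but this value is at least H_r, which exceeds k. *)
move=> /forallP le.
have : (omega_val q (Omega_item i) <= k)%N.
  rewrite -(qval_dig q_gt1 (ltn_trans (ltn_ord k) lth)); apply: leq_qval => j ltj.
  exact: le (Ordinal ltj).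
have : (k < omega_val q (Omega_item i))%N.
  apply: leq_trans (ltn_ord k) _; rewrite HrE.
  by apply: omega_val_mono => //; apply: (Omega_seq_le _ r_gt0 r_le_size lti).
by rewrite ltnNge => /negP.
Qed.

End LowerBound.

(* The formula for the maximal number of rational zeros *)
Local Close Scope ring_scope.

Theorem corollary8 (q : nat) (Fq : finFieldType) (card_Fq : #|Fq| = q)
    (m d r : nat) (m_ge1 : 1 <= m) (d_ge1 : 1 <= d)
    (r_ge1 : 1 <= r) (r_le : r <= 'C(m + d - 1, d - 1))
    (q_ge : (d - 1) ^ 2 <= q) :
  max_rational_zeros Fq m r d = Hr q r (d - 1) m + proj_card q (m - 1).
Proof.
subst q; case: d d_ge1 r_le q_ge => // e _; rewrite subSS subn0 addnS subSS subn0.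
move=> r_le; rewrite -mulnn => le_e.
have lt_e := sq_lt le_e; have q_gt1 := card_gt1 Fq.
have {}r_le : (r <= pdim m e.+1)%N by rewrite /pdim -bin_sub ?leq_addr // addKn.
have -> : proj_card #|Fq| (m - 1) = (\sum_(i < m) #|Fq| ^ i)%N.
  by rewrite /proj_card subn1 prednK.
apply/eqP; rewrite eqn_leq; apply/andP; split.
  apply/bigmax_leqP => t ft.
  rewrite (card_rational_zeros t) addnC -leq_subLR.
  apply: tail_count_Hr => //; apply: (proj_bound le_e (eval_space_Hom t)) => //.
  by rewrite dim_eval_space.
apply: leq_trans (pcount_extremal_forms lt_e r_ge1 r_le) _.
rewrite -card_rational_zeros; rewrite /max_rational_zeros.
exact: (@leq_bigmax_cond _ (fun t : r.-tuple (finvect_type (dhomog m.+1 Fq e.+1)) => free t)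
  (fun t => #|rational_zeros t|) (extremal_forms Fq m e r) (extremal_forms_free lt_e r_le)).
Qed.
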